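(* Let $f=(f(u,v),\ u\ge 0,\ v\in\mathbb{R})$ be a real-valued function of two variables. For a class $\mathcal V$ of continuous semimartingales vanishing at $0$, say that $f$ is a solution of the functional equation with domain of validity $\mathcal V$ if for all $X,Y\in\mathcal V$ and each $t\ge 0$ $$f(\langle X\rangle_t, X_t)\,f(\langle Y\rangle_t, Y_t)=f(\langle X+Y\rangle_t,\ X_t+Y_t+\langle X,Y\rangle_t)\qquad P\text{-a.s.}$$ Each of the assertions a) $f$ is a continuous strictly positive solution of the functional equation with domain of validity $\mathcal V=\mathcal S$; b) $f$ is a continuous strictly positive solution of the functional equation with domain of validity $\mathcal V=\mathcal M^W(I)$; c) there is a constant $c\in\mathbb{R}$ such that $f(u,v)=e^{cv-\frac{c}{2}u}$ for all $u\ge 0$, $v\in\mathbb{R}$; is equivalent to d) $f$ is a continuous strictly positive function such that $f(0,0)=1$ and, for some constants $\lambda_1\in\mathbb{R}$ and $\lambda_2\in\mathbb{R}$, the processes $$\frac{f(t,W_t)}{e^{\lambda_1 t}},\qquad \frac{f^2(t,W_t)}{e^{\lambda_2 t}},\qquad \frac{f(4t,2W_t+t)}{e^{\lambda_2 t}},\qquad t\ge 0,$$ are martingales.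
   Context: $(\Omega,\mathcal F,P)$ is a complete probability space with a filtration $(\mathcal F_t)_{t\ge 0}$ satisfying the usual conditions of right-continuity and completeness, and $W=(W_t)_{t\ge0}$ is a standard Brownian motion with respect to this filtration. $(\mathcal F^W_t)_{t\ge0}$ is the filtration generated by $W$; the martingales in d) are with respect to $(\mathcal F^W_t)$ and $P$. $\mathcal S$ is the class of continuous semimartingales $X$ (with respect to $(\mathcal F_t)$) with $X_0=0$. For $X,Y\in\mathcal S$, $\langle X\rangle$ is the square characteristic (quadratic variation) of the martingale part of $X$, and $\langle X,Y\rangle$ is the mutual characteristic (quadratic covariation) of $X$ and $Y$. $\mathcal M^W(I)$ is the class of stochastic integrals $h\cdot W=\int_0^{\cdot}h_u\,dW_u$ with deterministic integrands of the form $h_u=I_{[a\le u\le b]}$, where $0\le a\le b$. Here $f^2(t,x)$ denotes $(f(t,x))^2$. *)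

(* Defs.v *)
From HB Require Import structures.
From mathcomp Require Import all_boot all_order all_algebra.
From mathcomp Require Import all_classical all_reals all_analysis.
Import Order.TTheory GRing.Theory Num.Theory.
Import numFieldNormedType.Exports.

Set Implicit Arguments.
Unset Strict Implicit.
Unset Printing Implicit Defensive.

Local Open Scope classical_set_scope.
Local Open Scope ring_scope.

(* A process is a function [X : R -> T -> R]; only its values at times [t >= 0]
   are ever used.  Processes are considered up to a null set: path properties
   (continuity, monotonicity, vanishing at 0, ...) are required almost surely.
   A filtration is a family [F : R -> set (set T)] of sigma-algebras. *)

Definition process (R : realType) (T : Type) := R -> T -> R.

Record usual_filtration d (T : measurableType d) (R : realType)
    (P : probability T R) (F : R -> set (set T)) : Prop := {
  filtration_sigma : forall t : R, 0 <= t -> sigma_algebra setT (F t);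
  filtration_measurable : forall t : R, 0 <= t -> F t `<=` measurable;
  filtration_le : forall s t : R, 0 <= s -> s <= t -> F s `<=` F t;
  filtration_right : forall t : R, 0 <= t ->
    \bigcap_(s in [set s | t < s]) F s `<=` F t;
  filtration_complete : P.-negligible `<=` F 0
}.

Definition measurable_wrt (R : realType) (T : Type)
    (G : set (set T)) (X : T -> R) : Prop :=
  forall B : set R, measurable B -> G (X @^-1` B).

Definition adapted (R : realType) (T : Type)
    (F : R -> set (set T)) (X : process R T) : Prop :=
  forall t : R, 0 <= t -> measurable_wrt (F t) (X t).

Definition natural_filtration (R : realType) (T : Type)
    (W : process R T) (t : R) : set (set T) :=
  <<s [set A | exists2 s, 0 <= s <= t &
         exists2 B : set R, measurable B & A = W s @^-1` B] >>.

(* [Y] is a version of the conditional expectation of [X] given [G]. *)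
Definition is_condexp d (T : measurableType d) (R : realType)
    (P : probability T R) (G : set (set T)) (X Y : T -> R) : Prop :=
  [/\ measurable_wrt G Y,
      P.-integrable setT (EFin \o Y) &
      forall A, G A ->
        (\int[P]_(w in A) (Y w)%:E = \int[P]_(w in A) (X w)%:E)%E].

Definition martingale d (T : measurableType d) (R : realType)
    (P : probability T R) (F : R -> set (set T)) (X : process R T) : Prop :=
  [/\ adapted F X,
      (forall t : R, 0 <= t -> P.-integrable setT (EFin \o X t)) &
      forall s t : R, 0 <= s -> s <= t -> is_condexp P (F s) (X t) (X s)].

Definition continuous_paths d (T : measurableType d) (R : realType)
    (P : probability T R) (X : process R T) : Prop :=
  {ae P, forall w, {within `[0, +oo[, continuous (X ^~ w)}}.

Definition starts_at0 d (T : measurableType d) (R : realType)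
    (P : probability T R) (X : process R T) : Prop :=
  {ae P, forall w, X 0 w = 0}.

Record brownian_motion d (T : measurableType d) (R : realType)
    (P : probability T R) (F : R -> set (set T)) (W : process R T) : Prop := {
  brownian_adapted : adapted F W;
  brownian_start : starts_at0 P W;
  brownian_continuous : continuous_paths P W;
  brownian_normal : forall s t : R, 0 <= s -> s < t ->
    forall B : set R, measurable B ->
      P ((fun w => W t w - W s w) @^-1` B) =
      normal_prob 0 (Num.sqrt (t - s)) B;
  brownian_independent : forall s t : R, 0 <= s -> s < t ->
    forall A, F s A -> forall B : set R, measurable B ->
      (P (A `&` (fun w => (W t w - W s w)%R) @^-1` B) =
       P A * P ((fun w => (W t w - W s w)%R) @^-1` B))%E
}.

Definition stopping_time (R : realType) (T : Type)
    (F : R -> set (set T)) (tau : T -> \bar R) : Prop :=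
  (forall w, (0 <= tau w)%E) /\
  (forall t : R, 0 <= t -> F t [set w | (tau w <= t%:E)%E]).

Definition stopped (R : realType) (T : Type)
    (tau : T -> \bar R) (X : process R T) : process R T :=
  fun t w => X (fine (Order.min t%:E (tau w))) w.

(* Since the processes themselves are stopped (rather than their increments),
   this is meant for processes vanishing at 0. *)
Definition local_martingale d (T : measurableType d) (R : realType)
    (P : probability T R) (F : R -> set (set T)) (X : process R T) : Prop :=
  exists tau : nat -> T -> \bar R,
    [/\ forall n, stopping_time F (tau n),
        {ae P, forall w, forall m n, (m <= n)%N -> (tau m w <= tau n w)%E},
        {ae P, forall w, tau ^~ w @ \oo --> +oo%E} &
        forall n, martingale P F (stopped (tau n) X)].

Definition continuous_local_martingale0 d (T : measurableType d)
    (R : realType) (P : probability T R) (F : R -> set (set T))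
    (M : process R T) : Prop :=
  [/\ local_martingale P F M, continuous_paths P M & starts_at0 P M].

Definition continuous_fv0 d (T : measurableType d)
    (R : realType) (P : probability T R) (F : R -> set (set T))
    (A : process R T) : Prop :=
  [/\ adapted F A, continuous_paths P A, starts_at0 P A &
      {ae P, forall w, forall t : R, 0 <= t -> bounded_variation 0 t (A ^~ w)}].

(* [M] is the martingale part of the continuous semimartingale [X], [X_0 = 0]
   (it is unique up to indistinguishability). *)
Definition martingale_part d (T : measurableType d) (R : realType)
    (P : probability T R) (F : R -> set (set T)) (X M : process R T) : Prop :=
  continuous_local_martingale0 P F M /\
  continuous_fv0 P F (fun t w => X t w - M t w).

Definition semimartingale0 d (T : measurableType d) (R : realType)
    (P : probability T R) (F : R -> set (set T)) (X : process R T) : Prop :=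
  exists M, martingale_part P F X M.

(* [Q] is a version of <X>: the increasing compensator of the square of the
   martingale part of [X]. *)
Definition characteristic d (T : measurableType d) (R : realType)
    (P : probability T R) (F : R -> set (set T)) (X Q : process R T) : Prop :=
  exists2 M, martingale_part P F X M &
    [/\ adapted F Q, continuous_paths P Q, starts_at0 P Q,
        {ae P, forall w, {in `[0, +oo[ &, nondecreasing_fun (Q ^~ w)}} &
        local_martingale P F (fun t w => M t w ^+ 2 - Q t w)].

(* [C] is a version of <X, Y>: the finite-variation compensator of the product
   of the martingale parts of [X] and [Y]. *)
Definition mutual_characteristic d (T : measurableType d) (R : realType)
    (P : probability T R) (F : R -> set (set T)) (X Y C : process R T) : Prop :=
  exists M N, [/\ martingale_part P F X M, martingale_part P F Y N,
    continuous_fv0 P F C &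
    local_martingale P F (fun t w => M t w * N t w - C t w)].

(* A step integrand sum_i c_i 1_(a_i, b_i] is encoded by the list of the
   triples (c_i, a_i, b_i). *)
Definition step_integrand (R : realType) (l : seq (R * R * R)) : Prop :=
  forall c a b, (c, a, b) \in l -> 0 <= a <= b.

Definition step_fun (R : realType) (l : seq (R * R * R)) (u : R) : R :=
  \sum_(x <- l) x.1.1 * \1_(`]x.1.2, x.2] : set R) u.

Definition step_integral (R : realType) (T : Type)
    (W : process R T) (l : seq (R * R * R)) : process R T :=
  fun t w => \sum_(x <- l)
    x.1.1 * (W (Num.min t x.2) w - W (Num.min t x.1.2) w).

(* [X] is (a continuous version of) the stochastic integral [h . W] of the
   deterministic integrand [h]: for each [t >= 0], [X t] is the L^2(P)-limit of
   integrals of step integrands converging to [h] in L^2([0, t]). *)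
Definition stochastic_integral d (T : measurableType d) (R : realType)
    (P : probability T R) (F : R -> set (set T)) (W : process R T)
    (h : R -> R) (X : process R T) : Prop :=
  [/\ adapted F X, continuous_paths P X &
      forall t : R, 0 <= t -> exists l : nat -> seq (R * R * R),
        [/\ forall n, step_integrand (l n),
            (\int[lebesgue_measure]_(u in `[0%R, t])
               ((step_fun (l n) u - h u) ^+ 2)%:E)%E @[n --> \oo] --> 0%E &
            (\int[P]_w ((X t w - step_integral W (l n) t w) ^+ 2)%:E)%E
               @[n --> \oo] --> 0%E]].

Definition indicator_integrals d (T : measurableType d) (R : realType)
    (P : probability T R) (F : R -> set (set T)) (W : process R T)
    (X : process R T) : Prop :=
  exists a b : R, 0 <= a <= b /\
    stochastic_integral P F W (\1_(`[a, b] : set R)) X.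

(* Only the values of [f u v] for [u >= 0] matter. *)
Definition continuous_positive (R : realType) (f : R -> R -> R) : Prop :=
  {within [set p : R * R | 0 <= p.1], continuous (fun p => f p.1 p.2)} /\
  (forall u v : R, 0 <= u -> 0 < f u v).

(* The characteristics are only defined up to indistinguishability, so the
   equation is required for all their versions. *)
Definition solves_on d (T : measurableType d) (R : realType)
    (P : probability T R) (F : R -> set (set T))
    (V : process R T -> Prop) (f : R -> R -> R) : Prop :=
  forall X Y, V X -> V Y ->
  forall QX QY QXY C : process R T,
    characteristic P F X QX ->
    characteristic P F Y QY ->
    characteristic P F (fun t w => X t w + Y t w) QXY ->
    mutual_characteristic P F X Y C ->
  forall t : R, 0 <= t ->
    {ae P, forall w,
       f (QX t w) (X t w) * f (QY t w) (Y t w) =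
       f (QXY t w) (X t w + Y t w + C t w)}.

(* Main.v *)
Require Import Defs.
From HB Require Import structures.
From mathcomp Require Import all_boot all_order all_algebra.
From mathcomp Require Import all_classical all_reals all_analysis.
From mathcomp Require Import measurable_realfun.
From mathcomp Require Import ring lra.
Import Order.TTheory GRing.Theory Num.Theory.
Import numFieldNormedType.Exports.
Local Open Scope classical_set_scope.
Local Open Scope ring_scope.

(* For d) => c), write [u t x = f t x / exp (l1 t)]. The martingale properties say that the gaussian
   averages of [u (s + r^2)] and of its square around [x], at scale [r], are [u s x] and
   [exp (k r^2) (u s x)^2] with [k = l2 - 2 l1]. Tilting the gaussian measure, one computes the L^2
   distance between [y |-> u (s + r^2) (x + r y)] and the exponential [u s x * exp (b y - b^2 / 2)];
   it is nonnegative, so [u s] grows at most like [exp (sqrt k |x|)], and it vanishes when this rate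
   is attained. Midpoint convexity of [ln u] and the second moment for small [r] show that the rate
   is attained, so [u] is an exponential; the third martingale at times 0 and 1 gives the remaining
   relation between the constants.

   For a) => c) and b) => c), both classes contain the increments [W (t /\ b) - W (t /\ a)]. Adjacent
   increments give [f s x * f r y = f (s + r) (x + y)] and a doubled one gives
   [f s x ^ 2 = f (4 s) (2 x + s)], almost surely and hence everywhere, since Brownian increments
   have full support.

   For c) => a) and c) => b), the equation reduces to [<X + Y> = <X> + <Y> + 2 <X, Y>] for all versions
   of the brackets, that is, to the fact that a continuous local martingale of bounded variation
   vanishes. This is proved by discretization: summing the Taylor expansion of
   [sqrt (1 + x^2) - 1] along a fine partition, the first order terms have mean zero and the second
   order ones are bounded by the largest increment times the variation. *)

Set Implicit Arguments.
Unset Strict Implicit.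
Unset Printing Implicit Defensive.

(** * Gaussian integrals *)

(** No growth bound and no derivative of [f] is given, so neither Ito's formula nor a uniqueness
    theorem for the heat equation applies directly: all information on [u] comes from positivity and
    gaussian averages. At time 0 the law of [W] is a point mass, so the martingales speak about
    every [x] only at positive times, and [f 0 x] is recovered by continuity. Even at a positive
    time the averaging identity first holds for almost every [x]; without a dominating function the
    average is not known to be continuous in [x], and an approximate midpoint convexity of it takes
    the place of continuity. The rate [sqrt k] comes from making the two exponentials in the L^2
    distance equal. In c) => a), brackets are arbitrary versions, with possibly different martingale
    parts and localizing sequences, so uniqueness is needed in that generality. The stopped
    martingales are merely integrable, which excludes squares; [sqrt (1 + x^2) - 1] is quadratic
    near 0 but grows linearly, so integrability suffices, and stopping takes place on the partition
    instead of in continuous time. *)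

Section push.
Context d d' (T1 : measurableType d) (T2 : measurableType d') (R : realType).
Variables (m : {measure set T1 -> \bar R}) (f : T1 -> T2).
Hypothesis mf : measurable_fun [set: T1] f.

Definition push : {measure set T2 -> \bar R} :=
  measure_function_pushforward__canonical__measure_function_Measure m mf.

Lemma pushE A : push A = m (f @^-1` A). Proof. by []. Qed.

Lemma integral_push (h : T2 -> \bar R) : measurable_fun setT h ->
  (forall y, 0 <= h y)%E -> (\int[push]_y h y = \int[m]_x h (f x))%E.
Proof. by move=> mh h0; rewrite ge0_integral_pushforward. Qed.
End push.

Section gauss.
Context {R : realType}.
Local Notation mu := (@lebesgue_measure R).
Local Notation gam := (@normal_prob R 0 1).
Implicit Types (g : R -> \bar R) (a b r s x y : R).

Lemma integral_normal_prob m s g : measurable_fun setT g ->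
  (forall x, (0 <= g x)%E) ->
  (\int[normal_prob m s]_x g x = \int[mu]_x (g x * (normal_pdf m s x)%:E))%E.
Proof.
move=> mg g0.
rewrite -(Radon_Nikodym_SigmaFinite.change_of_variables
  (normal_prob_dominates m s) g0)//.
have nd := normal_prob_dominates m s.
apply: ae_eq_integral => //.
- apply: emeasurable_funM => //.
  exact: measurable_int (Radon_Nikodym_SigmaFinite.f_integrable _).
- apply: emeasurable_funM => //; apply/measurable_EFinP.
  exact: measurable_normal_pdf.
- apply: ae_eqe_mul2l.
  apply: integral_ae_eq => //.
  + exact: Radon_Nikodym_SigmaFinite.f_integrable.
  + by apply/measurable_EFinP; exact: measurable_normal_pdf.
  + by move=> E _ mE; rewrite -Radon_Nikodym_SigmaFinite.f_integral.
Qed.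

(** The rescaled pushforward takes the value [d - c] on []c, d]], and Lebesgue measure is the only
    measure that does. *)
Lemma lebesgue_affine s a : 0 < s -> forall A : set R, measurable A ->
  mu A = (s%:E * mu ((fun x => (s * x + a)%R) @^-1` A))%E.
Proof.
move=> s0 A mA.
have mf : measurable_fun setT (fun x : measurableTypeR R => s * x + a : measurableTypeR R).
  by apply: measurable_funD => //; exact: measurable_funM.
pose m := mscale (NngNum (ltW s0)) (push mu mf).
suff: mu A = m A by [].
apply: lebesgue_measure_unique => // _ [[c d]] _ <-.
change (mu `]c, d] = s%:E * mu ((fun x => (s * x + a)%R) @^-1` `]c, d]))%E.
rewrite [X in (_ * mu X)%E](_ : _ = `](c - a) / s, (d - a) / s]%classic); last first.
  apply/seteqP; split=> x; rewrite /= !in_itv/= => /andP[h1 h2].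
    by rewrite ltr_pdivrMr// ler_pdivlMr// mulrC; apply/andP; split; lra.
  move: h1 h2; rewrite ltr_pdivrMr// ler_pdivlMr// [x * s]mulrC => h1 h2.
  by apply/andP; split; lra.
rewrite !lebesgue_measure_itv/= !lte_fin ltr_pM2r ?invr_gt0// ltrD2r.
case: ifPn => _; last by rewrite mule0.
by rewrite -EFinB -EFinM; congr EFin; field; rewrite gt_eqF.
Qed.

Lemma integral_affine s a g : 0 < s -> measurable_fun setT g ->
  (forall x, (0 <= g x)%E) ->
  (\int[mu]_x g x = s%:E * \int[mu]_x g (s * x + a)%R)%E.
Proof.
move=> s0 mg g0.
have mf : measurable_fun setT (fun x : measurableTypeR R => s * x + a : measurableTypeR R).
  by apply: measurable_funD => //; exact: measurable_funM.
pose m := mscale (NngNum (ltW s0)) (push mu mf).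
transitivity (\int[m]_x g x)%E.
  apply: eq_measure_integral => A mA _.
  exact: lebesgue_affine.
rewrite /m ge0_integral_mscale//; congr (_ * _)%E.
by rewrite integral_push.
Qed.

Lemma integral_normal_scale s g : 0 < s -> measurable_fun setT g ->
  (forall x, (0 <= g x)%E) ->
  (\int[normal_prob 0 s]_x g x = \int[gam]_y g (s * y)%R)%E.
Proof.
move=> s0 mg g0.
have ms : measurable_fun setT (fun x : R => s * x) by exact: measurable_funM.
have mgs : measurable_fun setT (fun y => g (s * y)) by exact: measurableT_comp.
rewrite (integral_normal_prob 0 s mg g0).
rewrite (integral_normal_prob 0 1 mgs (fun y => g0 _)).
rewrite (integral_affine 0 s0)//; last 2 first.
- apply: emeasurable_funM => //; apply/measurable_EFinP.
  exact: measurable_normal_pdf.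
- by move=> x; rewrite mule_ge0// lee_fin normal_pdf_ge0.
rewrite -ge0_integralZl//; last 3 first.
- apply: emeasurable_funM.
    by apply: measurableT_comp => //; apply: measurable_funD.
  apply/measurable_EFinP; apply: measurableT_comp => //.
    exact: measurable_normal_pdf.
  exact: measurable_funD.
- by move=> x _; rewrite mule_ge0// lee_fin normal_pdf_ge0.
- by rewrite lee_fin ltW.
apply: eq_integral => x _; rewrite addr0 muleCA; congr (_ * _)%E.
rewrite -EFinM; congr EFin; rewrite !normal_pdfE ?gt_eqF// /normal_peak /normal_fun.
rewrite !subr0 expr1n mul1r.
rewrite -mulrnAr sqrtrM ?sqr_ge0// sqrtr_sqr gtr0_norm// invfM.
rewrite !mulrA divff ?gt_eqF// mul1r; congr (_ * expR _).
by field; rewrite gt_eqF.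
Qed.

(** The Cameron-Martin formula: after a change of variable, the weight is the ratio of the gaussian
    density centred at [a] to the standard one. *)
Lemma integral_gauss_translate a g : measurable_fun setT g ->
  (forall x, (0 <= g x)%E) ->
  (\int[gam]_y g (y + a)%R = \int[gam]_y (g y * (expR (a * y - a ^+ 2 / 2))%:E))%E.
Proof.
move=> mg g0.
have me : measurable_fun setT (fun y : R => expR (a * y - a ^+ 2 / 2)).
  apply: measurableT_comp => //; apply: measurable_funB => //.
have md : measurable_fun setT (fun y : R => y + a) by exact: measurable_funD.
have mgd : measurable_fun setT (fun y => g (y + a)) by exact: measurableT_comp.
have mge : measurable_fun setT (fun y => g y * (expR (a * y - a ^+ 2 / 2))%:E)%E.
  by apply: emeasurable_funM => //; exact/measurable_EFinP.
have ge0 y : (0 <= g y * (expR (a * y - a ^+ 2 / 2))%:E)%E.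
  by rewrite mule_ge0// lee_fin expR_ge0.
rewrite (integral_normal_prob 0 1 mgd (fun y => g0 _)).
rewrite (integral_normal_prob 0 1 mge ge0).
rewrite [RHS](integral_affine a ltr01)//; last 2 first.
- apply: emeasurable_funM; first by apply: emeasurable_funM => //; exact/measurable_EFinP.
  by apply/measurable_EFinP; exact: measurable_normal_pdf.
- by move=> x; rewrite !mule_ge0// lee_fin ?expR_ge0 ?normal_pdf_ge0.
rewrite mul1e; apply: eq_integral => x _; rewrite mul1r -muleA; congr (_ * _)%E.
rewrite -EFinM; congr EFin; rewrite normal_pdfE ?oner_eq0// /normal_fun !subr0.
rewrite mulrCA; congr (_ * _); rewrite -expRD; congr expR.
by rewrite expr1n; field.
Qed.

Lemma integral_gauss_opp g : measurable_fun setT g ->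
  (forall x, (0 <= g x)%E) ->
  (\int[gam]_y g (- y)%R = \int[gam]_y g y)%E.
Proof.
move=> mg g0.
have mN : measurable_fun setT (fun y : measurableTypeR R => - y : measurableTypeR R).
  exact: oppr_measurable.
have mgN : measurable_fun setT (fun y => g (- y)) by exact: (measurableT_comp mg).
rewrite (integral_normal_prob 0 1 mgN (fun y => g0 _)).
rewrite (integral_normal_prob 0 1 mg g0).
have mh : measurable_fun setT (fun x : measurableTypeR R => g x * (normal_pdf 0 1 x)%:E)%E.
  apply: emeasurable_funM => //; apply/measurable_EFinP.
  exact: measurable_normal_pdf.
have h0 x : (0 <= g x * (normal_pdf 0 1 x)%:E)%E.
  by rewrite mule_ge0// lee_fin normal_pdf_ge0.
transitivity (\int[push mu mN]_x (g x * (normal_pdf 0 1 x)%:E))%E.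
  transitivity (\int[mu]_x (g (- x)%R * (normal_pdf 0 1 (- x))%:E))%E.
    apply: eq_integral => x _; congr (_ * (_)%:E)%E.
    by rewrite !normal_pdfE ?oner_eq0// /normal_fun !subr0 sqrrN.
  exact: (esym (integral_push mu mN mh h0)).
by apply: eq_measure_integral => A mA _; exact: lebesgue_measureN.
Qed.

Lemma integral_gauss_cst (k : \bar R) : (0 <= k)%E -> (\int[gam]_y k = k)%E.
Proof.
by move=> k0; rewrite (integral_cst gam)//= [X in (_ * X)%E](probability_setT gam) mule1.
Qed.

Lemma integral_gauss_expR a :
  (\int[gam]_y (expR (a * y))%:E = (expR (a ^+ 2 / 2))%:E)%E.
Proof.
have mid : measurable_fun setT (fun x : R => a * x) by exact: measurable_funM.
have m1 : measurable_fun setT (fun _ : R => 1%E : \bar R) by [].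
have l1 (y : R) : (0 <= 1 :> \bar R)%E by [].
have := integral_gauss_translate a m1 l1.
rewrite (integral_gauss_cst (l1 0)) => /esym.
under eq_integral do rewrite mul1e expRD EFinM.
rewrite ge0_integralZr//; last by apply/measurable_EFinP; exact: measurableT_comp.
move=> /(congr1 (fun z => z * (expR (a ^+ 2 / 2))%:E)%E).
by rewrite -muleA -EFinM -expRD addNr expR0 mule1 mul1e.
Qed.

(** Multiplied by the standard density, the integrand is [q^-1] times the centred normal density of
    standard deviation [q^-1]. *)
Lemma integral_gauss_exp_sqr q : 0 < q ->
  (\int[gam]_y (expR ((1 - q ^+ 2) / 2 * y ^+ 2))%:E = (q^-1)%:E)%E.
Proof.
move=> q0.
have me : measurable_fun setT (fun x : R => expR ((1 - q ^+ 2) / 2 * x ^+ 2)).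
  by apply: measurableT_comp => //; apply: measurable_funM => //; exact: measurable_funX.
move/measurable_EFinP in me.
rewrite (integral_normal_prob 0 1 me)//; last first.
  by move=> x; rewrite lee_fin expR_ge0.
under eq_integral => x _.
  rewrite -EFinM [X in X%:E](_ : _ = q^-1 * normal_pdf 0 q^-1 x); last first.
    rewrite !normal_pdfE ?oner_eq0 ?invr_eq0 ?gt_eqF//.
    rewrite /normal_peak /normal_fun !subr0 expr1n mul1r.
    rewrite -[in RHS]mulrnAr sqrtrM ?sqr_ge0// sqrtr_sqr gtr0_norm ?invr_gt0//.
    rewrite mulrCA invfM invrK !mulrA mulVf ?gt_eqF// mul1r -mulrA -expRD.
    by congr (_ * expR _); field; rewrite gt_eqF.
  rewrite EFinM; over.
rewrite ge0_integralZl//; last 3 first.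
- by apply/measurable_EFinP; exact: measurable_normal_pdf.
- by move=> x _; rewrite lee_fin normal_pdf_ge0.
- by rewrite lee_fin invr_ge0 ltW.
by rewrite integral_normal_pdf mule1.
Qed.

(** The hypothesis is [1 + z <= exp z] integrated for [z = (1 - q^2) / 2 * y^2], with [J] the second
    moment. Taking [q = 1 - e] bounds [J] from above and [q = 1 + e] from below. *)
Lemma gauss_sqr_squeeze (J : R) : 0 <= J ->
  (forall q : R, 0 < q -> 1 + (1 - q ^+ 2) / 2 * J <= q^-1) -> J = 1.
Proof.
move=> J0 key.
have h e : 0 < e < 1 -> J * ((2 - e) * (1 - e)) <= 2 <= J * ((2 + e) * (1 + e)).
  move=> /andP[e0 e1].
  have p1 : 0 < 1 - e by lra.
  have p2 : 0 < 1 + e by lra.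
  have := key _ p1; rewrite -[(1 - e)^-1]mul1r ler_pdivlMr// => k1.
  have := key _ p2; rewrite -[(1 + e)^-1]mul1r ler_pdivlMr// => k2.
  apply/andP; split; rewrite -(ler_pM2l e0); lra.
apply/eqP; rewrite eq_le; apply/andP; split; rewrite leNgt; apply/negP => J1.
  (* This [e] gives [J * e = (J - 1) / 3], so that [2 * J - 3 * J * e = J + 1] already exceeds 2. *)
  have e01 : 0 < (J - 1) / (3 * J) < 1.
    apply/andP; split; first by rewrite divr_gt0//; lra.
    by rewrite ltr_pdivrMr; lra.
  have /andP[+ _] := h _ e01.
  have Je : J * ((J - 1) / (3 * J)) = (J - 1) / 3 by field; lra.
  move: e01 Je; set e := _ / _ => /andP[e0 e1] Je.
  rewrite (_ : J * ((2 - e) * (1 - e)) = 2 * J - 3 * (J * e) + J * e * e); last by ring.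
  rewrite Je.
  have : 0 <= (J - 1) / 3 * e by rewrite mulr_ge0 ?ltW//; lra.
  lra.
(* As [(2 + e) * (1 + e) <= 2 + 4 * e], this [e] yields [2 <= J * (3 - J)], which fails for
   [J < 1]. *)
have e01 : 0 < (1 - J) / 4 < 1 by apply/andP; split; lra.
have /andP[_ +] := h _ e01; move: e01; set e := _ / _ => /andP[e0 e1].
have : J * ((2 + e) * (1 + e)) <= J * (2 + 4 * e) by apply: ler_wpM2l => //; nra.
rewrite /e; nra.
Qed.

(* [y ^ 2] is squeezed between difference quotients of [exp (e y ^ 2)]. *)
Lemma integral_gauss_sqr : (\int[gam]_y (y ^+ 2)%:E = 1)%E.
Proof.
have mX : measurable_fun setT (fun x : R => (x ^+ 2)%:E).
  by apply/measurable_EFinP; exact: measurable_funX.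
have X0 : forall x : R, setT x -> (0 <= (x ^+ 2)%:E)%E.
  by move=> x _; rewrite lee_fin sqr_ge0.
have mexp e : measurable_fun setT (fun x : R => (expR (e * x ^+ 2))%:E).
  apply/measurable_EFinP; apply: measurableT_comp => //.
  by apply: measurable_funM => //; exact: measurable_funX.
set I := integral _ _ _.
have I0 : (0 <= I)%E by exact: integral_ge0.
have key q : 0 < q -> (1 + ((1 - q ^+ 2) / 2)%:E * I <= (q^-1)%:E)%E \/ I = +oo%E.
  move=> q0; set e := (1 - q ^+ 2) / 2.
  have [Ioo|Ifin] := eqVneq I +oo%E; [by right|left].
  have iX : gam.-integrable setT (fun x : R => (x ^+ 2)%:E).
    apply/integrableP; split => //.
    under eq_integral do rewrite abse_EFin ger0_norm ?sqr_ge0//.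
    by rewrite -/I ltey.
  rewrite -(integral_gauss_exp_sqr q0) -/e.
  rewrite -[X in (X + _ <= _)%E](@integral_gauss_cst 1%E)//.
  rewrite -integralZl// -integralD//=; last 2 first.
  - exact: finite_measure_integrable_cst.
  - exact: integrableZl.
  apply: le_integral => //.
  - apply: integrableD => //; first exact: finite_measure_integrable_cst.
    exact: integrableZl.
  - apply/integrableP; split; first exact: mexp.
    under eq_integral do rewrite abse_EFin ger0_norm ?expR_ge0//.
    by rewrite integral_gauss_exp_sqr// ltry.
  - by move=> x _; rewrite -EFinM -EFinD lee_fin; exact: expR_ge1Dx.
(* At [q = 1 / 2] the exponent is [3 / 8 * y^2]; the factor 3 is enough for
   [y^2 <= 3 * (1 + 3 / 8 * y^2)]. *)
have Ifin : I \is a fin_num.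
  rewrite ge0_fin_numE//.
  apply: (@le_lt_trans _ _ (\int[gam]_y (3 * (expR ((1 - (1/2) ^+ 2) / 2 * y ^+ 2)))%:E)%E).
    apply: ge0_le_integral => //.
    - apply/measurable_EFinP; apply: measurable_funM => //.
      by apply/measurable_EFinP; exact: mexp.
    - move=> x _; rewrite lee_fin.
      have := @expR_ge1Dx R ((1 - (1/2) ^+ 2) / 2 * x ^+ 2).
      have := sqr_ge0 x; lra.
  under eq_integral do rewrite EFinM.
  rewrite ge0_integralZl//; last exact: mexp.
  by rewrite integral_gauss_exp_sqr// -EFinM ltry.
have {key} : forall q, 0 < q -> 1 + (1 - q ^+ 2) / 2 * fine I <= q^-1.
  move=> q q0; have [|Ioo] := key q q0; last by move: Ifin; rewrite Ioo.
  by rewrite -{1}(fineK Ifin) -EFinM -EFinD lee_fin.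
have J0 : 0 <= fine I by rewrite fine_ge0.
rewrite -(fineK Ifin); move: (fine I) J0 => J J0 key; congr EFin.
exact: gauss_sqr_squeeze.
Qed.

(* The sum with the reflected integral has no odd term. *)
Lemma integral_gauss_sqrD x r :
  (\int[gam]_y ((x + r * y) ^+ 2)%:E = (x ^+ 2 + r ^+ 2)%:E)%E.
Proof.
have mX z s : measurable_fun setT (fun y : R => ((z + s * y) ^+ 2)%:E).
  by apply/measurable_EFinP; apply: measurable_funX; apply: measurable_funD.
have X0 z s y : (0 <= ((z + s * y) ^+ 2)%:E)%E by rewrite lee_fin sqr_ge0.
have E : (\int[gam]_y ((x + r * y) ^+ 2)%:E + \int[gam]_y ((x + r * y) ^+ 2)%:E
          = (2 * (x ^+ 2 + r ^+ 2))%:E)%E.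
  rewrite -[X in (_ + X)%E](integral_gauss_opp (mX x r))//.
  have mXN : measurable_fun setT (fun y : R => ((x + r * - y) ^+ 2)%:E).
    by under eq_fun do rewrite mulrN -mulNr; exact: mX.
  rewrite -ge0_integralD//; last exact: mX.
  under eq_integral => y _.
    rewrite -EFinD [X in X%:E](_ : _ = 2 * x ^+ 2 + 2 * r ^+ 2 * y ^+ 2); last by ring.
    rewrite EFinD [(_ * y ^+ 2)%:E]EFinM; over.
  rewrite ge0_integralD//; first last.
  - by apply/measurable_EFinP; apply: measurable_funM => //; exact: measurable_funX.
  - by move=> y _; rewrite -EFinM lee_fin -mulrA -exprMn mulr_ge0 ?sqr_ge0.
  - by move=> y _; rewrite lee_fin mulr_ge0// sqr_ge0.
  rewrite integral_gauss_cst; last by rewrite lee_fin mulr_ge0// sqr_ge0.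
  rewrite ge0_integralZl//; last 3 first.
  - by apply/measurable_EFinP; exact: measurable_funX.
  - by move=> y _; rewrite lee_fin sqr_ge0.
  - by rewrite lee_fin mulr_ge0 ?sqr_ge0.
  by rewrite integral_gauss_sqr mule1 -EFinD -mulrDr.
have : (0 <= \int[gam]_y ((x + r * y) ^+ 2)%:E)%E by exact: integral_ge0.
move: E; case: (integral _ _ _) => // z; rewrite -EFinD => -[E] _.
by congr EFin; lra.
Qed.

(** The density is positive everywhere. Exceptional sets for the law of [W s] thus become
    Lebesgue-null sets, which can be translated and dilated. *)
Lemma normal_prob_eq0 m s (A : set R) : s != 0 -> measurable A ->
  normal_prob m s A = 0%E -> mu A = 0%E.
Proof.
move=> s0 mA A0.
have mp : measurable_fun A (fun x => (normal_pdf m s x)%:E).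
  by apply/measurable_EFinP/measurable_funTS; exact: measurable_normal_pdf.
have [+ _] := ae_eq_integral_abs mu mA mp.
have -> : (\int[mu]_(x in A) `|(normal_pdf m s x)%:E| = normal_prob m s A)%E.
  by apply: eq_integral => x _; rewrite gee0_abs// lee_fin normal_pdf_ge0.
move=> /(_ A0) p0; apply/negligibleP => //.
move: p0; apply: negligibleS => x Ax /=.
move=> /(_ Ax) /= [] /eqP; apply/negP; rewrite gt_eqF// normal_pdfE//.
by rewrite mulr_gt0 ?normal_peak_gt0 ?expR_gt0.
Qed.

Lemma normal_prob_itv_gt0 s a b : s != 0 -> a < b ->
  (0 < normal_prob 0 s `]a, b[)%E.
Proof.
move=> s0 ab; rewrite lt0e measure_ge0 andbT; apply/eqP => /normal_prob_eq0.
move=> /(_ s0 (measurable_itv _)) /eqP; apply/negP.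
by rewrite lebesgue_measure_itv/= lte_fin ab -EFinB eqe subr_eq0 gt_eqF.
Qed.
End gauss.

(** * Rigidity of the heat identity *)

Section ge0_real_integral.
Context d (T : measurableType d) (R : realType) (m : {measure set T -> \bar R}).
Implicit Types (f g : T -> R).

Lemma ge0_integralD_EFin f g : measurable_fun setT f -> measurable_fun setT g ->
  (forall y, 0 <= f y) -> (forall y, 0 <= g y) ->
  (\int[m]_y (f y + g y)%:E = \int[m]_y (f y)%:E + \int[m]_y (g y)%:E)%E.
Proof.
move=> mf mg f0 g0; under eq_integral do rewrite EFinD.
by rewrite ge0_integralD//; first [exact/measurable_EFinP|move=> y _; rewrite lee_fin].
Qed.

Lemma ge0_integralZ_EFin (k : R) f : measurable_fun setT f -> (forall y, 0 <= f y) ->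
  0 <= k -> (\int[m]_y (k * f y)%:E = k%:E * \int[m]_y (f y)%:E)%E.
Proof.
move=> mf f0 k0; under eq_integral do rewrite EFinM.
by rewrite ge0_integralZl//; first [exact/measurable_EFinP|move=> y _; rewrite lee_fin].
Qed.

Lemma ge0_le_integral_EFin f g : measurable_fun setT f -> measurable_fun setT g ->
  (forall y, 0 <= f y) -> (forall y, f y <= g y) ->
  (\int[m]_y (f y)%:E <= \int[m]_y (g y)%:E)%E.
Proof.
move=> mf mg f0 fg; apply: ge0_le_integral => //.
- by move=> y _; rewrite lee_fin.
- exact/measurable_EFinP.
- exact/measurable_EFinP.
- by move=> y _; rewrite lee_fin.
Qed.

End ge0_real_integral.

Section continuous_real.
Context {R : realType}.
Implicit Types (f g : R -> R).

Lemma continuous_addf f g : continuous f -> continuous g ->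
  continuous (fun x => f x + g x).
Proof. by move=> cf cg x; apply: (@continuousD _ _ _ f g); [exact: cf|exact: cg]. Qed.

Lemma continuous_subf f g : continuous f -> continuous g ->
  continuous (fun x => f x - g x).
Proof. by move=> cf cg x; apply: (@continuousB _ _ _ f g); [exact: cf|exact: cg]. Qed.

Lemma continuous_mulf f g : continuous f -> continuous g ->
  continuous (fun x => f x * g x).
Proof. by move=> cf cg x; apply: (@continuousM _ _ f g); [exact: cf|exact: cg]. Qed.

Lemma continuous_compf f g : continuous f -> continuous g ->
  continuous (fun x => g (f x)).
Proof. by move=> cf cg x; apply: (@continuous_comp _ _ _ f g); [exact: cf|exact: cg]. Qed.

Lemma continuous_affine (x r : R) : continuous (fun y => x + r * y).
Proof.
apply: continuous_addf; first by move=> y; exact: cst_continuous.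
by apply: continuous_mulf => y; [exact: cst_continuous|exact: cvg_id].
Qed.

End continuous_real.

(** Around a point where [g] is nonzero there is an interval of such points, and every interval has
    positive gaussian mass. *)
Lemma gauss_ae0_continuous (R : realType) (g : R -> R) : continuous g ->
  (forall y, 0 <= g y) ->
  (\int[normal_prob 0 1]_y (g y)%:E <= 0)%E -> forall y, g y = 0.
Proof.
move=> cg gge0 g0 y; apply/eqP/negPn/negP => gy0.
have mg : measurable_fun setT (fun y => (g y)%:E).
  by apply/measurable_EFinP; exact: continuous_measurable_fun.
have [+ _] := @ae_eq_integral_abs _ _ _ (@normal_prob R 0 1) setT measurableT _ mg.
have {}g0 : (\int[normal_prob 0 1]_y (g y)%:E = 0)%E.
  by apply/eqP; rewrite eq_le g0/=; apply: integral_ge0 => x _; rewrite lee_fin.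
under eq_integral do rewrite gee0_abs ?lee_fin//.
move=> /(_ g0) [N [mN N0 subN]].
have := @cvgr_neq0 R R R (nbhs y) (nbhs_filter y) g (g y) (cg y) gy0.
move=> /nbhs_ballP[e /= e0 eg].
have : (normal_prob 0 1 `](y - e)%R, (y + e)%R[ <= normal_prob 0 1 N)%E.
  apply: le_measure; rewrite ?inE//.
  move=> z /=; rewrite in_itv/= => /andP[z1 z2]; apply: subN => /=.
  move=> /(_ Logic.I)/= [] /eqP; apply/negP; apply: eg.
  by rewrite /ball/= ltr_norml; apply/andP; split; lra.
rewrite N0; apply/negP; rewrite -ltNge; apply: normal_prob_itv_gt0.
  by rewrite oner_eq0.
by move: e0; lra.
Qed.

(** The limit [b -> 0] made explicit: if [X > Y], then [b ^ 2 = ln (X / Y)] makes the factor equal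
    to the square root of [X / Y], which is too small. *)
Lemma le_expR_sqr_mul (R : realType) (X Y : R) : 0 < Y ->
  (forall b, b != 0 -> X <= expR (b ^+ 2 / 2) * Y) -> X <= Y.
Proof.
move=> Y0 h; rewrite leNgt; apply/negP => YX.
have XY : 1 < X / Y by rewrite ltr_pdivlMr// mul1r.
have L0 : 0 < ln (X / Y) by exact: ln_gt0.
have := h (Num.sqrt (ln (X / Y))); rewrite gt_eqF ?sqrtr_gt0// => /(_ isT).
rewrite sqr_sqrtr; last exact: ltW.
rewrite -ler_pdivrMr//.
have XY0 : X / Y \is Num.pos by rewrite posrE (lt_trans _ XY).
rewrite -{1}(lnK XY0) ler_expR; lra.
Qed.

(** The mean value bound for [exp z - 1] by [w * exp w], squared. *)
Lemma sqr_expR_sub1_le (R : realType) (z w : R) : `|z| <= w ->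
  (expR z - 1) ^+ 2 <= w ^+ 2 * expR (2 * w).
Proof.
move=> zw; have w0 : 0 <= w by apply: le_trans zw.
have E1 := expR_ge1Dx z; have E2 := expR_ge1Dx (- z); have ez := expR_gt0 z.
have ew : expR z <= expR w by rewrite ler_expR (le_trans (ler_norm _)).
have ew1 : 1 <= expR w by rewrite -expR0 ler_expR.
have -> : w ^+ 2 * expR (2 * w) = (w * expR w) ^+ 2.
  by rewrite exprMn -expRM_natl; congr (_ * expR _); rewrite mulr_natl.
rewrite -[leLHS]real_normK ?num_real// lerXn2r ?nnegrE ?mulr_ge0 ?expR_ge0//.
move: zw; rewrite !ler_norml => /andP[zw1 zw2].
have EE : expR z * expR (- z) = 1 by rewrite -expRD subrr expR0.
apply/andP; split; first by nra.
have : expR z - 1 <= z * expR z by nra.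
have [z0|z0] := leP 0 z; nra.
Qed.

(** The excess over [m ^ 2] is at most [r * 2 * m ^ 3 * exp (2 * m)]. In the exponent 5, the part 3
    comes from [m ^ 3 <= exp (3 * m)] and the part 2 from the exponential. *)
Lemma sqr_expR_le (R : realType) (r m w : R) : 0 <= r <= 1 -> 0 <= m <= w ->
  m ^+ 2 * expR (2 * (r * m)) <= m ^+ 2 + r * (2 * expR (5 * w)).
Proof.
move=> /andP[r0 r1] /andP[m0 mw].
have rm0 : 0 <= r * m by rewrite mulr_ge0.
have rmm : r * m <= m by rewrite ler_piMl.
have E1 : expR (2 * (r * m)) <= 1 + 2 * (r * m) * expR (2 * (r * m)).
  have := expR_ge1Dx (- (2 * (r * m))); have := expR_gt0 (2 * (r * m)).
  have : expR (2 * (r * m)) * expR (- (2 * (r * m))) = 1 by rewrite -expRD subrr expR0.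
  nra.
have E2 : expR (2 * (r * m)) <= expR (2 * m) by rewrite ler_expR; lra.
have E3 : m <= expR m by apply: le_trans (expR_ge1Dx m); lra.
have E4 : m ^+ 3 * expR (2 * m) <= expR (5 * w).
  have : m ^+ 3 * expR (2 * m) <= expR m ^+ 3 * expR (2 * m).
    by rewrite ler_pM2r ?expR_gt0// lerXn2r ?nnegrE ?expR_ge0.
  move=> /le_trans; apply.
  by rewrite -expRM_natl -expRD ler_expR; lra.
have E5 : expR (2 * (r * m)) <= 1 + 2 * (r * m) * expR (2 * m).
  apply: (le_trans E1); rewrite lerD2l ler_wpM2l// mulr_ge0//.
apply: (@le_trans _ _ (m ^+ 2 * (1 + 2 * (r * m) * expR (2 * m)))).
  by rewrite ler_wpM2l// sqr_ge0.
have -> : m ^+ 2 * (1 + 2 * (r * m) * expR (2 * m)) = m ^+ 2 + r * (2 * (m ^+ 3 * expR (2 * m))) by ring.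
by rewrite lerD2l ler_wpM2l// ler_pM2l.
Qed.

Section heat.
Context {R : realType}.
Local Notation gam := (@normal_prob R 0 1).
Variables (u : R -> R -> R) (k : R).
Implicit Types s t r x y b : R.
Hypothesis cu : forall t, 0 < t -> continuous (u t).
Hypothesis u_gt0 : forall t x, 0 < t -> 0 < u t x.
Hypothesis H1 : forall s r x, 0 < s ->
  (\int[gam]_y (u (s + r ^+ 2) (x + r * y))%:E = (u s x)%:E)%E.
Hypothesis H2 : forall s r x, 0 < s ->
  (\int[gam]_y ((u (s + r ^+ 2) (x + r * y)) ^+ 2)%:E =
   (expR (k * r ^+ 2) * u s x ^+ 2)%:E)%E.

Let spos s r : 0 < s -> 0 < s + r ^+ 2 :> R.
Proof. by move=> s0; rewrite ltr_wpDr ?sqr_ge0. Qed.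

Let cau s r x : 0 < s -> continuous (fun y => u s (x + r * y)).
Proof.
by move=> s0; exact: (@continuous_compf _ _ (u s) (@continuous_affine _ x r) (cu s0)).
Qed.

Let mau s r x : 0 < s -> measurable_fun setT (fun y => u s (x + r * y)).
Proof. by move=> s0; apply: continuous_measurable_fun; exact: cau. Qed.

Let cexp (b c : R) : continuous (fun y => expR (b * y - c)).
Proof.
apply: (@continuous_compf _ (fun y => b * y - c) expR); last exact: continuous_expR.
by under eq_fun do rewrite addrC; exact: continuous_affine.
Qed.

Let mexp (b c : R) : measurable_fun setT (fun y => expR (b * y - c)).
Proof. by apply: continuous_measurable_fun; exact: cexp. Qed.

(** Shifting the gaussian variable by [b] moves the base point by [r * b]. Hence the values of [u s]
    are inner products of one function with exponentials. *)
Lemma heat_tilt s r x b : 0 < s ->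
  (\int[gam]_y (u (s + r ^+ 2) (x + r * y) * expR (b * y - b ^+ 2 / 2))%:E =
   (u s (x + r * b))%:E)%E.
Proof.
move=> s0; rewrite -(H1 r (x + r * b) s0).
under [RHS]eq_integral => y _ do rewrite -addrA -mulrDr [b + y]addrC.
have mg : measurable_fun setT (fun y => (u (s + r ^+ 2) (x + r * y))%:E).
  by apply/measurable_EFinP; exact: (mau r x (spos r s0)).
have g0 y : (0 <= (u (s + r ^+ 2) (x + r * y))%:E)%E.
  by rewrite lee_fin ltW// u_gt0// spos.
rewrite (integral_gauss_translate b mg g0).
by apply: eq_integral => y _; rewrite EFinM.
Qed.

Lemma heat_sqr_dist s r x b : 0 < s ->
  (\int[gam]_y ((u (s + r ^+ 2) (x + r * y) - u s x * expR (b * y - b ^+ 2 / 2)) ^+ 2)%:E =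
   (expR (k * r ^+ 2) * u s x ^+ 2 - 2 * u s x * u s (x + r * b)
     + u s x ^+ 2 * expR (b ^+ 2))%:E)%E.
Proof.
move=> s0; set p := u s x; set q := u s (x + r * b).
set g := fun y => u (s + r ^+ 2) (x + r * y).
set e := fun y => expR (b * y - b ^+ 2 / 2).
have p0 : 0 < p by exact: u_gt0.
have g0 y : 0 <= g y by rewrite ltW// u_gt0// spos.
have e0 y : 0 <= e y by exact: expR_ge0.
have mg : measurable_fun setT g by exact: (mau r x (spos r s0)).
have me : measurable_fun setT e by exact: mexp.
(* The cross term stays on the left so that only nonnegative functions are integrated; the
   finiteness of the distance then comes out of the identity. *)
have E1 : (\int[gam]_y ((g y - p * e y) ^+ 2 + 2 * p * (g y * e y))%:E =
           \int[gam]_y (g y ^+ 2 + p ^+ 2 * expR (b * 2 * y - b ^+ 2))%:E)%E.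
  apply: eq_integral => y _; congr EFin.
  have -> : expR (b * 2 * y - b ^+ 2) = e y ^+ 2.
    by rewrite /e [in RHS]expr2 -expRD; congr expR; field.
  by ring.
have pq : 0 <= 2 * p by rewrite mulr_ge0// ltW.
rewrite ge0_integralD_EFin in E1; last 4 first.
- by apply: measurable_funX; apply: measurable_funB => //; exact: measurable_funM.
- by apply: measurable_funM => //; exact: measurable_funM.
- by move=> y; rewrite sqr_ge0.
- by move=> y; exact: mulr_ge0 pq (mulr_ge0 (g0 y) (e0 y)).
rewrite ge0_integralZ_EFin// in E1; last 2 first.
- exact: measurable_funM.
- by move=> y; rewrite mulr_ge0.
rewrite (heat_tilt r x b s0) in E1.
rewrite ge0_integralD_EFin in E1; last 4 first.
- exact: measurable_funX.
- by apply: measurable_funM => //; exact: mexp.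
- by move=> y; rewrite sqr_ge0.
- by move=> y; rewrite mulr_ge0 ?sqr_ge0 ?expR_ge0.
rewrite (H2 r x s0) ge0_integralZ_EFin in E1; last 3 first.
- exact: mexp.
- by move=> y; exact: expR_ge0.
- exact: sqr_ge0.
have E2 : (\int[gam]_y (expR (b * 2 * y - b ^+ 2))%:E = (expR (b ^+ 2))%:E)%E.
  under eq_integral do rewrite expRD mulrC.
  rewrite ge0_integralZ_EFin; last 3 first.
  - by under eq_fun do rewrite -[_ * _]subr0; exact: mexp.
  - by move=> y; exact: expR_ge0.
  - exact: expR_ge0.
  by rewrite integral_gauss_expR -EFinM -expRD; congr (expR _)%:E; field.
rewrite E2 in E1.
have : (0 <= \int[gam]_y ((g y - p * e y) ^+ 2)%:E)%E.
  by apply: integral_ge0 => y _; rewrite lee_fin sqr_ge0.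
move: E1; case: (integral _ _ _) => // z; rewrite -!EFinM -!EFinD => -[E1] _.
by congr EFin; rewrite -/p -/q in E1 *; lra.
Qed.

(** For [r = 1] and [b = 0] the squared distance is [(exp k - 1) * (u 1 0) ^ 2]. *)
Lemma heat_rate_ge0 : 0 <= k.
Proof.
have := heat_sqr_dist 1 0 0 ltr01.
rewrite !mulr0 addr0 expr0n/= expR0 => E.
have : (0 <= (expR (k * 1 ^+ 2) * u 1 0 ^+ 2 - 2 * u 1 0 * u 1 0 + u 1 0 ^+ 2 * 1)%:E)%E.
  by rewrite -E; apply: integral_ge0 => y _; rewrite lee_fin sqr_ge0.
rewrite lee_fin expr1n mulr1 => h.
have u0 : 0 < u 1 0 ^+ 2 by rewrite exprn_gt0// u_gt0.
have : 1 <= expR k by rewrite -(ler_pM2r u0); lra.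
by rewrite -{1}expR0 ler_expR.
Qed.

(* Equality in the growth bound [heat_growth] makes the L^2 distance of [heat_sqr_dist] vanish. *)
Lemma heat_exp s r x b : 0 < s ->
  u s x * (expR (k * r ^+ 2) + expR (b ^+ 2)) <= 2 * u s (x + r * b) ->
  forall y, u (s + r ^+ 2) (x + r * y) = u s x * expR (b * y - b ^+ 2 / 2).
Proof.
move=> s0 h y; apply/eqP; rewrite -subr_eq0; apply/eqP.
move: y; suff h0 : forall y, (u (s + r ^+ 2) (x + r * y) - u s x * expR (b * y - b ^+ 2 / 2)) ^+ 2 = 0.
  by move=> y; apply/eqP; rewrite -sqrf_eq0 h0.
have cg : continuous (fun y => u (s + r ^+ 2) (x + r * y) -
                               u s x * expR (b * y - b ^+ 2 / 2)).
  apply: continuous_subf; first exact: (cau (spos r s0)).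
  apply: continuous_mulf; [by move=> ?; exact: cst_continuous|exact: cexp].
apply: (gauss_ae0_continuous (continuous_mulf cg cg)) => [y|]; first exact: sqr_ge0.
rewrite (heat_sqr_dist r x b s0) lee_fin.
by have := u_gt0 x s0; nra.
Qed.

(** The squared distance of [heat_sqr_dist] is nonnegative and divisible by [u s x]. *)
Lemma heat_growth s r x b : 0 < s ->
  2 * u s (x + r * b) <= u s x * (expR (k * r ^+ 2) + expR (b ^+ 2)).
Proof.
move=> s0; have p0 := u_gt0 x s0.
have := heat_sqr_dist r x b s0 => E.
have : (0 <= (expR (k * r ^+ 2) * u s x ^+ 2 - 2 * u s x * u s (x + r * b)
     + u s x ^+ 2 * expR (b ^+ 2))%:E)%E.
  by rewrite -E; apply: integral_ge0 => y _; rewrite lee_fin sqr_ge0.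
by rewrite lee_fin => h; rewrite -(ler_pM2l p0); lra.
Qed.

(** Both right-hand values are tilts, by [b] and [- b], over the scale [r = a / b], and
    [l * exp (b y) + l^-1 * exp (- b y) >= 2]. The spurious factor [exp (b^2 / 2)] disappears as
    [b -> 0]. The weight [l] is left free for [heat_log_convex]. *)
Lemma heat_midpoint s x a l : 0 < s -> 0 < l ->
  2 * u s x <= l * u s (x + a) + l^-1 * u s (x - a).
Proof.
move=> s0 l0.
have p1 := u_gt0 (x + a) s0; have p2 := u_gt0 (x - a) s0.
apply: le_expR_sqr_mul => [|b b0].
  by rewrite addr_gt0// mulr_gt0// invr_gt0.
set r := a / b.
have -> : x + a = x + r * b by rewrite /r divfK.
have -> : x - a = x + r * - b by rewrite /r mulrN divfK.
rewrite -lee_fin EFinM -(H1 r x s0) -ge0_integralZ_EFin//; last 2 first.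
- exact: (mau r x (spos r s0)).
- by move=> y; rewrite ltW// u_gt0// spos.
rewrite mulrDr 2!mulrA EFinD (EFinM _ (u s (x + r * b))) (EFinM _ (u s (x + r * - b))).
rewrite -(heat_tilt r x b s0) -(heat_tilt r x (- b) s0).
have mge z : measurable_fun setT (fun y => u (s + r ^+ 2) (x + r * y) * expR (z * y - z ^+ 2 / 2)).
  by apply: measurable_funM; [exact: (mau r x (spos r s0))|exact: mexp].
have ge0 z y : 0 <= u (s + r ^+ 2) (x + r * y) * expR (z * y - z ^+ 2 / 2).
  by rewrite mulr_ge0 ?expR_ge0// ltW// u_gt0// spos.
have mZ w z : measurable_fun setT (fun y => w * (u (s + r ^+ 2) (x + r * y) * expR (z * y - z ^+ 2 / 2))).
  by apply: measurable_funM => //; exact: mge.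
have k1 : 0 <= expR (b ^+ 2 / 2) * l by rewrite mulr_ge0 ?expR_ge0// ltW.
have k2 : 0 <= expR (b ^+ 2 / 2) / l by rewrite divr_ge0 ?expR_ge0// ltW.
rewrite -!ge0_integralZ_EFin//; do ?exact: mge.
rewrite -ge0_integralD_EFin//; last 4 first.
- exact: mZ.
- exact: mZ.
- by move=> y; rewrite mulr_ge0.
- by move=> y; rewrite mulr_ge0.
apply: ge0_le_integral_EFin.
- by apply: measurable_funM => //; exact: (mau r x (spos r s0)).
- by apply: measurable_funD; exact: mZ.
- by move=> y; rewrite mulr_ge0// ltW// u_gt0// spos.
move=> y; set g := u _ _.
have g0 : 0 < g by rewrite u_gt0// spos.
have -> : expR (b ^+ 2 / 2) * l * (g * expR (b * y - b ^+ 2 / 2)) +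
   expR (b ^+ 2 / 2) / l * (g * expR (- b * y - (- b) ^+ 2 / 2)) =
   g * (l * expR (b * y) + l^-1 * expR (- (b * y))).
  rewrite sqrrN !expRD mulNr [in expR (- (b ^+ 2 / 2))]expRN.
  by field; apply/andP; split; rewrite gt_eqF ?expR_gt0.
rewrite mulrC ler_wpM2l ?(ltW g0)//.
have e0 := expR_gt0 (b * y).
rewrite expRN -subr_ge0.
have -> : l * expR (b * y) + l^-1 * (expR (b * y))^-1 - 2 =
   (l * expR (b * y) - 1) ^+ 2 / (l * expR (b * y)).
  by field; rewrite !gt_eqF.
by rewrite divr_ge0 ?sqr_ge0// mulr_ge0// ltW.
Qed.

(** The weight [l = u s x / u s (x + a)] turns the arithmetic midpoint bound into the geometric
    one. *)
Lemma heat_log_convex s x a : 0 < s ->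
  2 * ln (u s x) <= ln (u s (x + a)) + ln (u s (x - a)).
Proof.
move=> s0.
have p0 := u_gt0 x s0; have p1 := u_gt0 (x + a) s0; have p2 := u_gt0 (x - a) s0.
have := heat_midpoint x a s0 (divr_gt0 p0 p1); rewrite divfK ?gt_eqF// invf_div => h.
rewrite -lnM ?posrE// mulr_natl -lnXn ?posrE// ler_ln ?posrE ?mulr_gt0 ?exprn_gt0//.
have : u s x * u s x <= u s (x + a) / u s x * u s (x - a) * u s x by rewrite ler_wpM2r ?(ltW p0)//; lra.
by rewrite mulrAC divfK ?gt_eqF// expr2.
Qed.

(** Jensen's inequality: the average over [y] is symmetrized with [- y], and midpoint convexity
    applies under the integral. *)
Lemma heat_monotone s r x : 0 < s -> u (s + r ^+ 2) x <= u s x.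
Proof.
move=> s0; have s1 := spos r s0.
have mg := mau r x s1.
have g0 y : 0 <= u (s + r ^+ 2) (x + r * y) by rewrite ltW// u_gt0.
have mgN : measurable_fun setT (fun y => u (s + r ^+ 2) (x + r * - y)).
  by under eq_fun do rewrite mulrN -mulNr; exact: mau.
suff : ((2 * u (s + r ^+ 2) x)%:E <= (2 * u s x)%:E)%E by rewrite lee_fin ler_pM2l.
rewrite -[leLHS](integral_gauss_cst); last by rewrite lee_fin mulr_ge0// ltW// u_gt0.
rewrite [X in (_ <= X)%E](_ : _ = (u s x)%:E + (u s x)%:E)%E; last first.
  by rewrite -EFinD; congr EFin; ring.
rewrite -(H1 r x s0).
have mg' : measurable_fun setT (fun y => (u (s + r ^+ 2) (x + r * y))%:E).
  exact/measurable_EFinP.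
rewrite -[X in (_ <= X + _)%E](integral_gauss_opp mg')//.
rewrite -ge0_integralD_EFin//.
apply: ge0_le_integral_EFin => //.
- by apply: measurable_funD.
- by move=> y; rewrite mulr_ge0// ltW// u_gt0.
move=> y; have := heat_midpoint x (r * - y) s1 ltr01.
by rewrite invr1 !mul1r mulrN opprK.
Qed.

(** At later times, the exponential at [T] attains the growth bound for [b = c * r], so [heat_exp]
    applies. At earlier times, [u t x] is the gaussian average of the known function [u T]. *)
Lemma heat_from_exp T c : 0 < T -> c ^+ 2 = k ->
  (forall x, u T x = u T 0 * expR (c * x)) ->
  forall t x, 0 < t -> u t x = u T 0 * expR (c * x - k / 2 * (t - T)).
Proof.
move=> T0 ck uT t x t0.
have [tT|Tt|->] := ltgtP t T; last first.
- by rewrite subrr mulr0 subr0 uT.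
- set r := Num.sqrt (t - T).
  have r2 : r ^+ 2 = t - T by rewrite sqr_sqrtr// subr_ge0 ltW.
  have r0 : r != 0 by rewrite gt_eqF// sqrtr_gt0 subr_gt0.
  have h : u T 0 * (expR (k * r ^+ 2) + expR ((c * r) ^+ 2)) <= 2 * u T (0 + r * (c * r)).
    rewrite exprMn ck add0r (uT (r * _)).
    have -> : c * (r * (c * r)) = k * r ^+ 2 by rewrite -ck; ring.
    lra.
  have := heat_exp T0 h (x / r); rewrite add0r [r * (x / r)]mulrC divfK//.
  rewrite [T + _]addrC r2 subrK => ->; congr (_ * expR _).
  rewrite -ck -r2; by field.
set r := Num.sqrt (T - t).
have r2 : r ^+ 2 = T - t by rewrite sqr_sqrtr// subr_ge0 ltW.
have := H1 r x t0; rewrite r2 [t + _]addrC subrK.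
under eq_integral => y _ do rewrite uT mulrDr expRD !mulrA.
rewrite ge0_integralZ_EFin; last 3 first.
- have := mexp (c * r) 0; by under eq_fun do rewrite subr0.
- by move=> y; exact: expR_ge0.
- by rewrite mulr_ge0 ?expR_ge0// ltW// u_gt0.
rewrite integral_gauss_expR -EFinM => -[<-].
rewrite -[LHS]mulrA -expRD; congr (_ * expR _).
rewrite exprMn ck r2; ring.
Qed.

Lemma heat_growth_exp s x a : 0 < s -> 0 < k ->
  u s (x + a) <= u s x * expR (Num.sqrt k * `|a|).
Proof.
move=> s0 k0; set c := Num.sqrt k.
have c0 : 0 < c by rewrite sqrtr_gt0.
have ck : c ^+ 2 = k by rewrite sqr_sqrtr// ltW.
have [->|a0] := eqVneq a 0; first by rewrite normr0 mulr0 expR0 mulr1 addr0.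
have na : 0 < `|a| by rewrite normr_gt0.
(* With [b = a / r], this scale makes [k * r ^ 2] and [b ^ 2] both equal to [c * |a|]. *)
set r := Num.sqrt (`|a| / c).
have r2 : r ^+ 2 = `|a| / c by rewrite sqr_sqrtr// divr_ge0// ltW.
have r0 : r != 0 by rewrite gt_eqF// sqrtr_gt0 divr_gt0.
have := heat_growth r x (a / r) s0; rewrite [r * _]mulrC divfK//.
have -> : k * r ^+ 2 = c * `|a| by rewrite r2 -ck; field; rewrite gt_eqF.
have -> : (a / r) ^+ 2 = c * `|a|.
  rewrite exprMn exprVn r2 -[a ^+ 2]real_normK ?num_real//.
  by field; rewrite !gt_eqF.
by have := u_gt0 x s0; lra.
Qed.

(* By log-convexity [P (r y)] is at most [r * m y] for dyadic [r], so expanding the second moment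
   over a time step [r ^ 2] gives [k <= \int m ^ 2] in the limit; as [m y <= c * |y|] and
   [\int y ^ 2 = 1], the function [m] must be [c * |y|]. *)
Let c := Num.sqrt k.
Let P y := ln (u 2 y) - ln (u 2 0).
Let m y := Num.max (P y) (P (- y)).
Let two_gt0 : 0 < 2 :> R. Proof. by []. Qed.

(** Midpoint convexity between 0 and the current point, where [P 0 = 0], iterated by halving. *)
Let P_half y j : P (2 ^- j * y) <= 2 ^- j * P y.
Proof.
elim: j => [|j ih]; first by rewrite expr0 invr1 !mul1r.
have := heat_log_convex (2 ^- j.+1 * y) (2 ^- j.+1 * y) two_gt0.
rewrite subrr -mulrDl (_ : 2 ^- j.+1 + 2 ^- j.+1 = 2 ^- j); last first.
  by rewrite exprS invfM; field; rewrite expf_neq0.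
move: ih; rewrite /P => ih h.
have -> : 2 ^- j.+1 = 2 ^- j / 2 :> R by rewrite exprS invfM mulrC.
have -> : 2 ^- j / 2 = 2 ^- j.+1 :> R by rewrite exprS invfM mulrC.
have E : 2 ^- j.+1 = 2 ^- j / 2 :> R by rewrite exprS invfM mulrC.
rewrite [leRHS](_ : _ = (2 ^- j * (ln (u 2 y) - ln (u 2 0))) / 2); last by rewrite E; ring.
lra.
Qed.

Let P_sym y : - P (- y) <= P y.
Proof. by have := heat_log_convex 0 y two_gt0; rewrite add0r sub0r /P; lra. Qed.

Let m_ge0 y : 0 <= m y.
Proof. by rewrite le_max; have := P_sym y; case: (leP 0 (P y)) => //=; lra. Qed.

(** The upper bound is [P_half] at [y]; the lower one is [P_half] at [- y] together with [P_sym]. *)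
Let P_le y j : `|P (2 ^- j * y)| <= 2 ^- j * m y.
Proof.
have j0 : 0 <= 2 ^- j :> R by rewrite invr_ge0 exprn_ge0.
have h1 := P_half y j; have := P_half (- y) j; rewrite mulrN => h2.
have := P_sym (2 ^- j * y) => h3.
have m1 : 2 ^- j * P y <= 2 ^- j * m y by rewrite ler_wpM2l// le_max lexx.
have m2 : 2 ^- j * P (- y) <= 2 ^- j * m y by rewrite ler_wpM2l// le_max lexx orbT.
by rewrite ler_norml; apply/andP; split; lra.
Qed.

Let m_le y : 0 < k -> m y <= c * `|y|.
Proof.
move=> k0; suff h z : P z <= c * `|z| by rewrite ge_max h -{1}(normrN y) h.
have := heat_growth_exp 0 z two_gt0 k0; rewrite add0r.
rewrite -ler_ln ?posrE ?mulr_gt0 ?expR_gt0 ?u_gt0//.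
by rewrite lnM ?posrE ?expR_gt0 ?u_gt0// expRK /P -/c; lra.
Qed.

Let cP : continuous P.
Proof.
apply: continuous_subf; last by move=> ?; exact: cst_continuous.
move=> y; have h : continuous_at y (@ln R \o u 2).
  by apply: continuous_comp; [exact: cu|apply: continuous_ln; exact: u_gt0].
exact: h.
Qed.

Let cm : continuous m.
Proof.
move=> y; apply: (@continuous_max _ _ P (fun y => P (- y))); first exact: cP.
apply: (@continuous_comp _ _ _ -%R P); first exact: opp_continuous.
exact: cP.
Qed.

Let u2E y : u 2 y = u 2 0 * expR (P y).
Proof.
by rewrite /P expRD expRN !lnK ?posrE ?u_gt0// mulrCA divff ?mulr1// gt_eqF// u_gt0.
Qed.

(** The variance-like quantity over the last time step before time 2 is at least of order
    [k * r ^ 2], while [P_le] bounds it above through [m]. The sum of two exponentials dominates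
    [exp (5 * c * |y|)] and has an explicit mean. *)
Let key (j : nat) : 0 < k ->
  (k%:E <= \int[gam]_y (m y ^+ 2 + 2 ^- j.+1 * (2 * (expR (5 * c * y) + expR (- (5 * c) * y))))%:E)%E.
Proof.
move=> k0; set r : R := 2 ^- j.+1.
have c0 : 0 <= c by exact: sqrtr_ge0.
have r0 : 0 < r by rewrite invr_gt0 exprn_gt0.
have r1 : r <= 1 by rewrite invf_le1 ?exprn_gt0// exprn_ege1// ler1n.
set s := 2 - r ^+ 2.
have r21 : r ^+ 2 <= 1 by rewrite expr_le1 ?(ltW r0).
have s0 : 0 < s by rewrite subr_gt0; lra.
have sr : s + r ^+ 2 = 2 by rewrite subrK.
set p := u 2 0; set q := u s 0.
have p0 : 0 < p by exact: u_gt0.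
have pq : p <= q by have := heat_monotone r 0 s0; rewrite sr.
pose g y := u 2 (r * y).
have gE y : g y = u (s + r ^+ 2) (0 + r * y) by rewrite add0r sr.
have mg : measurable_fun setT g.
  have -> : g = (fun y => u (s + r ^+ 2) (0 + r * y)) by apply/funext.
  exact: (mau r 0 (spos r s0)).
have g0 y : 0 < g y by exact: u_gt0.
have E1 : (\int[gam]_y ((g y - p) ^+ 2 + 2 * p * g y)%:E = \int[gam]_y (g y ^+ 2 + p ^+ 2)%:E)%E.
  by apply: eq_integral => y _; congr EFin; ring.
have Eg : (\int[gam]_y (g y)%:E = q%:E)%E.
  by under eq_integral do rewrite gE; exact: H1.
have Eg2 : (\int[gam]_y (g y ^+ 2)%:E = (expR (k * r ^+ 2) * q ^+ 2)%:E)%E.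
  by under eq_integral do rewrite gE; exact: H2.
have mgp : measurable_fun setT (fun y => (g y - p) ^+ 2).
  by apply: measurable_funX; apply: measurable_funB.
rewrite ge0_integralD_EFin in E1; last 4 first.
- by [].
- exact: measurable_funM.
- by move=> y; rewrite sqr_ge0.
- by move=> y; rewrite mulr_ge0 ?(ltW (g0 y))// mulr_ge0// ltW.
rewrite ge0_integralZ_EFin in E1; last 3 first.
- by [].
- by move=> y; rewrite ltW.
- by rewrite mulr_ge0// ltW.
rewrite ge0_integralD_EFin in E1; last 4 first.
- exact: measurable_funX.
- by [].
- by move=> y; rewrite sqr_ge0.
- by move=> y; rewrite sqr_ge0.
rewrite Eg Eg2 integral_gauss_cst ?lee_fin ?sqr_ge0// in E1.
(* The integral is [exp (k r^2) q^2 - 2 p q + p^2], at least [k r^2 q^2 + (q - p)^2]; then [p <= q]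
   allows [p] in place of [q]. *)
have E3 : ((k * r ^+ 2 * p ^+ 2)%:E <= \int[gam]_y ((g y - p) ^+ 2)%:E)%E.
  have : (0 <= \int[gam]_y ((g y - p) ^+ 2)%:E)%E.
    by apply: integral_ge0 => y _; rewrite lee_fin sqr_ge0.
  move: E1; case: (integral _ _ _) => // z; rewrite -!EFinM -!EFinD => -[E1] _.
  rewrite lee_fin.
  have ek := expR_ge1Dx (k * r ^+ 2).
  have kr : 0 <= k * r ^+ 2 by rewrite mulr_ge0 ?sqr_ge0// ltW.
  have h1 : p ^+ 2 <= q ^+ 2 by rewrite lerXn2r ?nnegrE// ltW// u_gt0.
  have h2 : (1 + k * r ^+ 2) * q ^+ 2 <= expR (k * r ^+ 2) * q ^+ 2 by rewrite ler_wpM2r ?sqr_ge0.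
  have h3 : k * r ^+ 2 * p ^+ 2 <= k * r ^+ 2 * q ^+ 2 by rewrite ler_wpM2l.
  have := sqr_ge0 (q - p); rewrite sqrrB; lra.
have rp0 : 0 < r ^+ 2 * p ^+ 2 by rewrite mulr_gt0 ?exprn_gt0.
have mM : measurable_fun setT (fun y => m y ^+ 2).
  by apply: measurable_funX; exact: continuous_measurable_fun.
have me (z : R) : measurable_fun setT (fun y => expR (z * y)).
  by have := mexp z 0; under eq_fun do rewrite subr0.
have mB : measurable_fun setT (fun y => m y ^+ 2 + r * (2 * (expR (5 * c * y) + expR (- (5 * c) * y)))).
  apply: measurable_funD => //; apply: measurable_funM => //; apply: measurable_funM => //.
  by apply: measurable_funD; exact: me.
have B0 y : 0 <= m y ^+ 2 + r * (2 * (expR (5 * c * y) + expR (- (5 * c) * y))).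
  by rewrite addr_ge0 ?sqr_ge0// mulr_ge0 ?(ltW r0)// mulr_ge0// addr_ge0// expR_ge0.
rewrite -(@lee_pmul2l _ (r ^+ 2 * p ^+ 2)%:E)// -EFinM.
rewrite mulrAC [_ * k]mulrC.
apply: (le_trans E3); rewrite -ge0_integralZ_EFin ?(ltW rp0)//.
apply: ge0_le_integral_EFin => //.
- exact: measurable_funM.
- by move=> y; rewrite sqr_ge0.
move=> y; rewrite /g u2E.
have -> : (u 2 0 * expR (P (r * y)) - p) ^+ 2 = p ^+ 2 * (expR (P (r * y)) - 1) ^+ 2 by rewrite /p; ring.
rewrite -mulrA [leRHS]mulrCA ler_wpM2l ?sqr_ge0//.
apply: (le_trans (sqr_expR_sub1_le (P_le y j.+1))); rewrite -/r exprMn -[leLHS]mulrA.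
rewrite ler_wpM2l ?sqr_ge0//.
have rr : 0 <= r <= 1 by rewrite (ltW r0) r1.
have mm : 0 <= m y <= c * `|y| by rewrite m_ge0 m_le.
apply: (le_trans (sqr_expR_le rr mm)).
rewrite lerD2l ler_wpM2l ?(ltW r0)// ler_wpM2l// -mulrA.
have [y0|y0] := leP 0 y.
  by rewrite ger0_norm// lerDl expR_ge0.
by rewrite ltr0_norm// [5 * _]mulrA mulrN -mulNr lerDr expR_ge0.
Qed.

(** Only the value of [m] at 1 is needed; the maximum defining [m] leaves the direction of steepest
    growth undetermined, hence the sign [z]. *)
Lemma heat_slope : 0 < k -> exists2 z : R, `|z| = 1 & u 2 0 * expR c <= u 2 z.
Proof.
move=> k0.
have c0 : 0 <= c by exact: sqrtr_ge0.
have ck : c ^+ 2 = k by rewrite sqr_sqrtr// ltW.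
have mM : measurable_fun setT (fun y => m y ^+ 2).
  by apply: measurable_funX; exact: continuous_measurable_fun.
have me (z : R) : measurable_fun setT (fun y => expR (z * y)).
  by have := mexp z 0; under eq_fun do rewrite subr0.
have mle2 y : m y ^+ 2 <= k * y ^+ 2.
  rewrite -ck -exprMn -[(c * y) ^+ 2]real_normK ?num_real// normrM (ger0_norm c0).
  by rewrite lerXn2r ?nnegrE ?m_ge0 ?mulr_ge0// m_le.
have mX : measurable_fun setT (fun y : R => y ^+ 2) by exact: measurable_funX.
have E1 : (\int[gam]_y (m y ^+ 2)%:E + \int[gam]_y (k * y ^+ 2 - m y ^+ 2)%:E = k%:E)%E.
  rewrite -ge0_integralD_EFin//; last 3 first.
  - by apply: measurable_funB => //; exact: measurable_funM.
  - by move=> y; rewrite sqr_ge0.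
  - by move=> y; rewrite subr_ge0.
  under eq_integral do rewrite addrC subrK.
  rewrite ge0_integralZ_EFin ?(ltW k0)//; last by move=> y; rewrite sqr_ge0.
  by rewrite integral_gauss_sqr mule1.
have E2 (j : nat) : (k%:E <= \int[gam]_y (m y ^+ 2)%:E + (2 ^- j.+1 * (4 * expR ((5 * c) ^+ 2 / 2)))%:E)%E.
  apply: (le_trans (key j k0)); rewrite ge0_integralD_EFin; last 4 first.
  - by [].
  - apply: measurable_funM => //; apply: measurable_funM => //.
    by apply: measurable_funD; exact: me.
  - by move=> y; rewrite sqr_ge0.
  - by move=> y; rewrite !mulr_ge0 ?invr_ge0 ?exprn_ge0// addr_ge0 ?expR_ge0.
  rewrite leeD2l// ge0_integralZ_EFin; last 3 first.
  - by apply: measurable_funM => //; apply: measurable_funD; exact: me.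
  - by move=> y; rewrite mulr_ge0// addr_ge0 ?expR_ge0.
  - by rewrite invr_ge0 exprn_ge0.
  rewrite ge0_integralZ_EFin; last 3 first.
  - by apply: measurable_funD; exact: me.
  - by move=> y; rewrite addr_ge0 ?expR_ge0.
  - by [].
  rewrite ge0_integralD_EFin//; do ?exact: me.
  rewrite !integral_gauss_expR sqrrN -EFinD -!EFinM lee_fin.
  by rewrite ler_wpM2l ?invr_ge0 ?exprn_ge0//; lra.
have E3 : (\int[gam]_y (k * y ^+ 2 - m y ^+ 2)%:E <= 0)%E.
  have i1 : (0 <= \int[gam]_y (m y ^+ 2)%:E)%E by apply: integral_ge0 => y _; rewrite lee_fin sqr_ge0.
  have i2 : (0 <= \int[gam]_y (k * y ^+ 2 - m y ^+ 2)%:E)%E by apply: integral_ge0 => y _; rewrite lee_fin subr_ge0.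
  move: E1 E2 i1 i2; case: (integral _ _ _) => [I| |]; case: (integral _ _ _) => [J| |] //.
  rewrite -EFinD => -[IJ] E2 _ _; rewrite lee_fin leNgt; apply/negP => J0.
  set K := 4 * expR ((5 * c) ^+ 2 / 2) in E2.
  have K0 : 0 < K by rewrite mulr_gt0 ?expR_gt0.
  (* As [n <= 2 ^ (n + 1)], the error [K / 2 ^ (n + 1)] drops below [J]. *)
  have [n Kn] : exists n : nat, K / J < n%:R.
    by exists (Num.truncn (K / J)).+1; exact: truncnS_gt.
  have := E2 n; rewrite -EFinD lee_fin; apply/negP; rewrite -ltNge -IJ ltrD2l.
  rewrite mulrC ltr_pdivrMr ?exprn_gt0// mulrC -ltr_pdivrMr//.
  apply: (lt_le_trans Kn); rewrite -natrX ler_nat.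
  by rewrite (leq_trans (ltnW (ltn_expl n (isT : (1 < 2)%N))))// leq_exp2l.
have ch : continuous (fun y => k * y ^+ 2 - m y ^+ 2).
  apply: continuous_subf.
    apply: (@continuous_mulf _ (fun=> k) (fun y => y ^+ 2)); first by move=> ?; exact: cst_continuous.
    by move=> y; exact: exprn_continuous.
  exact: (continuous_mulf cm cm).
have h0 y : 0 <= k * y ^+ 2 - m y ^+ 2 by rewrite subr_ge0.
have := gauss_ae0_continuous ch h0 E3 1; rewrite expr1n mulr1 => /eqP.
rewrite subr_eq0 -ck eqrXn2 ?m_ge0// => /eqP mc.
have : c <= Num.max (P 1) (P (- 1)) by rewrite mc /m.
rewrite le_max => /orP[h|h]; [exists 1|exists (- 1)]; rewrite ?normrN ?normr1//.
  by rewrite (u2E 1) ler_pM2l ?u_gt0// ler_expR.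
by rewrite (u2E (- 1)) ler_pM2l ?u_gt0// ler_expR.
Qed.

Lemma heat_solution : exists A b : R,
  b ^+ 2 = k /\ forall t x, 0 < t -> u t x = A * expR (b * x - b ^+ 2 / 2 * t).
Proof.
suff [T [b [T0 bk uT]]] : exists T b : R, [/\ 0 < T, b ^+ 2 = k &
    forall x, u T x = u T 0 * expR (b * x)].
  exists (u T 0 * expR (k / 2 * T)), b; split=> // t x t0.
  rewrite (heat_from_exp T0 bk uT x t0) -[RHS]mulrA -expRD; congr (_ * expR _).
  by rewrite bk; ring.
(* If [k = 0], the case [r = 1], [b = 0] of the growth bound is an equality, and [u 2] is
   constant. *)
have := heat_rate_ge0; rewrite le_eqVlt => /predU1P[k0|k0].
  exists 2, 0; split => //; first by rewrite -k0 expr0n.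
  have h : u 1 0 * (expR (k * 1 ^+ 2) + expR (0 ^+ 2)) <= 2 * u 1 (0 + 1 * 0).
    by rewrite -k0 mul0r expr0n/= expR0 mulr0 addr0; lra.
  have := heat_exp ltr01 h; rewrite expr1n (_ : 1 + 1 = 2 :> R)// => e x.
  have {}e y : u 2 y = u 1 0.
    have := e y; rewrite add0r mul1r => ->.
    by rewrite mul0r expr0n/= mul0r subrr expR0 mulr1.
  by rewrite !e mul0r expR0 mulr1.
have [z z1 uz] := heat_slope k0.
have ck : c ^+ 2 = k by rewrite sqr_sqrtr// ltW.
have c0 : 0 < c by rewrite sqrtr_gt0.
have sc0 : 0 < Num.sqrt c by rewrite sqrtr_gt0.
have sc2 : Num.sqrt c ^+ 2 = c by rewrite sqr_sqrtr// ltW.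
have z2 : z ^+ 2 = 1 by rewrite -real_normK ?num_real// z1 expr1n.
(* These give [r * b = z] and [k * r ^ 2 = b ^ 2 = c]: the slope at time 2 is the equality case of
   [heat_exp], which produces an exponential at time [2 + 1 / c]. *)
set r := (Num.sqrt c)^-1; set b := Num.sqrt c * z.
have r0 : r != 0 by rewrite invr_eq0 gt_eqF.
have rb : r * b = z by rewrite /r /b mulKf// gt_eqF.
have r2 : r ^+ 2 = c^-1 by rewrite exprVn sc2.
have h : u 2 0 * (expR (k * r ^+ 2) + expR (b ^+ 2)) <= 2 * u 2 (0 + r * b).
  rewrite add0r rb r2 exprMn sc2 z2 mulr1 -ck expr2 mulfK ?gt_eqF//; lra.
have e := heat_exp two_gt0 h.
exists (2 + r ^+ 2), (c * z); split.
- exact: spos.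
- by rewrite exprMn z2 mulr1.
move=> x; have := e (x / r); rewrite add0r [r * _]mulrC divfK// => ->.
have := e 0; rewrite mulr0 add0r => ->; rewrite -mulrA -expRD.
congr (_ * expR _); rewrite /r /b invrK.
rewrite [_ * z * _](_ : _ = Num.sqrt c ^+ 2 * z * x); last by ring.
by rewrite sc2; ring.
Qed.

End heat.

(** * Brownian motion *)

Section law.
Context d d' (T : measurableType d) (T' : measurableType d') (R : realType).
Variables (P : probability T R) (f : T -> T').
Hypothesis mf : measurable_fun setT f.

(** Kept apart from [push] in order to carry the finiteness instance used for product measures. *)
Definition law : set T' -> \bar R := push P mf.
HB.instance Definition _ := Measure.on law.

Let law_fin : fin_num_fun law.
Proof.
move=> A mA; rewrite /law pushE fin_num_measure//.
by rewrite -[_ @^-1` _]setTI; exact: mf.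
Qed.

HB.instance Definition _ := Measure_isFinite.Build _ _ _ law law_fin.

End law.

Section sub_sigma_algebra.
Context d (T : measurableType d) (R : realType).
Variable G : set (set T).
Hypothesis Gsig : sigma_algebra setT G.
Notation TG := (g_sigma_algebraType G).

Lemma sub_measurableE (A : set T) : measurable (A : set TG) <-> G A.
Proof. by rewrite /measurable/= /g_sigma_algebraType/= (sigma_algebra_id Gsig). Qed.

Lemma measurable_wrtE (X : T -> R) :
  measurable_wrt G X <-> measurable_fun setT (X : TG -> R).
Proof.
split=> [h _ B mB|h B mB].
  by rewrite setTI; apply/sub_measurableE; exact: h.
by apply/sub_measurableE; rewrite -[_ @^-1` _]setTI; exact: h.
Qed.

Hypothesis Gmeas : G `<=` measurable.

Lemma sub_sigma_id : measurable_fun setT (idfun : T -> TG).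
Proof. by move=> _ A mA; rewrite setTI; apply: Gmeas; exact/sub_measurableE. Qed.

Lemma measurable_wrt_fun (X : T -> R) : measurable_wrt G X -> measurable_fun setT X.
Proof. by move=> h _ B mB; rewrite setTI; apply: Gmeas; exact: h. Qed.

End sub_sigma_algebra.

Section brownian.
Context d (T : measurableType d) (R : realType) (P : probability T R).
Context (F : R -> set (set T)) (W : process R T).
Hypothesis uF : usual_filtration P F.
Hypothesis bW : brownian_motion P F W.
Implicit Types s t : R.
Local Notation gam := (@normal_prob R 0 1).

Lemma brownian_measurable_wrt s : 0 <= s -> measurable_wrt (F s) (W s).
Proof. by move=> s0; exact: (brownian_adapted bW). Qed.

Lemma brownian_measurable s : 0 <= s -> measurable_fun setT (W s).
Proof.
move=> s0; exact: (measurable_wrt_fun (filtration_measurable uF s0) (brownian_measurable_wrt s0)).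
Qed.

(* The increment is paired with the identity of [T], the latter seen as a random element of
   [T] endowed with the sigma-algebra [F s]. *)
Lemma brownian_joint s t (H : g_sigma_algebraType (F s) * measurableTypeR R -> \bar R) :
  0 <= s -> s < t -> measurable_fun setT H -> (forall z, 0 <= H z)%E ->
  (\int[P]_w H (w, (W t w - W s w)%R) =
   \int[P]_w \int[gam]_y H (w, (Num.sqrt (t - s) * y)%R))%E.
Proof.
move=> s0 st mH H0.
have t0 : 0 <= t by rewrite (le_trans s0)// ltW.
have Fs := filtration_sigma uF s0.
have mid := sub_sigma_id Fs (filtration_measurable uF s0).
have mD : measurable_fun setT (fun w => W t w - W s w : measurableTypeR R).
  by apply: measurable_funB; exact: brownian_measurable.
pose Phi (w : T) : g_sigma_algebraType (F s) * measurableTypeR R := (w, W t w - W s w).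
have mPhi : measurable_fun setT Phi by exact: (measurable_fun_pair mid mD).
set sg := Num.sqrt (t - s).
have sg0 : 0 < sg by rewrite sqrtr_gt0 subr_gt0.
rewrite -(integral_push P mPhi mH H0).
transitivity (\int[law P mid \x normal_prob 0 sg]_z H z)%E.
  apply: eq_measure_integral => A mA _; apply/esym.
  apply: (@product_measure_unique _ _ _ _ _ _ _ (push P mPhi)) => // B C mB mC.
  have := brownian_independent bW s0 st (proj1 (sub_measurableE Fs B) mB) mC.
  by rewrite (brownian_normal bW s0 st mC).
transitivity (\int[law P mid]_w fubini_F (normal_prob 0 sg) H w)%E.
  exact: (@fubini_tonelli1 _ _ _ _ _ (law P mid) (@normal_prob R 0 sg) H mH H0).
transitivity (\int[P]_w fubini_F (normal_prob 0 sg) H w)%E.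
  have mF := @measurable_fun_fubini_tonelli_F _ _ _ _ _ (@normal_prob R 0 sg) H mH H0.
  have F0 w : (0 <= fubini_F (normal_prob 0 sg) H w)%E by apply: integral_ge0.
  exact: (@integral_push _ _ _ _ _ P _ mid _ mF F0).
apply: eq_integral => w _ /=; rewrite /fubini_F.
have mHw : measurable_fun setT (fun y : measurableTypeR R => H (w, y)).
  exact: (measurableT_comp mH (pair1_measurable (w : g_sigma_algebraType (F s)))).
exact: (integral_normal_scale sg0 mHw).
Qed.

(** Freezing: [X] is known at time [s] and the increment is independent of [F s], so only the
    increment is averaged. The event [A] enters [brownian_joint] as a factor [\1_A]. *)
Lemma brownian_condE s t A (X : T -> R) (h : R -> R -> R) :
  0 <= s -> s < t -> F s A -> measurable_wrt (F s) X ->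
  measurable_fun setT (fun z : R * R => h z.1 z.2) -> (forall x y, 0 <= h x y) ->
  (\int[P]_(w in A) (h (X w) (W t w - W s w))%:E =
   \int[P]_(w in A) \int[gam]_y (h (X w) (Num.sqrt (t - s) * y))%:E)%E.
Proof.
move=> s0 st FA mX mh h0.
have Fs := filtration_sigma uF s0.
pose H (z : g_sigma_algebraType (F s) * measurableTypeR R) :=
  ((\1_A (z.1 : T))%:E * (h (X z.1) z.2)%:E)%E.
have mH : measurable_fun setT H.
  apply: emeasurable_funM; apply/measurable_EFinP.
    apply: (@measurableT_comp _ _ _ _ _ _ (\1_A : g_sigma_algebraType (F s) -> R)).
      by apply: measurable_indic; exact/(sub_measurableE Fs).
    exact: measurable_fst.
  have mX1 : measurable_fun setT (fun z : g_sigma_algebraType (F s) * measurableTypeR R => X z.1).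
    apply: (@measurableT_comp _ _ _ _ _ _ (X : g_sigma_algebraType (F s) -> R)).
      exact/(measurable_wrtE Fs).
    exact: measurable_fst.
  have m2 : measurable_fun setT (fun z : g_sigma_algebraType (F s) * measurableTypeR R => z.2 : R).
    exact: measurable_snd.
  exact: (measurableT_comp mh (measurable_fun_pair mX1 m2)).
have H0 z : (0 <= H z)%E by rewrite mule_ge0// lee_fin.
have := brownian_joint s0 st mH H0; rewrite /H /=.
have E (g : T -> \bar R) : (\int[P]_(w in A) g w = \int[P]_w ((\1_A w)%:E * g w))%E.
  rewrite integral_mkcond; apply: eq_integral => w _.
  rewrite epatch_indic muleC//.
rewrite !E => ->; apply: eq_integral => w _.
rewrite ge0_integralZl//.
- apply/measurable_EFinP.
  have m1 : measurable_fun setT (fun y : R => (X w, Num.sqrt (t - s) * y)).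
    by apply: measurable_fun_pair => //; exact: measurable_funM.
  exact: (measurableT_comp mh m1).
- by move=> y _; rewrite lee_fin.
Qed.

End brownian.

Section martingale_lemmas.
Context d (T : measurableType d) (R : realType) (P : probability T R).
Variable G : R -> set (set T).
Hypothesis Gsig : forall t, 0 <= t -> sigma_algebra setT (G t).
Hypothesis Gmeas : forall t, 0 <= t -> G t `<=` measurable.
Implicit Types (X Y : process R T) (s t : R).

Lemma measurable_wrt_comp H (X : T -> R) (f : R -> R) : sigma_algebra setT H ->
  measurable_fun setT f -> measurable_wrt H X -> measurable_wrt H (fun w => f (X w)).
Proof.
move=> sH mf /(measurable_wrtE sH) mX; apply/(measurable_wrtE sH).
exact: (measurableT_comp mf mX).
Qed.

Lemma measurable_wrtD H (X Y : T -> R) : sigma_algebra setT H ->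
  measurable_wrt H X -> measurable_wrt H Y -> measurable_wrt H (fun w => X w + Y w).
Proof.
move=> sH /(measurable_wrtE sH) mX /(measurable_wrtE sH) mY; apply/(measurable_wrtE sH).
exact: measurable_funD.
Qed.

Lemma measurable_wrtS (H H' : set (set T)) (X : T -> R) : H `<=` H' ->
  measurable_wrt H X -> measurable_wrt H' X.
Proof. by move=> HH mX B mB; apply: HH; exact: mX. Qed.

Lemma eq_martingale X Y : (forall t, 0 <= t -> X t = Y t) ->
  martingale P G X -> martingale P G Y.
Proof.
move=> XY [aX iX cX]; split.
- by move=> t t0; rewrite -XY//; exact: aX.
- by move=> t t0; rewrite -XY//; exact: iX.
- by move=> s t s0 st; rewrite -!XY ?(le_trans s0 st)//; exact: cX.
Qed.

Lemma martingale_lin (a b : R) X Y : martingale P G X -> martingale P G Y ->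
  martingale P G (fun t w => a * X t w + b * Y t w).
Proof.
move=> [aX iX cX] [aY iY cY].
have aXY : adapted G (fun t w => a * X t w + b * Y t w).
  move=> t t0; apply: measurable_wrtD => //; first exact: Gsig.
    by apply: (measurable_wrt_comp (f := fun x => a * x)); [exact: Gsig|exact: measurable_funM|exact: aX].
  by apply: (measurable_wrt_comp (f := fun x => b * x)); [exact: Gsig|exact: measurable_funM|exact: aY].
have iZ (c : R) (Z : T -> R) : P.-integrable setT (EFin \o Z) -> P.-integrable setT (fun w => c%:E * (Z w)%:E)%E.
  by move=> iZ; exact: integrableZl.
have iXY t : 0 <= t -> P.-integrable setT (EFin \o (fun w => a * X t w + b * Y t w)).
  move=> t0.
  have := @integrableD _ _ _ P setT measurableT _ _ (iZ a _ (iX t t0)) (iZ b _ (iY t t0)).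
  exact.
have eI t A : 0 <= t -> measurable A -> (\int[P]_(w in A) (a * X t w + b * Y t w)%:E =
    a%:E * (\int[P]_(w in A) (X t w)%:E) + b%:E * (\int[P]_(w in A) (Y t w)%:E))%E.
  move=> t0 mA.
  have iXA : P.-integrable A (fun w => (X t w)%:E) by apply: (integrableS measurableT) => //; exact: iX.
  have iYA : P.-integrable A (fun w => (Y t w)%:E) by apply: (integrableS measurableT) => //; exact: iY.
  rewrite -!integralZl// -integralD//=; exact: integrableZl.
split => // s t s0 st; have t0 := le_trans s0 st; split; [exact: aXY|exact: iXY|].
move=> A GA; have mA := Gmeas s0 GA.
have [_ _ /(_ _ GA) eX] := cX _ _ s0 st; have [_ _ /(_ _ GA) eY] := cY _ _ s0 st.
by rewrite !eI// eX eY.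
Qed.

End martingale_lemmas.

(** * Exponential and quadratic martingales of Brownian motion *)

Section brownian_martingales.
Context d (T : measurableType d) (R : realType) (P : probability T R).
Context (F : R -> set (set T)) (W : process R T).
Hypothesis uF : usual_filtration P F.
Hypothesis bW : brownian_motion P F W.
Implicit Types s t : R.
Local Notation gam := (@normal_prob R 0 1).

Let Fsig t : 0 <= t -> sigma_algebra setT (F t).
Proof. exact: (filtration_sigma uF). Qed.
Let Fmeas t : 0 <= t -> F t `<=` measurable.
Proof. exact: (filtration_measurable uF). Qed.
Let Fle s t : 0 <= s -> s <= t -> F s `<=` F t.
Proof. exact: (filtration_le uF). Qed.

Lemma natural_filtration_sub t : 0 <= t -> natural_filtration W t `<=` F t.
Proof.
move=> t0; apply: smallest_sub; first exact: Fsig.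
move=> _ [s /andP[s0 st] [B mB ->]]; apply: (Fle s0 st).
exact: (brownian_measurable_wrt bW s0).
Qed.

Lemma natural_filtration_sigma t : sigma_algebra setT (natural_filtration W t).
Proof. exact: smallest_sigma_algebra. Qed.

Lemma natural_filtration_wrt t : 0 <= t -> measurable_wrt (natural_filtration W t) (W t).
Proof.
move=> t0 B mB; apply: sub_sigma_algebra; exists t; first by rewrite t0 lexx.
by exists B.
Qed.

Lemma brownian_exp_cond s t A (c : R) : 0 <= s -> s <= t -> F s A ->
  (\int[P]_(w in A) (expR (c * W t w - c ^+ 2 / 2 * t))%:E =
   \int[P]_(w in A) (expR (c * W s w - c ^+ 2 / 2 * s))%:E)%E.
Proof.
move=> s0; rewrite le_eqVlt => /predU1P[<-//|st] FA.
have mc : measurable_fun setT (fun z : R * R => expR (c * (z.1 + z.2) - c ^+ 2 / 2 * t)).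
  apply: measurableT_comp => //; apply: measurable_funB => //.
  by apply: measurable_funM => //; apply: measurable_funD.
pose h x y := expR (c * (x + y) - c ^+ 2 / 2 * t).
have h0 x y : 0 <= h x y by exact: expR_ge0.
have := brownian_condE (h := h) uF bW s0 st FA (brownian_measurable_wrt bW s0) mc h0.
under eq_integral => w _ do rewrite /h [W s w + _]addrC subrK.
move=> ->; apply: eq_integral => w _; rewrite /h.
have E y : expR (c * (W s w + Num.sqrt (t - s) * y) - c ^+ 2 / 2 * t) =
    expR (c * W s w - c ^+ 2 / 2 * t) * expR (c * Num.sqrt (t - s) * y).
  by rewrite -expRD; congr expR; ring.
under eq_integral do rewrite E.
rewrite ge0_integralZ_EFin; last 3 first.
- by apply: measurableT_comp => //; exact: measurable_funM.
- by move=> y; exact: expR_ge0.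
- exact: expR_ge0.
rewrite integral_gauss_expR -EFinM -expRD; congr (expR _)%:E.
rewrite exprMn sqr_sqrtr; last by rewrite subr_ge0 ltW.
by field.
Qed.

Lemma brownian_exp_integrable t (c : R) : 0 <= t ->
  P.-integrable setT (EFin \o (fun w => expR (c * W t w - c ^+ 2 / 2 * t))).
Proof.
move=> t0.
have m1 s : 0 <= s -> measurable_fun setT (fun w => expR (c * W s w - c ^+ 2 / 2 * s)).
  move=> s0; apply: measurableT_comp => //; apply: measurable_funB => //.
  by apply: measurable_funM => //; exact: (brownian_measurable uF bW).
apply/integrableP; split; first exact/measurable_EFinP/m1.
under eq_integral do rewrite /= ger0_norm ?expR_ge0//.
have FT : F 0 setT by have [_ h _] := Fsig (lexx 0); have := h set0; rewrite setD0; apply; case: (Fsig (lexx 0)).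
rewrite (brownian_exp_cond c (lexx 0) t0 FT).
rewrite (_ : (\int[P]_w _)%E = 1%E) ?ltry//.
rewrite (@ge0_ae_eq_integral _ _ _ _ _ _ (cst 1%E))//.
- by rewrite (integral_cst P)// [X in (_ * X)%E](probability_setT P) mul1e.
- exact/measurable_EFinP/m1.
have [N [mN N0 sN]] := brownian_start bW; exists N; split => //.
apply: subset_trans sN => w /= h w0; apply: h => _.
by rewrite w0 !mulr0 subr0 expR0.
Qed.

Lemma exp_martingale (c : R) :
  martingale P (natural_filtration W) (fun t w => expR (c * W t w - c ^+ 2 / 2 * t)).
Proof.
have aX : adapted (natural_filtration W) (fun t w => expR (c * W t w - c ^+ 2 / 2 * t)).
  move=> t t0.
  apply: (measurable_wrt_comp (f := fun x => expR (c * x - c ^+ 2 / 2 * t))).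
  - exact: natural_filtration_sigma.
  - apply: measurableT_comp => //; apply: measurable_funB => //; exact: measurable_funM.
  - exact: natural_filtration_wrt.
split => //; first by move=> t t0; exact: brownian_exp_integrable.
move=> s t s0 st; split; [exact: aX|exact: brownian_exp_integrable|].
by move=> A /(natural_filtration_sub s0) FA; exact/esym/brownian_exp_cond.
Qed.

(** The integral of the indicator of []a, b]], with bracket [step_clock]. These are the only test
    processes used to derive c) from a) and b). *)
Definition brownian_step (a b : R) : process R T :=
  fun t w => W (Num.min t b) w - W (Num.min t a) w.

Definition step_clock (a b t : R) : R := Num.min t b - Num.min t a.

(** Between [s] and [t] the step moves only on the intersection of [[s, t]] and [[a, b]], whose ends
    are [p] and [q]. As [s <= p], an event of [F s] lies in [F p], and the martingale properties
    reduce to a single increment. *)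
Lemma brownian_step_incr a b s t : 0 <= a <= b -> 0 <= s -> s <= t ->
  (brownian_step a b t = brownian_step a b s /\ step_clock a b t = step_clock a b s) \/
  exists p q, [/\ s <= p, p < q, step_clock a b t - step_clock a b s = q - p &
    forall w, brownian_step a b t w = brownian_step a b s w + (W q w - W p w)].
Proof.
move=> /andP[a0 ab] s0 st; rewrite /brownian_step /step_clock.
have [sb|bs] := leP b s.
  left; have bt := le_trans sb st.
  by rewrite !min_r ?(le_trans ab)//.
have [ta|at_] := leP t a.
  left; have sa := le_trans st ta.
  split; last by rewrite !min_l ?(le_trans _ ab)//; rewrite !subrr.
  by apply/funext => w; rewrite !min_l ?(le_trans _ ab)//; rewrite !subrr.
have [tb|bt] := leP t b.
  have [as_|sa] := leP a s.
    have [->|nst] := eqVneq s t; first by left.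
    right; exists s, t; split=> //.
    - by rewrite lt_neqAle nst.
    - ring.
    - by move=> w; ring.
  right; exists a, t; split=> //.
  - exact: ltW.
  - ring.
  - by move=> w; ring.
have [as_|sa] := leP a s.
  right; exists s, b; split=> //.
  - ring.
  - by move=> w; ring.
have [eab|nab] := eqVneq a b.
  by left; rewrite -eab; split; [apply/funext => w|]; rewrite !subrr.
right; exists a, b; split=> //.
- exact: ltW.
- by rewrite lt_neqAle nab.
- ring.
- by move=> w; ring.
Qed.

(** The free [X] serves twice: constants give the mean of the increment, and the current value of a
    step gives the compensated square. *)
Lemma brownian_sqr_cond p q A (X : T -> R) : 0 <= p -> p < q -> F p A ->
  measurable_wrt (F p) X ->
  (\int[P]_(w in A) ((X w + (W q w - W p w)) ^+ 2)%:E =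
   \int[P]_(w in A) (X w ^+ 2 + (q - p))%:E)%E.
Proof.
move=> p0 pq FA mX.
have mc : measurable_fun setT (fun z : R * R => (z.1 + z.2) ^+ 2).
  by apply: measurable_funX; apply: measurable_funD.
rewrite (brownian_condE (h := fun x y => (x + y) ^+ 2) uF bW p0 pq FA mX mc (fun x y => sqr_ge0 _)).
apply: eq_integral => w _; rewrite integral_gauss_sqrD sqr_sqrtr//.
by rewrite subr_ge0 ltW.
Qed.


Lemma brownian_step_sqr_integrable a b t : 0 <= a <= b -> 0 <= t ->
  [/\ measurable_wrt (F t) (brownian_step a b t),
      P.-integrable setT (EFin \o (fun w => brownian_step a b t w ^+ 2)) &
      P.-integrable setT (EFin \o brownian_step a b t)].
Proof.
move=> ab t0; have /andP[a0 ab'] := ab.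
have mt : measurable_wrt (F t) (brownian_step a b t).
  have h r : 0 <= r -> measurable_wrt (F t) (W (Num.min t r)).
    move=> r0; have m0 : 0 <= Num.min t r by rewrite le_min t0.
    apply: (measurable_wrtS (Fle m0 _)); first by rewrite ge_min lexx.
    exact: (brownian_measurable_wrt bW m0).
  apply: measurable_wrtD; first exact: Fsig.
    by apply: h; rewrite (le_trans a0).
  by apply: (measurable_wrt_comp (f := -%R)); [exact: Fsig|exact: oppr_measurable|exact: h].
have mm := measurable_wrt_fun (Fmeas t0) mt.
have i2 : P.-integrable setT (EFin \o (fun w => brownian_step a b t w ^+ 2)).
  apply/integrableP; split; first by apply/measurable_EFinP; exact: measurable_funX.
  under eq_integral do rewrite /= ger0_norm ?sqr_ge0//.
  have s00 w : brownian_step a b 0 w = 0.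
    by rewrite /brownian_step !min_l ?(le_trans a0)//; rewrite subrr.
  have [[e _]|[p [q [p0 pq _ e]]]] := brownian_step_incr ab (lexx 0) t0.
    under eq_integral do rewrite e s00 expr0n/=.
    by rewrite integral0 ltry.
  have FT : F p setT by have [h1 h2 _] := Fsig p0; have := h2 _ h1; rewrite setD0.
  under eq_integral do rewrite e s00.
  have m0 : measurable_wrt (F p) (fun _ : T => 0 : R).
    by apply/(measurable_wrtE (Fsig p0)); exact: measurable_cst.
  rewrite (brownian_sqr_cond p0 pq FT m0).
  by rewrite (integral_cst P)// [X in (_ * X)%E](probability_setT P) mule1 ltry.
split => //.
apply: (@le_integrable _ _ _ P setT measurableT _ (fun w => (1 + brownian_step a b t w ^+ 2)%:E)).
- exact/measurable_EFinP.
- move=> w _; rewrite lee_fin [leRHS]ger0_norm ?addr_ge0 ?sqr_ge0//.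
  set x := brownian_step a b t w; rewrite -[x ^+ 2]real_normK ?num_real//.
  have := sqr_ge0 (`|x| - 1); have := normr_ge0 x; rewrite sqrrB1; nra.
- have := @integrableD _ _ _ P setT measurableT _ _
    (@finite_measure_integrable_cst _ _ _ P _ 1 measurableT) i2.
  exact.
Qed.

(* Comparing the second moments of [x + dW] for [x = 0] and [x = 1] gives the mean of [dW]. *)
Lemma brownian_incr_mean0 p q A : 0 <= p -> p < q -> F p A ->
  P.-integrable setT (EFin \o (fun w => W q w - W p w)) /\
  (\int[P]_(w in A) (W q w - W p w)%:E = 0)%E.
Proof.
move=> p0 pq FA.
have pq2 : 0 <= p <= q by rewrite p0 ltW.
have q0 : 0 <= q by rewrite (le_trans p0) ?ltW.
have [_ i2 i1] := brownian_step_sqr_integrable pq2 q0.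
have E w : brownian_step p q q w = W q w - W p w.
  by rewrite /brownian_step minxx min_r// ltW.
have {}i1 : P.-integrable setT (EFin \o (fun w => W q w - W p w)).
  by rewrite -(funext E).
have {}i2 : P.-integrable setT (EFin \o (fun w => (W q w - W p w) ^+ 2)).
  by rewrite -(funext (fun w => congr1 (fun x => x ^+ 2) (E w))).
split => //.
have mA := Fmeas p0 FA.
have mc (x : R) : measurable_wrt (F p) (fun _ : T => x).
  by apply/(measurable_wrtE (Fsig p0)); exact: measurable_cst.
have e0 := brownian_sqr_cond p0 pq FA (mc 0).
have e1 := brownian_sqr_cond p0 pq FA (mc 1).
have iA (f : T -> R) : P.-integrable setT (EFin \o f) -> P.-integrable A (EFin \o f).
  by move=> h; apply: (integrableS measurableT).
have icst (x : R) : P.-integrable A (EFin \o cst x).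
  by apply: finite_measure_integrable_cst.
move: e0; under eq_integral do rewrite add0r.
move=> e0.
move: e1; under eq_integral => w _.
  rewrite (_ : (1 + (W q w - W p w)) ^+ 2 = 1 + (2 * (W q w - W p w) + (W q w - W p w) ^+ 2)); last by ring.
  rewrite !EFinD EFinM; over.
have i2l := integrableZl measurableT 2 i1.
rewrite integralD//=; last 2 first.
- exact: icst.
- apply: integrableD => //=; last exact: iA.
  by apply: integrableZl => //; exact: iA.
rewrite integralD//=; last 2 first.
- by apply: integrableZl => //; exact: iA.
- exact: iA.
rewrite integralZl//=; last exact: iA.
rewrite e0 !(integral_cst P)// expr0n expr1n/= add0r.
have PA : P A \is a fin_num by exact: fin_num_measure.
have iI : (\int[P]_(x in A) (W q x - W p x)%:E)%E \is a fin_num.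
  by apply: integrable_fin_num => //; exact: iA.
rewrite -(fineK PA) -(fineK iI) -!EFinM -!EFinD => -[] e.
by congr EFin; lra.
Qed.

Lemma brownian_step_martingale a b : 0 <= a <= b -> martingale P F (brownian_step a b).
Proof.
move=> ab; split.
- by move=> t t0; have [] := brownian_step_sqr_integrable ab t0.
- by move=> t t0; have [] := brownian_step_sqr_integrable ab t0.
move=> s t s0 st; have [ms _ is_] := brownian_step_sqr_integrable ab s0.
split => // A FA.
have [[-> _]//|[p [q [sp pq _ e]]]] := brownian_step_incr ab s0 st.
have p0 := le_trans s0 sp.
have mA := Fmeas s0 FA.
have [i1 e1] := brownian_incr_mean0 p0 pq (Fle s0 sp FA).
under [RHS]eq_integral do rewrite e EFinD.
rewrite integralD//=; last 2 first.
- by apply: (integrableS measurableT) => //; exact: is_.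
- by apply: (integrableS measurableT) => //; exact: i1.
by rewrite e1 adde0.
Qed.

Lemma brownian_step_sqr_martingale a b : 0 <= a <= b ->
  martingale P F (fun t w => brownian_step a b t w ^+ 2 - step_clock a b t).
Proof.
move=> ab.
have aX : adapted F (fun t w => brownian_step a b t w ^+ 2 - step_clock a b t).
  move=> t t0; have [mt _ _] := brownian_step_sqr_integrable ab t0.
  apply: (measurable_wrt_comp (f := fun x => x ^+ 2 - step_clock a b t)) mt.
    exact: Fsig.
  by apply: measurable_funB => //; exact: measurable_funX.
have iX t : 0 <= t -> P.-integrable setT (EFin \o (fun w => brownian_step a b t w ^+ 2 - step_clock a b t)).
  move=> t0; have [_ i2 _] := brownian_step_sqr_integrable ab t0.
  have := @integrableD _ _ _ P setT measurableT _ _ i2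
    (@finite_measure_integrable_cst _ _ _ P _ (- step_clock a b t) measurableT).
  exact.
split => // s t s0 st; split; [exact: aX|exact: iX|] => A FA.
have [ms i2 is_] := brownian_step_sqr_integrable ab s0.
have mA := Fmeas s0 FA.
have t0 := le_trans s0 st.
have [_ it2 _] := brownian_step_sqr_integrable ab t0.
have sub (f : T -> R) (c : R) : P.-integrable setT (EFin \o f) ->
    (\int[P]_(w in A) (f w + c)%:E = \int[P]_(w in A) (f w)%:E + c%:E * P A)%E.
  move=> fi; under eq_integral do rewrite EFinD.
  rewrite integralD//=; last 2 first.
  - exact: (integrableS measurableT).
  - exact: finite_measure_integrable_cst.
  by rewrite (integral_cst P).
have [[-> ->]//|[p [q [sp pq eq_ e]]]] := brownian_step_incr ab s0 st.
have p0 := le_trans s0 sp.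
have msp : measurable_wrt (F p) (brownian_step a b s) by exact: (measurable_wrtS (Fle s0 sp)).
have := brownian_sqr_cond p0 pq (Fle s0 sp FA) msp.
under eq_integral do rewrite -e.
move=> E; rewrite (sub (fun w => brownian_step a b s w ^+ 2))//.
rewrite (sub (fun w => brownian_step a b t w ^+ 2))// E.
rewrite (sub (fun w => brownian_step a b s w ^+ 2))//.
have PA : P A \is a fin_num by exact: fin_num_measure.
rewrite -addeA -(fineK PA) -!EFinM -EFinD; congr (_ + _%:E)%E.
rewrite -mulrDl; congr (_ * _); rewrite -eq_; ring.
Qed.

End brownian_martingales.

(** * Continuity of [f] up to time 0, and Lebesgue-null sets *)

Section continuous_positive_lemmas.
Context {R : realType}.
Variable f : R -> R -> R.
Hypothesis cf : continuous_positive f.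

(** [f] is continuous only within the half plane of nonnegative first argument, so [a] must take its
    values there. *)
Lemma continuous_positive_comp (U : topologicalType) (a b : U -> R) (z : U) :
  (forall w, 0 <= a w) -> {for z, continuous a} -> {for z, continuous b} ->
  {for z, continuous (fun w => f (a w) (b w))}.
Proof.
move=> a0 ca cb; have [/subspace_continuousP cF _] := cf.
have h := cF (a z, b z) (a0 z).
have cab : (fun w => (a w, b w)) @ nbhs z --> (a z, b z).
  by apply: (@cvg_pair _ _ _ _ (nbhs (a z)) (nbhs (b z))); [exact: ca|exact: cb].
move=> V /h /= hV; have {hV} := cab _ hV.
rewrite /nbhs/= => hV; apply: filterS hV => w /= hw; apply: hw; exact: a0.
Qed.

Lemma continuous_positive_section (t : R) : 0 <= t -> continuous (f t).
Proof.
move=> t0 x; apply: (@continuous_positive_comp R (fun=> t) id x) => //.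
exact: cst_continuous.
Qed.

Lemma continuous_positive_cvg0 (x : R) : (fun n : nat => f n.+1%:R^-1 x) @ \oo --> f 0 x.
Proof.
have [/subspace_continuousP cF _] := cf.
have h := cF (0, x) (lexx 0).
have cab : (fun n : nat => (n.+1%:R^-1 : R, x)) @ \oo --> (0 : R, x).
  by apply: (@cvg_pair _ _ _ _ (nbhs (0 : R)) (nbhs x)); [exact: cvg_harmonic|exact: cvg_cst].
move=> V /h /= hV; have {hV} := cab _ hV.
rewrite /nbhs/= => hV; apply: filterS hV => w /= hw; apply: hw.
by rewrite /= invr_ge0.
Qed.

Lemma continuous_positive_exp0 (b c : R) :
  (forall t x, 0 < t -> f t x = expR (b * x + c * t)) ->
  forall x, f 0 x = expR (b * x).
Proof.
move=> h x.
have h1 := @continuous_positive_cvg0 x.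
have h2 : (fun n : nat => f n.+1%:R^-1 x) @ \oo --> expR (b * x).
  under eq_fun do rewrite h//.
  have -> : expR (b * x) = expR (b * x + c * 0) by rewrite mulr0 addr0.
  apply: (@cvg_comp _ _ _ (fun n : nat => b * x + c * n.+1%:R^-1) expR); last exact: continuous_expR.
  apply: cvgD; first exact: cvg_cst.
  by apply: cvgM; [exact: cvg_cst|exact: cvg_harmonic].
exact: (cvg_unique _ h1 h2).
Qed.

End continuous_positive_lemmas.

Lemma continuous_ball (R : realType) (h : R -> R) (x e : R) : continuous h -> 0 < e ->
  exists2 dl, 0 < dl & forall y, `|y - x| < dl -> `|h y - h x| < e.
Proof.
move=> ch e0; have /cvgrPdist_lt /(_ _ e0) /nbhs_ballP[dl /= dl0 H] := ch x.
exists dl => // y yx; rewrite distrC; apply: H.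
by rewrite /ball/= distrC.
Qed.

(** In the limit [e -> 0] the bounds read [V <= G] and [2 * G <= G + V]. The limit is replaced by
    one [e], the gap divided by [2 * (G + V + 4)]. *)
Lemma squeeze_eq (R : realType) (V G : R) : 0 <= V -> 0 <= G ->
  (forall e, 0 < e < 1 -> V <= (1 + e) * (G + e) /\ 2 * (G - e) <= (1 + e) * (G + e + V)) ->
  V = G.
Proof.
move=> V0 G0 H.
have [VG|GV|//] := ltgtP V G.
- have S0 : 0 < 2 * (G + V + 4) by lra.
  have e01 : 0 < (G - V) / (2 * (G + V + 4)) < 1.
    by rewrite divr_gt0 ?subr_gt0//= ltr_pdivrMr//; lra.
  have [_ +] := H _ e01; have := divfK (lt0r_neq0 S0) (G - V).
  by move: e01; set e := _ / _ => /andP[e0 e1] eE h; nra.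
- have S0 : 0 < 2 * (G + V + 4) by lra.
  have e01 : 0 < (V - G) / (2 * (G + V + 4)) < 1.
    by rewrite divr_gt0 ?subr_gt0//= ltr_pdivrMr//; lra.
  have [+ _] := H _ e01; have := divfK (lt0r_neq0 S0) (V - G).
  by move: e01; set e := _ / _ => /andP[e0 e1] eE h; nra.
Qed.

Section null_sets.
Context {R : realType}.
Local Notation mu := (@lebesgue_measure R).

Lemma lebesgue_null_affine (D : set R) (s a : R) : 0 < s -> measurable D ->
  mu D = 0%E -> mu ((fun x => s * x + a) @^-1` D) = 0%E.
Proof.
move=> s0 mD; rewrite (lebesgue_affine a s0 mD) => /eqP.
by rewrite mule_eq0 eqe gt_eqF//= => /eqP.
Qed.

Lemma measurable_affine_preimage (D : set R) (s a : R) : measurable D ->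
  measurable ((fun x => s * x + a) @^-1` D).
Proof.
move=> mD; rewrite -[_ @^-1` _]setTI.
have h : measurable_fun setT (fun x : R => s * x + a).
  by apply: measurable_funD => //; exact: measurable_funM.
exact: h.
Qed.

(** The forbidden values of [d] fill three affine copies of [D], which are null and cannot cover
    []0, e[]. *)
Lemma lebesgue_null_avoid (D : set R) (x e : R) : measurable D -> mu D = 0%E -> 0 < e ->
  exists d, [/\ 0 < d < e, ~ D (x + d), ~ D (x - d) & ~ D (x + 2 * d)].
Proof.
move=> mD D0 e0.
pose D1 := (fun y : R => 1 * y + x) @^-1` D.
pose D2 := (-%R : measurableTypeR R -> measurableTypeR R) @^-1` D1.
pose D3 := (fun y : R => 2 * y + x) @^-1` D.
have mD1 : measurable D1 by exact: measurable_affine_preimage.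
have mD2 : measurable D2.
  by rewrite /D2 -[_ @^-1` _]setTI; apply: oppr_measurable => //; exact: measurableT.
have mD3 : measurable D3 by exact: measurable_affine_preimage.
have D10 : mu D1 = 0%E by exact: lebesgue_null_affine.
have D20 : mu D2 = 0%E by have := lebesgue_measureN mD1; rewrite /pushforward => ->.
have D30 : mu D3 = 0%E by exact: lebesgue_null_affine.
apply: contrapT => h.
have sub : `]0, e[%classic `<=` D1 `|` D2 `|` D3.
  move=> d /=; rewrite in_itv/= => de.
  apply: contrapT => /not_orP[/not_orP[n1 n2] n3]; apply: h; exists d; split => //.
  - by move: n1; rewrite /D1/= mul1r addrC.
  - by move: n2; rewrite /D2 /D1/= mul1r addrC.
  - by move: n3; rewrite /D3/= addrC.
have : (mu `]0%R, e[ <= mu (D1 `|` D2 `|` D3))%E.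
  apply: le_measure; rewrite ?inE//.
  by apply: measurableU => //; exact: measurableU.
rewrite lebesgue_measure_itv/= lte_fin e0 leNgt; apply/negP; rewrite negbK.
apply: (@le_lt_trans _ _ 0%E); last by rewrite -EFinB lte_fin subr0.
rewrite measure_le0; apply/eqP; apply: null_set_setU => //.
  exact: measurableU.
exact: null_set_setU.
Qed.

End null_sets.

(** * From the martingale property to the averaging identity at every point *)

Section martingale_heat.
Context d (T : measurableType d) (R : realType) (P : probability T R).
Context (F : R -> set (set T)) (W : process R T).
Hypothesis uF : usual_filtration P F.
Hypothesis bW : brownian_motion P F W.
Implicit Types s t : R.
Local Notation gam := (@normal_prob R 0 1).

Lemma brownian_marginal s (k : R -> \bar R) : 0 < s -> measurable_fun setT k ->
  (forall x, 0 <= k x)%E -> (\int[P]_w k (W s w) = \int[normal_prob 0 (Num.sqrt s)]_x k x)%E.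
Proof.
move=> s0 mk k0.
have ms := brownian_measurable uF bW (ltW s0).
have m0 := brownian_measurable uF bW (lexx 0).
have mD : measurable_fun setT (fun w => W s w - W 0 w : measurableTypeR R).
  exact: measurable_funB.
(* [W 0] vanishes only almost surely, while the normal law is that of the increment. *)
transitivity (\int[P]_w k (W s w - W 0 w)%R)%E.
  apply: ge0_ae_eq_integral => //; try exact: measurableT_comp.
  have [N [mN N0 sN]] := brownian_start bW; exists N; split => //.
  apply: subset_trans sN => w /= h w0; apply: h => _.
  by rewrite w0 subr0.
rewrite -(@integral_push _ _ _ _ _ P _ mD k mk k0).
apply: eq_measure_integral => A mA _; rewrite pushE.
have := brownian_normal bW (lexx 0) s0 mA; rewrite subr0; exact.
Qed.

Variable g : R -> R -> R.
Hypothesis cg : forall t, 0 < t -> continuous (g t).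
Hypothesis g0 : forall t x, 0 <= t -> 0 <= g t x.
Hypothesis mgW : martingale P (natural_filtration W) (fun t w => g t (W t w)).

Let v t r x := (\int[gam]_y (g t (x + r * y))%:E)%E.

Let mg t : 0 < t -> measurable_fun setT (g t).
Proof. by move=> t0; apply: continuous_measurable_fun; exact: cg. Qed.

Let mgs t : 0 < t -> measurable_fun setT (fun z : R * R => g t (z.1 + z.2)).
Proof. by move=> t0; apply: measurableT_comp; [exact: mg|exact: measurable_funD]. Qed.

Implicit Types (x y r b : R).
Let mgx t x r : 0 < t -> measurable_fun setT (fun y => g t (x + r * y)).
Proof.
move=> t0; apply: measurableT_comp; first exact: mg.
by apply: measurable_funD => //; exact: measurable_funM.
Qed.

Let mv t r : 0 < t -> measurable_fun setT (v t r).
Proof.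
move=> t0.
pose h (z : R * measurableTypeR R) := (g t (z.1 + r * z.2))%:E.
have mh : measurable_fun setT h.
  apply/measurable_EFinP.
  have m1 : measurable_fun setT (fun z : R * measurableTypeR R => (z.1, r * z.2) : R * R).
    apply: measurable_fun_pair; first exact: measurable_fst.
    by apply: measurable_funM => //; exact: measurable_snd.
  exact: (measurableT_comp (mgs t0) m1).
have h0 z : (0 <= h z)%E by rewrite lee_fin g0// ltW.
exact: (@measurable_fun_fubini_tonelli_F _ _ _ _ _ gam h mh h0).
Qed.

(** The martingale property tested on the events that [W s] lies in [B] identifies [g s] and the
    average up to a null set of the law of [W s]. *)
Let v_ae s r : 0 < s -> 0 < r -> exists D : set R,
  [/\ measurable D, lebesgue_measure D = 0%E &
      forall x, ~ D x -> v (s + r ^+ 2) r x = (g s x)%:E].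
Proof.
move=> s0 r0; set t := s + r ^+ 2.
have st : s < t by rewrite ltrDl exprn_gt0.
have t0 := lt_trans s0 st.
have rE : Num.sqrt (t - s) = r by rewrite /t addrC addKr sqrtr_sqr gtr0_norm.
have [_ _ cX] := mgW.
have [_ iX eX] := cX _ _ (ltW s0) (ltW st).
have E (k : R -> \bar R) (B : set R) : measurable B -> measurable_fun setT k -> (forall x, 0 <= k x)%E ->
    (\int[P]_(w in W s @^-1` B) k (W s w) = \int[normal_prob 0 (Num.sqrt s)]_(x in B) k x)%E.
  move=> mB mk k0; rewrite integral_mkcond [RHS]integral_mkcond.
  rewrite -brownian_marginal//; last 2 first.
  - by apply/(measurable_restrictT _ mB); exact: measurable_funTS.
  - by move=> x; rewrite patchE; case: ifP.
have ae : ae_eq (@normal_prob R 0 (Num.sqrt s)) setT (fun x => (g s x)%:E) (v t r).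
  apply: integral_ae_eq => //.
  - apply/integrableP; split; first by apply/measurable_EFinP; exact: mg.
    under eq_integral do rewrite gee0_abs ?lee_fin ?g0 ?(ltW s0)//.
    rewrite -brownian_marginal//; last 2 first.
    - by apply/measurable_EFinP; exact: mg.
    - by move=> x; rewrite lee_fin g0// ltW.
    have /integrableP[_] := iX.
    by under eq_integral do rewrite /= ger0_norm ?g0 ?(ltW s0)//.
  - exact: mv.
  move=> B _ mB; rewrite -!E//; last 4 first.
  - exact: mv.
  - by move=> x; apply: integral_ge0 => y _; rewrite lee_fin g0// ltW.
  - by apply/measurable_EFinP; exact: mg.
  - by move=> x; rewrite lee_fin g0// ltW.
  have hw : measurable_wrt (natural_filtration W s) (W s) by apply: natural_filtration_wrt; exact: ltW.
  have NB : natural_filtration W s (W s @^-1` B) by exact: hw.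
  rewrite (eX _ NB).
  have FB := natural_filtration_sub uF bW (ltW s0) NB.
  have := brownian_condE (h := fun x y => g t (x + y)) uF bW (ltW s0) st FB
    (brownian_measurable_wrt bW (ltW s0)) (mgs t0) (fun x y => g0 _ (ltW t0)).
  by under eq_integral do rewrite [W s _ + _]addrC subrK; rewrite rE.
have [N [mN N0 sN]] := ae; exists N; split => //.
  by apply: (normal_prob_eq0 _ mN N0); rewrite gt_eqF// sqrtr_gt0.
move=> x nN; apply: contrapT => h; apply: nN; apply: sN => /= e; apply: h.
by rewrite -e.
Qed.

(** The tilting argument of [heat_midpoint], for the average itself: it uses positivity only, holds
    for infinite values, and its constant tends to [1 / 2] as [b -> 0]. *)
Let v_convex t r x b : 0 < t ->
  (v t r x <= (expR (b ^+ 2 / 2) / 2)%:E * (v t r (x + r * b) + v t r (x - r * b)))%E.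
Proof.
move=> t0.
have mE := mgx x r t0; have h0 y : 0 <= g t (x + r * y) by rewrite g0// ltW.
have tilt c : (v t r (x + r * c) = \int[gam]_y (g t (x + r * y) * expR (c * y - c ^+ 2 / 2))%:E)%E.
  rewrite /v.
  under eq_integral => y _ do rewrite -addrA -mulrDr [c + y]addrC.
  have mE' : measurable_fun setT (fun y => (g t (x + r * y))%:E) by exact/measurable_EFinP.
  rewrite (integral_gauss_translate c mE')//.
have me c : measurable_fun setT (fun y : R => expR (c * y - c ^+ 2 / 2)).
  by apply: measurableT_comp => //; apply: measurable_funB => //; exact: measurable_funM.
have mm c : measurable_fun setT (fun y : R => g t (x + r * y) * expR (c * y - c ^+ 2 / 2)).
  by apply: measurable_funM.
have m0 c y : 0 <= g t (x + r * y) * expR (c * y - c ^+ 2 / 2).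
  by rewrite mulr_ge0// expR_ge0.
rewrite -mulrN !tilt -ge0_integralD_EFin//; do ?exact: mm.
rewrite -ge0_integralZ_EFin; last 3 first.
- by apply: measurable_funD; exact: mm.
- by move=> y; rewrite addr_ge0.
- by rewrite divr_ge0// expR_ge0.
apply: ge0_le_integral_EFin => //.
- by apply: measurable_funM => //; apply: measurable_funD; exact: mm.
move=> y; rewrite sqrrN -mulrDr mulrCA ler_peMr//.
have e1 : expR (b ^+ 2 / 2) * expR (b * y - b ^+ 2 / 2) = expR (b * y).
  by rewrite -expRD; congr expR; ring.
have e2 : expR (b ^+ 2 / 2) * expR (- b * y - b ^+ 2 / 2) = expR (- (b * y)).
  by rewrite -expRD; congr expR; ring.
rewrite mulrAC mulrDr e1 e2 ler_pdivlMr// mul1r expRN.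
have e0 := expR_gt0 (b * y); rewrite -subr_ge0.
have -> : expR (b * y) + (expR (b * y))^-1 - 2 = (expR (b * y) - 1) ^+ 2 / expR (b * y).
  by field; rewrite gt_eqF.
by rewrite divr_ge0 ?sqr_ge0// ltW.
Qed.

Let heat_pos s r x : 0 < s -> 0 < r -> v (s + r ^+ 2) r x = (g s x)%:E.
Proof.
move=> s0 r0; set t := s + r ^+ 2.
have t0 : 0 < t by rewrite addr_gt0// exprn_gt0.
have [D [mD D0 vD]] := v_ae s0 r0.
pose K (y : R) := expR ((y / r) ^+ 2 / 2).
have cK : continuous K.
  apply: (@continuous_compf _ (fun y => (y / r) ^+ 2 / 2) expR); last exact: continuous_expR.
  have c1 : continuous (fun y : R => y / r).
    by apply: continuous_mulf => z; [exact: cvg_id|exact: cst_continuous].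
  apply: (@continuous_mulf _ (fun y => (y / r) ^+ 2) (fun=> 2^-1)); last by move=> z; exact: cst_continuous.
  exact: (continuous_mulf c1 c1).
have K1 y : 1 <= K y by rewrite -expR0 ler_expR divr_ge0// sqr_ge0.
have vge0 y : (0 <= v t r y)%E by apply: integral_ge0 => z _; rewrite lee_fin g0// ltW.
(* The upper bound on the average at [x] is convexity at [x] between [x - dl] and [x + dl]; the
   lower bound is convexity at [x + dl] between [x] and [x + 2 * dl]. All these points other than
   [x] avoid [D]. *)
have key e : 0 < e < 1 -> exists k a b c,
    [/\ 1 <= k <= 1 + e, g s x - e <= c, a + b <= 2 * (g s x + e) /\ 0 <= a + b,
       (v t r x <= ((k / 2) * (a + b))%:E)%E &
       (c%:E <= (k / 2)%:E * ((g s x + e)%:E + v t r x))%E].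
  move=> /andP[e0 e1].
  have [d1 d10 h1] := continuous_ball x (cg s0) e0.
  have [d2 d20 h2] := continuous_ball 0 cK e0.
  have e3 : 0 < Num.min d1 d2 / 2 by rewrite divr_gt0// lt_min d10.
  have [dl [/andP[dl0 dle] n1 n2 n3]] := lebesgue_null_avoid x mD D0 e3.
  have [dd1 dd2] : 2 * dl < d1 /\ dl < d2.
    have : 2 * dl < Num.min d1 d2 by lra.
    by rewrite lt_min => /andP[? ?]; split => //; lra.
  have rb : r * (dl / r) = dl by rewrite mulrC divfK// gt_eqF.
  have KE : expR ((dl / r) ^+ 2 / 2) / 2 = K dl / 2 by [].
  have g1 : `|g s (x + dl) - g s x| < e by apply: h1; rewrite addrAC subrr add0r gtr0_norm//; lra.
  have g2 : `|g s (x - dl) - g s x| < e by apply: h1; rewrite addrAC subrr add0r normrN gtr0_norm//; lra.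
  have g3 : `|g s (x + 2 * dl) - g s x| < e.
    by apply: h1; rewrite addrAC subrr add0r gtr0_norm// mulr_gt0.
  have k1 : `|K dl - K 0| < e by apply: h2; rewrite subr0 gtr0_norm.
  have K0 : K 0 = 1 by rewrite /K mul0r expr0n/= mul0r expR0.
  rewrite K0 in k1.
  move: g1 g2 g3 k1; rewrite !ltr_norml => /andP[? ?] /andP[? ?] /andP[? ?] /andP[? ?].
  have p1 := g0 (x + dl) (ltW s0); have p2 := g0 (x - dl) (ltW s0).
  exists (K dl), (g s (x + dl)), (g s (x - dl)), (g s (x + dl)); split.
  - by rewrite K1/=; lra.
  - by lra.
  - by split; lra.
  - have := v_convex r x (dl / r) t0; rewrite rb KE (vD _ n1) (vD _ n2) -EFinD -EFinM; exact.
  - have := v_convex r (x + dl) (dl / r) t0; rewrite rb KE.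
    have -> : x + dl + dl = x + 2 * dl by ring.
    have -> : x + dl - dl = x by ring.
    rewrite (vD _ n1) (vD _ n3) => /le_trans; apply.
    rewrite lee_pmul2l// ?lte_fin ?divr_gt0 ?expR_gt0// leeD2r//.
    by rewrite lee_fin; lra.
have vfin : v t r x \is a fin_num.
  rewrite ge0_fin_numE//; have [|k [a [b [c [_ _ _ h _]]]]] := key (1/2).
    by apply/andP; split; lra.
  exact: (le_lt_trans h (ltry _)).
have := vge0 x; move: key; rewrite -(fineK vfin); set V := fine _ => key; rewrite lee_fin => V0.
congr EFin; apply: squeeze_eq => //; first exact: g0 (ltW s0).
move=> e e01; have [k [a [b [c [/andP[ka kb] hc [ab ab0] h1 h2]]]]] := key e e01.
move: h1 h2; rewrite -EFinD -EFinM !lee_fin => h1 h2.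
have G0 := g0 x (ltW s0); move/andP: e01 => [e0 e1].
split; nra.
Qed.

Lemma martingale_heat s r x : 0 < s ->
  (\int[gam]_y (g (s + r ^+ 2) (x + r * y))%:E = (g s x)%:E)%E.
Proof.
move=> s0; have [r0|r0|->] := ltgtP r 0.
- have r0' : 0 < - r by rewrite oppr_gt0.
  have := heat_pos x s0 r0'; rewrite sqrrN /v.
  have t0 : 0 < s + r ^+ 2 by rewrite ltr_wpDr// sqr_ge0.
  have m1 : measurable_fun setT (fun y => (g (s + r ^+ 2) (x + r * y))%:E).
    by apply/measurable_EFinP; exact: mgx.
  rewrite -(integral_gauss_opp m1); last by move=> y; rewrite lee_fin g0// ltW.
  by move=> <-; apply: eq_integral => y _; rewrite mulrN mulNr.
- exact: heat_pos.
- under eq_integral do rewrite mul0r addr0 expr0n/= addr0.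
  by rewrite integral_gauss_cst// lee_fin g0// ltW.
Qed.

End martingale_heat.

(** * Equivalence of c) and d) *)

Section assertions_cd.
Context d (T : measurableType d) (R : realType) (P : probability T R).
Context (F : R -> set (set T)) (W : process R T).
Hypothesis uF : usual_filtration P F.
Hypothesis bW : brownian_motion P F W.
Variable f : R -> R -> R.
Local Notation gam := (@normal_prob R 0 1).

Let exp_form := exists c : R, forall u v : R, 0 <= u -> f u v = expR (c * v - c / 2 * u).

Lemma exp_form_continuous_positive : exp_form -> continuous_positive f.
Proof.
move=> [c fE]; split; last by move=> u v u0; rewrite fE// expR_gt0.
have cG : continuous (fun p : R * R => expR (c * p.2 - c / 2 * p.1)).
  move=> p; apply: (@cvg_comp _ _ _ (fun p : R * R => c * p.2 - c / 2 * p.1) expR); last exact: continuous_expR.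
  apply: cvgB.
    by apply: cvgM; [exact: cvg_cst|exact: cvg_snd].
  by apply: cvgM; [exact: cvg_cst|exact: cvg_fst].
apply: (@subspace_eq_continuous _ _ _ (fun p : R * R => expR (c * p.2 - c / 2 * p.1))).
  by move=> p /set_mem/= p0; rewrite /from_subspace/= fE.
exact: continuous_subspaceT.
Qed.

Lemma exp_form_martingales : exp_form ->
  [/\ continuous_positive f, f 0 0 = 1 &
    exists lambda1 lambda2 : R,
      [/\ martingale P (natural_filtration W)
            (fun t w => f t (W t w) / expR (lambda1 * t)),
          martingale P (natural_filtration W)
            (fun t w => f t (W t w) ^+ 2 / expR (lambda2 * t)) &
          martingale P (natural_filtration W)
            (fun t w => f (4 * t) (2 * W t w + t) / expR (lambda2 * t))]].
Proof.
move=> ef; have cf := exp_form_continuous_positive ef; case: ef => c fE.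
split => //; first by rewrite fE// !mulr0 subr0 expR0.
(* Under c), [f (4 t) (2 x + t)] equals [(f t x) ^ 2 = exp (2 c x - c t)], so the last two processes
   are both the exponential martingale of parameter [2 * c]. *)
exists (c ^+ 2 / 2 - c / 2), (2 * c ^+ 2 - c); split.
- apply: (eq_martingale _ (exp_martingale uF bW c)) => t t0.
  apply/funext => w; rewrite fE// -expRN -expRD; congr expR; by field.
- apply: (eq_martingale _ (exp_martingale uF bW (2 * c))) => t t0.
  apply/funext => w; rewrite fE// -expRN -expRM_natl -expRD; congr expR; by field.
- apply: (eq_martingale _ (exp_martingale uF bW (2 * c))) => t t0.
  apply/funext => w; rewrite fE ?mulr_ge0// -expRN -expRD; congr expR; by field.
Qed.

Lemma martingales_exp_form (l1 l2 : R) : continuous_positive f -> f 0 0 = 1 ->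
  martingale P (natural_filtration W) (fun t w => f t (W t w) / expR (l1 * t)) ->
  martingale P (natural_filtration W) (fun t w => f t (W t w) ^+ 2 / expR (l2 * t)) ->
  martingale P (natural_filtration W)
    (fun t w => f (4 * t) (2 * W t w + t) / expR (l2 * t)) -> exp_form.
Proof.
move=> cf f00 M1 M2 M3.
have fpos t x : 0 <= t -> 0 < f t x by move=> t0; case: cf => _; exact.
have cft t : 0 <= t -> continuous (f t) by exact: continuous_positive_section.
pose u t x := f t x / expR (l1 * t).
have cu t : 0 < t -> continuous (u t).
  move=> t0; apply: (@continuous_mulf _ (f t) (fun=> (expR (l1 * t))^-1)).
    exact/cft/ltW.
  by move=> x; exact: cst_continuous.
have u_gt0 t x : 0 < t -> 0 < u t x.
  by move=> t0; rewrite divr_gt0 ?expR_gt0// fpos// ltW.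
pose g2 t x := f t x ^+ 2 / expR (l2 * t).
have cg2 t : 0 < t -> continuous (g2 t).
  move=> t0; apply: (@continuous_mulf _ (fun x => f t x ^+ 2) (fun=> (expR (l2 * t))^-1)).
    by apply: continuous_mulf; exact/cft/ltW.
  by move=> x; exact: cst_continuous.
have u_ge0 t x : 0 <= t -> 0 <= u t x by move=> t0; rewrite divr_ge0 ?expR_ge0// ltW// fpos.
have g2_ge0 t x : 0 <= t -> 0 <= g2 t x by move=> t0; rewrite divr_ge0 ?expR_ge0// sqr_ge0.
have H1 s r x : 0 < s -> (\int[gam]_y (u (s + r ^+ 2) (x + r * y))%:E = (u s x)%:E)%E.
  by move=> s0; exact: (martingale_heat uF bW cu u_ge0 M1).
have G2 s r x : 0 < s -> (\int[gam]_y (g2 (s + r ^+ 2) (x + r * y))%:E = (g2 s x)%:E)%E.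
  by move=> s0; exact: (martingale_heat uF bW cg2 g2_ge0 M2).
(* In terms of [u], the second martingale is [u ^ 2 * exp (- k * t)]. *)
pose k := l2 - 2 * l1.
have uE t x : u t x ^+ 2 = expR (k * t) * g2 t x.
  rewrite /u /g2 exprMn exprVn -expRM_natl -!expRN [RHS]mulrCA -expRD.
  by congr (_ * expR _); rewrite /k; ring.
have H2 s r x : 0 < s -> (\int[gam]_y ((u (s + r ^+ 2) (x + r * y)) ^+ 2)%:E =
   (expR (k * r ^+ 2) * u s x ^+ 2)%:E)%E.
  move=> s0; under eq_integral do rewrite uE.
  have t0 : 0 < s + r ^+ 2 by rewrite ltr_wpDr// sqr_ge0.
  rewrite ge0_integralZ_EFin; last 3 first.
  - apply: continuous_measurable_fun.
    exact: (@continuous_compf _ _ (g2 _) (@continuous_affine _ x r) (cg2 _ t0)).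
  - by move=> y; rewrite g2_ge0// ltW.
  - exact: expR_ge0.
  by rewrite G2// uE mulrA -expRD -EFinM -mulrDr [r ^+ 2 + s]addrC.
have [A [b [bk uS]]] := heat_solution cu u_gt0 H1 H2.
have fS t x : 0 < t -> f t x = A * expR (b * x + (l1 - b ^+ 2 / 2) * t).
  move=> t0; have := uS t x t0; rewrite /u => /(congr1 (fun z => z * expR (l1 * t))).
  rewrite divfK ?gt_eqF ?expR_gt0// => ->; rewrite -mulrA -expRD.
  by congr (_ * expR _); ring.
(* At [x = 0] the formula tends to [A] as [t] decreases to 0, where [f] equals 1. *)
have A1 : A = 1.
  have h1 := continuous_positive_cvg0 cf (x := 0); rewrite f00 in h1.
  have h2 : (fun n : nat => A * expR ((l1 - b ^+ 2 / 2) * n.+1%:R^-1)) @ \oo --> A * expR ((l1 - b ^+ 2 / 2) * 0).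
    apply: cvgM; first exact: cvg_cst.
    apply: (@cvg_comp _ _ _ (fun n : nat => (l1 - b ^+ 2 / 2) * n.+1%:R^-1) expR _ (nbhs ((l1 - b ^+ 2 / 2) * 0))); last exact: continuous_expR.
    by apply: cvgM; [exact: cvg_cst|exact: cvg_harmonic].
  rewrite mulr0 expR0 mulr1 in h2.
  have h3 : (fun n : nat => f n.+1%:R^-1 0) = (fun n : nat => A * expR ((l1 - b ^+ 2 / 2) * n.+1%:R^-1)).
    by apply/funext => n; rewrite fS// mulr0 add0r.
  rewrite h3 in h1.
  exact: (cvg_unique _ h2 h1).
rewrite A1 in fS.
(* Equal means of the third martingale at times 0 and 1 give [l2 = b + 4 * l1]; combined with
   [b ^ 2 = l2 - 2 * l1] this determines [l1]. *)
have l1E : l1 = (b ^+ 2 - b) / 2.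
  have [_ i3 c3] := M3.
  have [_ _ e3] := c3 0 1 (lexx 0) ler01.
  have NT : natural_filtration W 0 setT.
    have [h1 h2 _] := natural_filtration_sigma W 0.
    by have := h2 _ h1; rewrite setD0.
  have := e3 _ NT.
  have m4 (t s : R) : 0 <= t -> measurable_fun setT (fun x : R => f t (2 * x + s) / expR (l2 * s)).
    move=> t0; apply: measurable_funM => //.
    apply: (@measurableT_comp _ _ _ _ _ _ (f t)).
      by apply: continuous_measurable_fun; exact: cft.
    by apply: measurable_funD => //; exact: measurable_funM.
  have -> : (\int[P]_w (f (4 * 0) (2 * W 0 w + 0) / expR (l2 * 0))%:E = 1)%E.
    rewrite (@ge0_ae_eq_integral _ _ _ P setT _ (cst 1%E))//.
    - by rewrite (integral_cst P)// [X in (_ * X)%E](probability_setT P) mul1e.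
    - apply/measurable_EFinP; rewrite mulr0.
      exact: (measurableT_comp (m4 0 0 (lexx 0)) (brownian_measurable uF bW (lexx 0))).
    - by move=> w _; rewrite lee_fin divr_ge0 ?expR_ge0// ltW// fpos// mulr0.
    have [N [mN N0 sN]] := brownian_start bW; exists N; split => //.
    apply: subset_trans sN => w /= h w0; apply: h => _.
    by rewrite w0 !mulr0 addr0 f00 expR0 divr1.
  rewrite (@brownian_marginal _ _ _ P F W uF bW 1 (fun x => (f (4 * 1) (2 * x + 1) / expR (l2 * 1))%:E)) => //; last 2 first.
  - by apply/measurable_EFinP; apply: m4; rewrite mulr1.
  - by move=> x; rewrite lee_fin divr_ge0 ?expR_ge0// ltW// fpos// mulr1.
  rewrite sqrtr1.
  have E x : f (4 * 1) (2 * x + 1) / expR (l2 * 1) =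
      expR (b + 4 * l1 - 2 * b ^+ 2 - l2) * expR (2 * b * x).
    rewrite fS ?mulr1// mul1r -expRN -!expRD; congr expR; by field.
  under eq_integral do rewrite E.
  rewrite ge0_integralZ_EFin; last 3 first.
  - by apply: measurableT_comp => //; exact: measurable_funM.
  - by move=> y; exact: expR_ge0.
  - exact: expR_ge0.
  rewrite integral_gauss_expR -EFinM -expRD => -[] /esym /(congr1 (@ln R)).
  rewrite expRK ln1 exprMn => e; move: bk; rewrite /k; lra.
have fS' t x : 0 < t -> f t x = expR (b * x + (- (b / 2)) * t).
  move=> t0; rewrite fS// mul1r l1E; congr expR; by field.
exists b => t x; rewrite le_eqVlt => /predU1P[<-|t0].
  by rewrite (continuous_positive_exp0 cf fS') mulr0 subr0.
by rewrite fS'// mulNr.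
Qed.

End assertions_cd.

(** * The functional equation for real arguments *)

Section functional_equation.
Context {R : realType}.

Lemma additive_bounded0 (h : R -> R) (M : R) : (forall x y, h (x + y) = h x + h y) ->
  (forall x, `|h x| <= M) -> forall x, h x = 0.
Proof.
move=> hD hM x; apply/eqP/negPn/negP => hx0.
have hn (n : nat) : h (x *+ n.+1) = h x *+ n.+1.
  by elim: n => [|n ih]; [rewrite !mulr1n|rewrite mulrS hD ih -mulrS].
have nhx : 0 < `|h x| by rewrite normr_gt0.
have := hM (x *+ (Num.truncn (M / `|h x|)).+1); apply/negP; rewrite -ltNge hn normrMn.
have := truncnS_gt (M / `|h x|); rewrite ltr_pdivrMr// => /lt_le_trans; apply.
by rewrite mulr_natl.
Qed.

(** After subtraction of [y * h 1], the function vanishes at the integers, hence is periodic, hence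
    bounded by its maximum on [[0, 1]]; a bounded additive function is zero. *)
Lemma continuous_additive (h : R -> R) : continuous h ->
  (forall x y, h (x + y) = h x + h y) -> forall x, h x = x * h 1.
Proof.
move=> ch hD x; pose k y := h y - y * h 1.
have kD y z : k (y + z) = k y + k z by rewrite /k hD; ring.
have k1 : k 1 = 0 by rewrite /k mul1r subrr.
have k0 : k 0 = 0 by have := kD 0 0; rewrite addr0; lra.
have kn (n : nat) : k n%:R = 0.
  by elim: n => [//|n ih]; rewrite -addn1 natrD kD ih k1 addr0.
have kN y : k (- y) = - k y by have := kD y (- y); rewrite subrr k0; lra.
have kz (z : int) : k z%:~R = 0.
  by case: z => n; [exact: kn|rewrite NegzE mulrNz kN -pmulrn kn oppr0].
have ck : continuous k.
  apply: continuous_subf => //; apply: continuous_mulf; [by move=> ?; exact: cvg_id|by move=> ?; exact: cst_continuous].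
have [M hM] : exists M, forall y, 0 <= y <= 1 -> `|k y| <= M.
  have ck1 : {within `[(0 : R), 1], continuous (fun y => `|k y|)}.
    apply: continuous_subspaceT => y; apply: cvg_norm; exact: ck.
  have [c _ hc] := EVT_max ler01 ck1.
  by exists (`|k c|) => y y01; apply: hc; rewrite in_itv.
have kb y : `|k y| <= M.
  have -> : k y = k (y - (Num.floor y)%:~R) by rewrite kD kN kz oppr0 addr0.
  apply: hM; rewrite subr_ge0 floor_le /=.
  have := floorD1_gt y; rewrite intrD; lra.
have := additive_bounded0 kD kb x; rewrite /k => /eqP; rewrite subr_eq0 => /eqP; exact.
Qed.

Lemma functional_equation_exp (f : R -> R -> R) : continuous_positive f ->
  (forall s r x y : R, 0 < s -> 0 < r -> f s x * f r y = f (s + r) (x + y)) ->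
  (forall s x : R, 0 < s -> f s x ^+ 2 = f (4 * s) (2 * x + s)) ->
  exists c : R, forall u v : R, 0 <= u -> f u v = expR (c * v - c / 2 * u).
Proof.
move=> cf fM fS.
have fpos t x : 0 <= t -> 0 < f t x by move=> t0; case: cf => _; exact.
pose g t x := ln (f t x).
have gM s r x y : 0 < s -> 0 < r -> g s x + g r y = g (s + r) (x + y).
  by move=> s0 r0; rewrite /g -fM// lnM// posrE fpos// ltW.
have gS s x : 0 < s -> 2 * g s x = g (4 * s) (2 * x + s).
  by move=> s0; rewrite /g -fS// lnXn ?mulr_natl// fpos// ltW.
pose b x := g 1 x - g 1 0.
have gb s x : 0 < s -> g s x = g s 0 + b x.
  move=> s0; have := gM s 1 x 0 s0 ltr01; have := gM s 1 0 x s0 ltr01.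
  by rewrite addr0 add0r /b; lra.
have bD x y : b (x + y) = b x + b y.
  have e1 := gM 1 1 x y ltr01 ltr01; have e2 := gM 1 1 0 (x + y) ltr01 ltr01.
  rewrite add0r -e1 in e2; rewrite /b; lra.
have cb : continuous b.
  apply: continuous_subf; last by move=> ?; exact: cst_continuous.
  move=> y; have h : continuous_at y (@ln R \o f 1).
    by apply: continuous_comp; [exact: (continuous_positive_section cf)|apply: continuous_ln; exact: fpos].
  exact: h.
have bL := continuous_additive cb bD.
pose c := b 1.
(* Additivity gives [g (4 s) 0 = 4 * g s 0], doubling gives [2 * g s 0 = g (4 s) 0 + c * s]. The
   time dependence follows without solving a Cauchy equation in [s]. *)
have gL s x : 0 < s -> g s x = c * x - c / 2 * s.
  move=> s0; have s2 : 0 < s + s by rewrite addr_gt0.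
  have e1 := gM s s 0 0 s0 s0; have e2 := gM (s + s) (s + s) 0 0 s2 s2; have e3 := gS s 0 s0.
  rewrite addr0 in e1 e2; rewrite mulr0 add0r (_ : 4 * s = s + s + (s + s)) in e3; last by ring.
  have e4 : g (s + s + (s + s)) s = g (s + s + (s + s)) 0 + b s by apply: gb; rewrite addr_gt0.
  rewrite gb// (bL x); rewrite (bL s) in e4; rewrite -/c in e4 *; lra.
have fL s x : 0 < s -> f s x = expR (c * x + (- (c / 2)) * s).
  by move=> s0; rewrite mulNr -gL// lnK// posrE fpos// ltW.
exists c => t x; rewrite le_eqVlt => /predU1P[<-|t0].
  by rewrite (continuous_positive_exp0 cf fL) mulr0 subr0.
by rewrite fL// mulNr.
Qed.

End functional_equation.

Lemma within_continuous_min (R : realType) (g : R -> R) (a : R) : 0 <= a ->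
  {within `[0, +oo[, continuous g} -> {within `[0, +oo[, continuous (fun t => g (Num.min t a))}.
Proof.
move=> a0 /subspace_continuousP cg; apply/subspace_continuousP => x x0.
have A0 t : t \in `[0, +oo[ -> Num.min t a \in `[0, +oo[.
  by rewrite !in_itv/= !andbT => t0; rewrite le_min t0.
have cmin : {for x, continuous (fun t : R => Num.min t a)}.
  by apply: (@continuous_min _ _ (fun t : R => t) (fun=> a)); [exact: cvg_id|exact: cst_continuous].
move=> V /(cg _ (A0 _ x0)) hV.
have {}hV : nbhs (Num.min x a) (fun y => `[0, +oo[%classic y -> V (g y)) by exact: hV.
have h := cmin _ hV.
change (nbhs x (fun t => `[0, +oo[%classic t -> V (g (Num.min t a)))).
by apply: (@filterS _ (nbhs x) _ _ _ _ h) => t /= {}h t0; apply: h; exact: A0.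
Qed.

Lemma within_continuous2 (R : realType) (op : R -> R -> R) (A : set R) (g h : R -> R) :
  (forall x y, (fun z => op z.1 z.2) @ (x, y) --> op x y) ->
  {within A, continuous g} -> {within A, continuous h} ->
  {within A, continuous (fun t => op (g t) (h t))}.
Proof.
move=> cop /subspace_continuousP cg /subspace_continuousP ch.
apply/subspace_continuousP => x Ax.
apply: (@cvg_comp _ _ _ (fun t => (g t, h t)) (fun z => op z.1 z.2) _ (nbhs (g x, h x))); last exact: cop.
by apply: (@cvg_pair _ _ _ _ (nbhs (g x)) (nbhs (h x))); [exact: cg|exact: ch].
Qed.

Lemma within_continuous_lin (R : realType) (a b : R) (A : set R) (g h : R -> R) :
  {within A, continuous g} -> {within A, continuous h} ->
  {within A, continuous (fun t => a * g t + b * h t)}.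
Proof.
apply: (within_continuous2 (op := fun x y => a * x + b * y)) => x y.
apply: cvgD; apply: cvgM; try exact: cvg_cst.
  exact: cvg_fst.
exact: cvg_snd.
Qed.

(** * Martingales as their own martingale parts, with deterministic brackets *)

Section martingale_parts.
Context d (T : measurableType d) (R : realType) (P : probability T R).
Context (F : R -> set (set T)).
Hypothesis uF : usual_filtration P F.
Implicit Types (X Y M : process R T) (t : R).

Let Fsig t : 0 <= t -> sigma_algebra setT (F t).
Proof. exact: (filtration_sigma uF). Qed.

Lemma filtration_set0 t : 0 <= t -> F t set0.
Proof. by move=> t0; have [] := Fsig t0. Qed.

Lemma filtration_setT t : 0 <= t -> F t setT.
Proof. by move=> t0; have [h0 hC _] := Fsig t0; rewrite -(setD0 setT); exact: hC. Qed.

Lemma measurable_wrt_cst t (c : R) : 0 <= t -> measurable_wrt (F t) (fun=> c : R).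
Proof.
move=> t0 B mB; rewrite preimage_cst; case: ifP => _.
  exact: filtration_setT.
exact: filtration_set0.
Qed.

Lemma martingale_local X : martingale P F X -> local_martingale P F X.
Proof.
move=> mX; exists (fun _ _ => +oo%E); split.
- move=> n; split=> [w|t t0]; first by rewrite leey.
  rewrite (_ : [set _ | _] = set0); first exact: filtration_set0.
  by apply/seteqP; split => w //=; rewrite leye_eq.
- by apply: aeW => w.
- by apply: aeW => w; exact: cvg_cst.
- move=> n; apply: eq_martingale mX => t t0; apply/funext => w.
  by rewrite /stopped min_l ?leey.
Qed.

Lemma continuous_fv0_deterministic (q : R -> R) : {within `[0, +oo[, continuous q} ->
  q 0 = 0 -> {in `[0, +oo[ &, nondecreasing_fun q} -> continuous_fv0 P F (fun t _ => q t).
Proof.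
move=> cq q0 iq; split.
- by move=> t t0; exact: measurable_wrt_cst.
- by apply: aeW => w.
- exact: aeW.
- apply: aeW => w t t0; apply: nondecreasing_bounded_variation => x y.
  rewrite !in_itv/= => /andP[x0 _] /andP[y0 _]; apply: iq; by rewrite in_itv/= andbT.
Qed.

Lemma continuous_fv0_0 : continuous_fv0 P F (fun _ _ => 0).
Proof.
apply: (continuous_fv0_deterministic (q := fun=> 0)) => //.
by apply: continuous_subspaceT => x; exact: cst_continuous.
Qed.

Lemma martingale_part_self M : martingale P F M -> continuous_paths P M -> starts_at0 P M ->
  martingale_part P F M M.
Proof.
move=> mM cM sM; split; first by split => //; exact: martingale_local.
rewrite (_ : (fun t w => _) = (fun _ _ => 0)); first exact: continuous_fv0_0.
by apply/funext => t; apply/funext => w; rewrite subrr.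
Qed.

Lemma characteristic_self M (q : R -> R) : martingale P F M -> continuous_paths P M ->
  starts_at0 P M -> {within `[0, +oo[, continuous q} ->
  q 0 = 0 -> {in `[0, +oo[ &, nondecreasing_fun q} ->
  martingale P F (fun t w => M t w ^+ 2 - q t) ->
  characteristic P F M (fun t _ => q t).
Proof.
move=> mM cM sM cq q0 iq mq; exists M; first exact: martingale_part_self.
have [aq cq' sq _] := continuous_fv0_deterministic cq q0 iq; split => //.
- exact: aeW.
- exact: martingale_local.
Qed.

End martingale_parts.

(** * Brownian increments as test processes for a) and b) *)

Section brownian_steps.
Context d (T : measurableType d) (R : realType) (P : probability T R).
Context (F : R -> set (set T)) (W : process R T).
Hypothesis uF : usual_filtration P F.
Hypothesis bW : brownian_motion P F W.
Implicit Types a b s t r : R.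
Local Notation step := (brownian_step W).

Lemma brownian_step_continuous a b : 0 <= a <= b -> continuous_paths P (step a b).
Proof.
move=> /andP[a0 ab]; have b0 := le_trans a0 ab.
apply: filterS (brownian_continuous bW) => w cW.
have ca := within_continuous_min a0 cW; have cb := within_continuous_min b0 cW.
rewrite (_ : (_ ^~ w) = (fun t => 1 * W (Num.min t b) w + (-1) * W (Num.min t a) w)).
  exact: within_continuous_lin.
by apply/funext => t; rewrite mul1r mulN1r.
Qed.

Lemma brownian_step_start a b : 0 <= a <= b -> starts_at0 P (step a b).
Proof.
move=> /andP[a0 ab]; apply: aeW => w.
by rewrite /brownian_step !min_l ?(le_trans a0)// subrr.
Qed.

Lemma step_clock_continuous a b : 0 <= a <= b -> {within `[0, +oo[, continuous (step_clock a b)}.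
Proof.
move=> /andP[a0 ab]; have b0 := le_trans a0 ab.
have cid : {within `[0, +oo[, continuous (fun t : R => t)}.
  by apply: continuous_subspaceT => x; exact: cvg_id.
have ca := within_continuous_min a0 cid; have cb := within_continuous_min b0 cid.
rewrite (_ : step_clock a b = (fun t => 1 * Num.min t b + (-1) * Num.min t a)).
  exact: within_continuous_lin.
by apply/funext => t; rewrite mul1r mulN1r.
Qed.

Lemma step_clock0 a b : 0 <= a <= b -> step_clock a b 0 = 0.
Proof.
by move=> /andP[a0 ab]; rewrite /step_clock !min_l ?(le_trans a0)// subrr.
Qed.

Lemma step_clock_nondecreasing a b : a <= b -> nondecreasing_fun (step_clock a b).
Proof.
move=> ab s t st; rewrite /step_clock /Num.min.
case: ifP => h1; case: ifP => h2; case: ifP => h3; case: ifP => h4; lra.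
Qed.

Lemma brownian_step_part a b : 0 <= a <= b -> martingale_part P F (step a b) (step a b).
Proof.
move=> ab; apply: martingale_part_self => //.
- exact: brownian_step_martingale.
- exact: brownian_step_continuous.
- exact: brownian_step_start.
Qed.

Lemma brownian_step_characteristic a b : 0 <= a <= b ->
  characteristic P F (step a b) (fun t _ => step_clock a b t).
Proof.
move=> ab; have /andP[_ ab'] := ab; apply: characteristic_self => //.
- exact: brownian_step_martingale.
- exact: brownian_step_continuous.
- exact: brownian_step_start.
- exact: step_clock_continuous.
- exact: step_clock0.
- by move=> s t _ _; exact: step_clock_nondecreasing.
- exact: brownian_step_sqr_martingale.
Qed.

Lemma brownian_step_double_characteristic a b : 0 <= a <= b ->
  characteristic P F (fun t w => step a b t w + step a b t w)
    (fun t _ => 4 * step_clock a b t).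
Proof.
move=> ab; have /andP[_ ab'] := ab.
have mM := brownian_step_martingale uF bW ab.
have mQ := brownian_step_sqr_martingale uF bW ab.
apply: (characteristic_self uF (q := fun t => 4 * step_clock a b t)) => //.
- apply: eq_martingale (martingale_lin (filtration_sigma uF) (filtration_measurable uF) 1 1 mM mM).
  by move=> t _; apply/funext => w; rewrite !mul1r.
- apply: filterS (brownian_step_continuous ab) => w c.
  rewrite (_ : (fun t => _) = (fun t => 1 * step a b t w + 1 * step a b t w)).
    exact: within_continuous_lin.
  by apply/funext => t; rewrite !mul1r.
- by apply: filterS (brownian_step_start ab) => w ->; rewrite addr0.
- have c := step_clock_continuous ab.
  rewrite (_ : (fun t => _) = (fun t => 4 * step_clock a b t + 0 * step_clock a b t)).
    exact: within_continuous_lin.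
  by apply/funext => t; rewrite mul0r addr0.
- by rewrite step_clock0// mulr0.
- by move=> s t _ _ st; rewrite ler_pM2l//; exact: step_clock_nondecreasing.
- apply: eq_martingale (martingale_lin (filtration_sigma uF) (filtration_measurable uF) 4 0 mQ mQ).
  by move=> t _; apply/funext => w; ring.
Qed.

Lemma brownian_step_mutual a b : 0 <= a <= b ->
  mutual_characteristic P F (step a b) (step a b) (fun t _ => step_clock a b t).
Proof.
move=> ab; have /andP[_ ab'] := ab; exists (step a b), (step a b); split.
- exact: brownian_step_part.
- exact: brownian_step_part.
- apply: continuous_fv0_deterministic => //.
  + exact: step_clock_continuous.
  + exact: step_clock0.
  + by move=> s t _ _; exact: step_clock_nondecreasing.
- exact/martingale_local/brownian_step_sqr_martingale.
Qed.

Lemma brownian_stepD a b c : (fun t w => step a b t w + step b c t w) = step a c.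
Proof.
by apply/funext => t; apply/funext => w; rewrite /brownian_step; ring.
Qed.

(** Polarization: the product is half of the square of the sum minus the two squares; the sum of the
    two steps is again a step, and the clocks add up. *)
Lemma brownian_step_orthogonal a b c : 0 <= a <= b -> b <= c ->
  mutual_characteristic P F (step a b) (step b c) (fun _ _ => 0).
Proof.
move=> ab bc; have /andP[a0 ab'] := ab; have b0 := le_trans a0 ab'.
have bc2 : 0 <= b <= c by rewrite b0.
have ac2 : 0 <= a <= c by rewrite a0 (le_trans ab').
exists (step a b), (step b c); split.
- exact: brownian_step_part.
- exact: brownian_step_part.
- exact: continuous_fv0_0.
apply: martingale_local => //.
have lin := martingale_lin (filtration_sigma uF) (filtration_measurable uF).
have h1 := brownian_step_sqr_martingale uF bW ab.
have h2 := brownian_step_sqr_martingale uF bW bc2.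
have h3 := brownian_step_sqr_martingale uF bW ac2.
apply: eq_martingale (lin P (1 / 2) (- (1 / 2)) _ _ h3 (lin P 1 1 _ _ h1 h2)).
move=> t _; apply/funext => w; rewrite -(brownian_stepD a b c) /step_clock; by field.
Qed.

Lemma brownian_step_semimartingale a b : 0 <= a <= b -> semimartingale0 P F (step a b).
Proof. by move=> ab; exists (step a b); exact: brownian_step_part. Qed.

(** The indicators of [[a, b]] and []a, b]] differ only at [a], so a constant sequence of step
    integrands already converges. *)
Lemma brownian_step_indicator_integral a b : 0 <= a <= b -> indicator_integrals P F W (step a b).
Proof.
move=> ab; exists a, b; split => //; split.
- by have [] := brownian_step_martingale uF bW ab.
- exact: brownian_step_continuous.
move=> t t0; exists (fun=> [:: (1, a, b)]); split.
- by move=> _ c a' b'; rewrite inE => /eqP[_ -> ->].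
- rewrite (_ : (fun _ => _) = cst 0%E); first exact: cvg_cst.
  apply/funext => n; rewrite (_ : (fun u => _) = (fun u => (\1_([set a] : set R) u)%:E)).
    rewrite integral_indic//.
    apply/eqP; rewrite eq_le measure_ge0 andbT -(lebesgue_measure_set1 a).
    by apply: le_measure; rewrite ?inE//; exact: measurableI.
  apply/funext => u; rewrite /step_fun big_seq1/= mul1r !indicE; congr EFin.
  have [/andP[_ ab']] := ab.
  have -> : (u \in [set a]) = (u == a) by apply/idP/eqP; rewrite inE.
  rewrite !mem_setE !in_itv/=.
  have [->|ua] := eqVneq u a; first by rewrite ltxx lexx ab'/= sub0r sqrrN expr1n.
  by rewrite lt_neqAle eq_sym ua/= subrr expr0n.
- rewrite (_ : (fun _ => _) = cst 0%E); first exact: cvg_cst.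
  apply/funext => n; apply: integral0_eq => w _.
  by rewrite /step_integral big_seq1/= mul1r subrr expr0n.
Qed.

(** Two independent increments with positive densities charge every product of balls, in particular
    one on which [h] would be nonzero. *)
Lemma brownian_increments_full_support s r (h : R * R -> R) : 0 < s -> 0 < r -> continuous h ->
  {ae P, forall w, h (W s w - W 0 w, W (s + r) w - W s w) = 0} -> forall z, h z = 0.
Proof.
move=> s0 r0 ch [N [mN N0 sN]] [x y]; apply/eqP/negPn/negP => hz.
have nz : 0 < `|h (x, y)| by rewrite normr_gt0.
have /cvgrPdist_lt /(_ _ nz) := ch (x, y).
move=> /nbhs_ballP[e /= e0 he].
have sr : s < s + r by rewrite ltrDl.
pose A := (fun w => W s w - W 0 w) @^-1` (ball x e).
pose B := (fun w => W (s + r) w - W s w) @^-1` (ball y e).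
have FA : F s A.
  have m : measurable_wrt (F s) (fun w => W s w - W 0 w).
    have i0 : (0 : R) <= 0 <= s by rewrite lexx ltW.
    have [ad _ _] := brownian_step_martingale uF bW i0.
    rewrite (_ : (fun w => _) = step 0 s s); first exact: (ad s (ltW s0)).
    by apply/funext => w; rewrite /brownian_step minxx min_r// ltW.
  by apply: m; rewrite ball_itv; exact: measurable_itv.
have mA : measurable A by apply: (filtration_measurable uF (ltW s0)).
have PAB : (0 < P (A `&` B))%E.
  rewrite (brownian_independent bW (ltW s0) sr FA); last first.
    by rewrite ball_itv; exact: measurable_itv.
  rewrite mule_gt0//.
    rewrite (brownian_normal bW (lexx 0) s0); last by rewrite ball_itv; exact: measurable_itv.
    rewrite ball_itv; apply: normal_prob_itv_gt0.
      by rewrite subr0 sqrtr_eq0 -ltNge.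
    by lra.
  rewrite (brownian_normal bW (ltW s0) sr); last by rewrite ball_itv; exact: measurable_itv.
  rewrite ball_itv; apply: normal_prob_itv_gt0.
    by rewrite sqrtr_eq0 -ltNge addrAC subrr add0r.
  by lra.
have mB : measurable B.
  rewrite /B -[_ @^-1` _]setTI; apply: measurable_funB => //; last first.
  - by rewrite ball_itv; exact: measurable_itv.
  - exact: (brownian_measurable uF bW (ltW s0)).
  - by apply: (brownian_measurable uF bW); rewrite addr_ge0// ltW.
move: PAB; apply/negP; rewrite -leNgt -N0; apply: le_measure; rewrite ?inE//.
  exact: measurableI.
move=> w [Aw Bw]; apply: sN => /= h0.
have := he (W s w - W 0 w, W (s + r) w - W s w) (conj Aw Bw).
by rewrite h0 subr0 ltxx.
Qed.

(** Only steps are required of [V], so a) and b) are treated together. At the right end of the steps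
    all brackets are numbers, and full support turns the almost sure equation into one for all
    reals. *)
Lemma solves_on_exp_form (V : process R T -> Prop) (f : R -> R -> R) :
  (forall a b, 0 <= a <= b -> V (step a b)) ->
  continuous_positive f -> solves_on P F V f ->
  exists c : R, forall u v : R, 0 <= u -> f u v = expR (c * v - c / 2 * u).
Proof.
move=> VS cf sf; have cs t := continuous_positive_section cf (t := t).
have step0 s t w : 0 <= s -> s <= t -> step 0 s t w = W s w - W 0 w.
  by move=> s0 st; rewrite /brownian_step min_r// min_r// (le_trans s0).
have clock0 s t : 0 <= s -> s <= t -> step_clock 0 s t = s.
  by move=> s0 st; rewrite /step_clock min_r// min_r ?subr0// (le_trans s0).
apply: functional_equation_exp => //.
- move=> s r x y s0 r0.
  have s0' := ltW s0; have sr : s <= s + r by rewrite lerDl ltW.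
  have sr0 : 0 <= s + r by rewrite addr_ge0// ltW.
  have i1 : (0 : R) <= 0 <= s by rewrite lexx.
  have i2 : 0 <= s <= s + r by rewrite s0'.
  have i3 : (0 : R) <= 0 <= s + r by rewrite lexx.
  (* The sum of adjacent steps is a step, so its bracket is known as well. *)
  have c3 := brownian_step_characteristic i3; rewrite -(brownian_stepD 0 s (s + r)) in c3.
  have := sf _ _ (VS _ _ i1) (VS _ _ i2) _ _ _ _ (brownian_step_characteristic i1)
    (brownian_step_characteristic i2) c3 (brownian_step_orthogonal i1 sr) _ sr0.
  rewrite !clock0// => H.
  pose h (z : R * R) := f s z.1 * f r z.2 - f (s + r) (z.1 + z.2).
  have ch : continuous h.
    move=> z; apply: cvgB.
      apply: cvgM.
        by apply: (@cvg_comp _ _ _ fst (f s)); [exact: cvg_fst|exact: cs].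
      by apply: (@cvg_comp _ _ _ snd (f r)); [exact: cvg_snd|apply: cs; exact: ltW].
    apply: (@cvg_comp _ _ _ (fun z : R * R => z.1 + z.2) (f (s + r))); last exact: cs.
    by apply: cvgD; [exact: cvg_fst|exact: cvg_snd].
  apply/eqP; rewrite -subr_eq0; apply/eqP.
  apply: (brownian_increments_full_support s0 r0 ch _ (x, y)).
  apply: filterS H => w; rewrite step0// addr0 /h/=.
  rewrite (_ : step s (s + r) (s + r) w = W (s + r) w - W s w); last first.
    by rewrite /brownian_step minxx min_r.
  rewrite (_ : step_clock s (s + r) (s + r) = r) => [->|]; first by rewrite subrr.
  by rewrite /step_clock minxx min_r// addrAC subrr add0r.
- move=> s x s0; have s0' := ltW s0.
  have i1 : (0 : R) <= 0 <= s by rewrite lexx.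
  have := sf _ _ (VS _ _ i1) (VS _ _ i1) _ _ _ _ (brownian_step_characteristic i1)
    (brownian_step_characteristic i1) (brownian_step_double_characteristic i1)
    (brownian_step_mutual i1) _ s0'.
  rewrite !clock0// => H.
  pose h (z : R * R) := f s z.1 ^+ 2 - f (4 * s) (2 * z.1 + s).
  have ch : continuous h.
    have ch1 : continuous (fun x => f s x * f s x - f (4 * s) (2 * x + s)).
      apply: continuous_subf.
        by apply: continuous_mulf; exact: cs.
      apply: (@continuous_compf _ (fun x => 2 * x + s) (f (4 * s))).
        move=> z; apply: cvgD; last exact: cvg_cst.
        by apply: cvgM; [exact: cvg_cst|exact: cvg_id].
      by apply: cs; rewrite mulr_ge0.
    by move=> z; apply: (@cvg_comp _ _ _ fst (fun x => f s x * f s x - f (4 * s) (2 * x + s))); [exact: cvg_fst|exact: ch1].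
  apply/eqP; rewrite -subr_eq0; apply/eqP.
  (* Only one increment occurs here; the second coordinate is a dummy increment of length 1. *)
  apply: (brownian_increments_full_support s0 ltr01 ch _ (x, 0)).
  apply: filterS H => w; rewrite step0// /h/= -expr2 => ->.
  by rewrite [2 * _]mulr_natl mulr2n subrr.
Qed.

End brownian_steps.

(** * Continuous martingales of bounded variation *)

Section pathwise_bound.
Context {R : realType}.
Implicit Types (x h K dl : R) (u : nat -> R) (i n : nat).

(* A smooth version of the absolute value, with derivative [dsoftabs]. *)
Definition softabs x : R := Num.sqrt (1 + x ^+ 2) - 1.
Definition dsoftabs x : R := x / Num.sqrt (1 + x ^+ 2).

Lemma sqrt1D_ge1 x : 1 <= Num.sqrt (1 + x ^+ 2).
Proof. by rewrite -[X in X <= _]sqrtr1 ler_sqrt ?ler_wpDr ?sqr_ge0// addr_ge0 ?sqr_ge0. Qed.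

Lemma softabs_ge0 x : 0 <= softabs x.
Proof. by rewrite subr_ge0 sqrt1D_ge1. Qed.

Lemma softabs_le x : softabs x <= `|x|.
Proof.
rewrite /softabs lerBlDr -[leRHS]ger0_norm ?addr_ge0// -sqrtr_sqr ler_sqrt ?sqr_ge0//.
by rewrite sqrrD1 real_normK ?num_real// addrAC [leRHS]addrC -subr_ge0; have := normr_ge0 x; lra.
Qed.

Lemma softabs_eq0 x : softabs x = 0 -> x = 0.
Proof.
move=> /eqP; rewrite subr_eq0 => /eqP/(congr1 (fun z => z ^+ 2)).
rewrite sqr_sqrtr ?addr_ge0 ?sqr_ge0// expr1n => e.
by apply/eqP; rewrite -sqrf_eq0; apply/eqP; lra.
Qed.

Lemma dsoftabs_le1 x : `|dsoftabs x| <= 1.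
Proof.
have s1 := sqrt1D_ge1 x; have s0 : 0 < Num.sqrt (1 + x ^+ 2) by lra.
rewrite normrM normfV (gtr0_norm s0) ler_pdivrMr// mul1r -sqrtr_sqr.
by rewrite ler_sqrt ?lerDr// addr_ge0 ?sqr_ge0.
Qed.

(** The second derivative is at most 1. Concretely, [p * q <= (p^2 + q^2) / 2] for the two square
    roots, and [p >= 1]. *)
Lemma softabsD_le x h : softabs (x + h) <= softabs x + dsoftabs x * h + h ^+ 2 / 2.
Proof.
rewrite /softabs /dsoftabs; set p := Num.sqrt (1 + x ^+ 2); set q := Num.sqrt _.
have p1 : 1 <= p := sqrt1D_ge1 x; have p0 : 0 < p by lra.
have pp : p ^+ 2 = 1 + x ^+ 2 by rewrite sqr_sqrtr// addr_ge0 ?sqr_ge0.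
have qq : q ^+ 2 = 1 + (x + h) ^+ 2 by rewrite sqr_sqrtr// addr_ge0 ?sqr_ge0.
suff : q <= p + x / p * h + h ^+ 2 / 2 by lra.
rewrite -(ler_pM2r p0) !mulrDl mulrAC divfK ?gt_eqF//.
have h1 : h ^+ 2 / 2 <= h ^+ 2 / 2 * p by rewrite ler_peMr// divr_ge0 ?sqr_ge0.
have := sqr_ge0 (q - p); nra.
Qed.

Definition increment_sum u n : R := \sum_(j < n) `|u j.+1 - u j|.

(** The times before a discrete stopping time. The recursion makes it visible that only the values
    up to [n] enter, which gives measurability by induction. *)
Fixpoint good u K dl n : bool := match n with
  | 0 => u 0%N == 0
  | n'.+1 => [&& good u K dl n', `|u n'.+1 - u n'| <= dl & increment_sum u n'.+1 <= K]
  end.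

Fixpoint jump u dl n : bool :=
  if n is n'.+1 then jump u dl n' || (dl < `|u n'.+1 - u n'|) else false.

Lemma jumpP u dl n : reflect (exists2 i, (i < n)%N & dl < `|u i.+1 - u i|) (jump u dl n).
Proof.
elim: n => [|n ih] /=; first by apply: (iffP idP) => // -[].
apply: (iffP orP) => [[/ih[i ni ai]|an]|[i]].
- by exists i => //; rewrite ltnW.
- by exists n.
- rewrite ltnS leq_eqVlt => /predU1P[->|ni] ai; first by right.
  by left; apply/ih; exists i.
Qed.

(** Exit from the good region through a large increment. Exit through the bound [K] needs no mark,
    as it overshoots by at most [dl]. *)
Definition bad u K dl n : bool := good u K dl n && (dl < `|u n.+1 - u n|).

Variables (u : nat -> R) (K dl : R).
Hypotheses (K0 : 0 <= K) (dl0 : 0 <= dl).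
Local Notation a i := (u i.+1 - u i).
Local Notation gd := (good u K dl).
Local Notation bd := (bad u K dl).
Local Notation va := (increment_sum u).
Local Notation jp := (jump u dl).

Lemma variS n : va n.+1 = va n + `|a n|.
Proof. by rewrite /increment_sum big_ord_recr. Qed.

Lemma vari_le i n : (i <= n)%N -> va i <= va n.
Proof.
elim: n => [|n ih]; first by rewrite leqn0 => /eqP->.
rewrite leq_eqVlt => /predU1P[->//|/ih h]; apply: (le_trans h).
by rewrite variS lerDl.
Qed.

Lemma good_start n : gd n -> u 0%N = 0.
Proof. by elim: n => [/eqP//|n ih /= /and3P[/ih]]. Qed.

Lemma good_vari n : gd n -> va n <= K.
Proof. by case: n => [_|n /= /and3P[]//]; rewrite /increment_sum big_ord0. Qed.

Lemma abs_vari n : `|u n| <= `|u 0%N| + va n.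
Proof.
elim: n => [|n ih]; first by rewrite /increment_sum big_ord0 addr0.
rewrite variS addrA; apply: le_trans (lerD ih (lexx _)).
by rewrite (le_trans _ (ler_normD _ _))// addrC subrK.
Qed.

Lemma good_abs n : gd n -> `|u n| <= K.
Proof.
move=> gn; apply: (le_trans (abs_vari n)); rewrite (good_start gn) normr0 add0r.
exact: good_vari.
Qed.

(** Taylor expansion summed while the path is good. At a bad step the left side drops to 0 and the
    term in [|a i|] absorbs the first order term, since the derivative is at most 1 in absolute
    value. *)
Lemma softabs_good n : (gd n)%:R * softabs (u n) <=
  \sum_(i < n) ((gd i)%:R * dsoftabs (u i) * a i + (bd i)%:R * `|a i| +
                (gd i && (`|a i| <= dl))%:R * (a i) ^+ 2 / 2).
Proof.
elim: n => [|n ih].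
  rewrite big_ord0 /=; case: eqP => [->|_]; last by rewrite mul0r.
  by rewrite mul1r /softabs expr0n/= addr0 sqrtr1 subrr.
rewrite big_ord_recr/=; apply: le_trans (lerD ih (lexx _)).
rewrite /bad; case: (gd n) => /=; last by rewrite !mul0r !addr0.
have := softabsD_le (u n) (a n); rewrite [u n + _]addrC subrK !mul1r.
have h0 := softabs_ge0 (u n); have hS := softabs_ge0 (u n.+1).
have [adl|adl] := leP (`|a n|) dl; rewrite /= !mul0r ?mul1r ?addr0.
  by case: (_ <= K); rewrite ?mul1r ?mul0r; lra.
have : `|dsoftabs (u n) * a n| <= `|a n|.
  by rewrite normrM ler_piMl// dsoftabs_le1.
by rewrite ler_norml => /andP[]; lra.
Qed.

(** Each square counted is at most [dl] times the absolute increment. The bound is [K + dl] and not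
    [K] because the step that crosses [K] is still counted; the second part is what the induction
    needs. *)
Lemma sqr_good n :
  \sum_(i < n) (gd i && (`|a i| <= dl))%:R * (a i) ^+ 2 <= dl * (K + dl) /\
  (gd n -> \sum_(i < n) (gd i && (`|a i| <= dl))%:R * (a i) ^+ 2 <= dl * va n).
Proof.
elim: n => [|n [ih1 ih2]].
  by rewrite big_ord0 /increment_sum big_ord0 mulr0; split => //; rewrite mulr_ge0// addr_ge0.
rewrite big_ord_recr/=.
have [gn|gn] := boolP (gd n); last by rewrite /= mul0r addr0.
have {}ih2 := ih2 gn; have Vn := good_vari gn.
have [adl|adl] := leP (`|a n|) dl; last by rewrite /= mul0r addr0.
have aa : (a n) ^+ 2 <= dl * `|a n|.
  by rewrite -real_normK ?num_real// expr2 ler_wpM2r.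
have dV : dl * va n <= dl * K by rewrite ler_wpM2l.
have da : dl * `|a n| <= dl * dl by rewrite ler_wpM2l.
rewrite /= mul1r variS !mulrDr; split=> [|_]; lra.
Qed.

(** The good region is left at most once, so bad steps exclude one another and exclude [good n]. *)
Lemma bad_sum n : \sum_(i < n) (bd i)%:R + (gd n)%:R <= 1 :> R.
Proof.
elim: n => [|n ih]; first by rewrite big_ord0 add0r lern1 leq_b1.
rewrite big_ord_recr/=; apply: le_trans ih; rewrite -addrA lerD2l.
rewrite /bad; case: (gd n) => //=; last by rewrite addr0.
by have [_|_] := leP (`|a n|) dl; rewrite /= ?addr0// add0r; case: (_ <= K).
Qed.

Lemma bad_sum_jump n : \sum_(i < n) (bd i)%:R <= (jp n)%:R :> R.
Proof.
case: jumpP => [_|h].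
  by apply: le_trans (bad_sum n); rewrite lerDl.
rewrite big1// => i _; rewrite /bad; case: ltP => [adl|]; last by rewrite andbF.
by exfalso; apply: h; exists (i : nat).
Qed.

(* The sum has mean zero as soon as [u] is a martingale. The increments that leave the good region
   are compared with the terminal value, which keeps the error term integrable uniformly in [N]. *)
Lemma pathwise_bound (c : bool) N : (c -> u 0%N = 0 /\ va N <= K) ->
  c%:R * softabs (u N) <=
    \sum_(i < N) ((gd i)%:R * dsoftabs (u i) * a i -
                  (bd i)%:R * Num.sg (u i.+1) * (u N - u i.+1)) +
    (jp N)%:R * (2 * `|u N| + K) + dl * (K + dl) / 2.
Proof.
move=> cP.
(* Under [c], a path without large increment is good up to [N]; otherwise the linear growth of
   [softabs] is used. *)
have h1 : c%:R * softabs (u N) <= (gd N)%:R * softabs (u N) + (jp N)%:R * `|u N|.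
  have hN := softabs_ge0 (u N); have aN := normr_ge0 (u N); have hl := softabs_le (u N).
  case: c cP => [/(_ isT)[u0 VK]|_]; last first.
    by rewrite mul0r; case: (gd N) (jp N) => [] []; rewrite ?mul1r ?mul0r ?addr0 ?add0r//; lra.
  have [_|jN] := jumpP u dl N.
    by rewrite !mul1r; case: (gd N); rewrite ?mul1r ?mul0r; lra.
  have -> : gd N; last by rewrite !mul1r mul0r addr0.
  have : (N <= N)%N by [].
  elim: {-2}N => [_|n ih nN] /=; first by rewrite u0.
  rewrite ih ?(ltnW nN)//= (le_trans (vari_le nN) VK) andbT leNgt.
  by apply/negP => an; apply: jN; exists n.
(* Here [|a i| <= |u i.+1| + K], and [|u i.+1|] is [Num.sg (u i.+1) * u N] minus a martingale
   increment after time [i.+1]. *)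
have h2 (i : 'I_N) : (bd i)%:R * `|a i| <=
    - ((bd i)%:R * Num.sg (u i.+1) * (u N - u i.+1)) + (bd i)%:R * (`|u N| + K).
  have [bi|_] := boolP (bd i); last by rewrite !mul0r oppr0 addr0.
  have {bi}/andP[gi _] := bi; rewrite !mul1r mulrBr -normrEsg.
  have ui := good_abs gi.
  have : `|a i| <= `|u i.+1| + `|u i| by exact: ler_normB.
  have : `|Num.sg (u i.+1) * u N| <= `|u N|.
    by rewrite normrM ler_piMl// normr_sg; case: (_ != 0).
  by rewrite ler_norml => /andP[]; lra.
have [h3 _] := sqr_good N; have h4 := bad_sum_jump N; have h5 := softabs_good N.
have h6 : \sum_(i < N) (bd i)%:R * (`|u N| + K) <= (jp N)%:R * (`|u N| + K).
  by rewrite -mulr_suml ler_wpM2r// addr_ge0.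
have h7 : \sum_(i < N) (bd i)%:R * `|a i| <= \sum_(i < N)
    (- ((bd i)%:R * Num.sg (u i.+1) * (u N - u i.+1)) + (bd i)%:R * (`|u N| + K)).
  by apply: ler_sum => i _; exact: h2.
move: h5 h7; rewrite !big_split/= -mulr_suml => h5 h7.
rewrite (_ : _ * (2 * `|u N| + K) = (jp N)%:R * `|u N| + (jp N)%:R * (`|u N| + K)); last by ring.
have lin (g j p q A B S D E G : R) : E <= g + j -> g <= A + p + S / 2 -> p <= q + B -> B <= G ->
    S <= D -> E <= A + q + (j + G) + D / 2 by lra.
exact: lin h1 h5 h7 h6 h3.
Qed.

End pathwise_bound.


(** * Orthogonality of increments to bounded variables known beforehand *)

Section mean_zero.
Context d (T : measurableType d) (R : realType) (P : probability T R).
Implicit Types (h k xi D : T -> R).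

Definition mean0 h : Prop := P.-integrable setT (EFin \o h) /\ (\int[P]_w (h w)%:E = 0)%E.

Lemma mean0_lin (a b : R) h k : mean0 h -> mean0 k -> mean0 (fun w => a * h w + b * k w).
Proof.
move=> [ih h0] [ik k0].
have iah : P.-integrable setT (fun w => (a%:E * (h w)%:E)%E) by exact: integrableZl ih.
have ibk : P.-integrable setT (fun w => (b%:E * (k w)%:E)%E) by exact: integrableZl ik.
split; first exact: integrableD iah ibk.
under eq_integral do rewrite EFinD !EFinM.
by rewrite (integralD measurableT iah ibk) (integralZl measurableT ih) (integralZl measurableT ik) h0 k0 !mule0 adde0.
Qed.

Lemma mean0_0 : mean0 (fun=> 0).
Proof. by split; [exact: integrable0|rewrite integral0]. Qed.

Lemma mean0_sum n (h : nat -> T -> R) : (forall i, (i < n)%N -> mean0 (h i)) ->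
  mean0 (fun w => \sum_(i < n) h i w).
Proof.
elim: n => [_|n ih H].
  by under eq_fun do rewrite big_ord0; exact: mean0_0.
have h1 : mean0 (fun w => \sum_(i < n) h i w) by apply: ih => i ni; apply: H; rewrite ltnW.
have h2 := H n (ltnSn n).
have := mean0_lin 1 1 h1 h2; rewrite (_ : (fun w => 1 * _ + _) = (fun w => \sum_(i < n.+1) h i w))//.
by apply/funext => w; rewrite big_ord_recr/= !mul1r.
Qed.

Lemma integrable_mul_le1 xi D : measurable_fun setT xi -> (forall w, `|xi w| <= 1) ->
  P.-integrable setT (EFin \o D) -> P.-integrable setT (EFin \o (fun w => xi w * D w)).
Proof.
move=> mxi xi1 iD; have mD : measurable_fun setT D.
  by apply/measurable_EFinP; exact: measurable_int iD.
apply: (le_integrable measurableT _ _ iD) => [|w _].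
  by apply/measurable_EFinP; exact: measurable_funM.
by rewrite /= lee_fin normrM ler_piMl.
Qed.

Lemma mean0_le h1 h2 z : P.-integrable setT (EFin \o h1) -> P.-integrable setT (EFin \o h2) ->
  mean0 z -> (forall w, h1 w <= z w + h2 w) ->
  (\int[P]_w (h1 w)%:E <= \int[P]_w (h2 w)%:E)%E.
Proof.
move=> i1 i2 [iz z0] le; rewrite -[leRHS]add0e -z0 -(integralD measurableT iz i2).
apply: (le_integral measurableT i1); first exact: integrableD iz i2.
by move=> w _; rewrite /= -EFinD lee_fin.
Qed.

(** The sum is the minimum of [m] and the integer part of [y]: the staircase behind the
    approximation in [mean0_mul]. *)
Lemma count_sum (m : nat) (y : R) : 0 <= y ->
  (m%:R <= y -> \sum_(k < m) (k.+1%:R <= y)%R%:R = m%:R :> R) /\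
  (y < m%:R -> y - 1 <= \sum_(k < m) (k.+1%:R <= y)%R%:R <= y).
Proof.
move=> y0; elim: m => [|m [ih1 ih2]].
  by rewrite big_ord0; split => //; rewrite ltNge y0.
rewrite big_ord_recr/=; split=> [my|].
  by rewrite my ih1 ?natr1// (le_trans _ my)// ler_nat.
rewrite ltNge => my; rewrite (negbTE my) addr0.
have [ym|ym] := ltP y m%:R; first exact: ih2.
by rewrite ih1//; move: my; rewrite -ltNge -natr1; lra.
Qed.

Lemma mean0_mul (G : set (set T)) xi D : sigma_algebra setT G -> G `<=` measurable ->
  measurable_wrt G xi -> (forall w, `|xi w| <= 1) -> P.-integrable setT (EFin \o D) ->
  (forall A, G A -> \int[P]_(w in A) (D w)%:E = 0)%E -> mean0 (fun w => xi w * D w).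
Proof.
move=> sG Gm mxi xi1 iD D0.
have Dind A : G A -> mean0 (fun w => \1_A w * D w).
  move=> GA; split.
    apply: integrable_mul_le1 => // [|w]; first exact: measurable_indic (Gm _ GA).
    by rewrite indicE ger0_norm ?ler0n// lern1 leq_b1.
  rewrite -(D0 _ GA) [RHS]integral_mkcond epatch_indic.
  by apply: eq_integral => w _; rewrite /= -EFinM mulrC.
have GT : G setT by have [h0 hC _] := sG; rewrite -(setD0 setT); exact: hC.
have unit zeta : measurable_wrt G zeta -> (forall w, 0 <= zeta w <= 1) ->
    mean0 (fun w => zeta w * D w).
  move=> mz z01; have mz' := measurable_wrt_fun Gm mz.
  have iz : P.-integrable setT (EFin \o (fun w => zeta w * D w)).
    by apply: integrable_mul_le1 => // w; have /andP[z0 z1] := z01 w; rewrite ger0_norm.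
  split => //.
  have iaD : P.-integrable setT (fun w => `|D w|%:E) by exact: integrable_abse iD.
  have fz : (\int[P]_w (zeta w * D w)%:E \is a fin_num)%E by exact: integrable_fin_num iz.
  have fD : (\int[P]_w `|D w|%:E \is a fin_num)%E by exact: integrable_fin_num iaD.
  set e := fine (\int[P]_w (zeta w * D w)%:E); set I := fine (\int[P]_w `|D w|%:E).
  (* [zeta] is uniformly approximated by a staircase [S] whose level sets lie in [G]; [S * D] has
     mean zero, and the error costs at most the mesh times the mean of [|D|]. *)
  have bnd (m : nat) : `|e| <= m.+1%:R^-1 * I.
    pose S w : R := \sum_(k < m.+1) m.+1%:R^-1 * (k.+1%:R <= m.+1%:R * zeta w)%R%:R.
    pose A (k : nat) := [set w | k.+1%:R <= m.+1%:R * zeta w].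
    pose hk (k : nat) w : R := m.+1%:R^-1 * (\1_(A k) w * D w) + 0 * 0.
    have mS : mean0 (fun w => \sum_(k < m.+1) hk k w).
      apply: mean0_sum => k _; apply: (@mean0_lin _ 0 _ (fun=> 0)); last exact: mean0_0.
      apply: Dind.
      have -> : A k = zeta @^-1` `[m.+1%:R^-1 * k.+1%:R, +oo[.
        by apply/seteqP; split => w /=; rewrite in_itv/= andbT ler_pdivrMl.
      by apply: mz; exact: measurable_itv.
    have eS : (fun w => \sum_(k < m.+1) hk k w) = (fun w => S w * D w).
      apply/funext => w; rewrite /S mulr_suml; apply: eq_bigr => k _.
      by rewrite /hk mul0r addr0 mulrA indicE mem_setE.
    rewrite {}eS in mS.
    have SE w : `|zeta w - S w| <= m.+1%:R^-1.
      have /andP[z0 z1] := z01 w; have m0 : 0 < m.+1%:R :> R by [].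
      rewrite /S -mulr_sumr.
      have [h1 h2] := count_sum m.+1 (mulr_ge0 (ltW m0) z0).
      rewrite -(ler_pM2l m0) mulfV ?gt_eqF// -{1}(gtr0_norm m0) -normrM mulrBr mulVKf ?gt_eqF//.
      have [mz1|/h2 /andP[]] := leP m.+1%:R (m.+1%:R * zeta w).
        rewrite (h1 mz1); have : m.+1%:R * zeta w <= m.+1%:R by rewrite ler_piMr// ltW.
        by move: mz1; rewrite ler_norml; lra.
      by rewrite ler_norml; lra.
    have h1 : (\int[P]_w (zeta w * D w)%:E <= \int[P]_w (m.+1%:R^-1 * `|D w|)%:E)%E.
      apply: mean0_le iz _ mS _; first exact: integrableZl iaD.
      move=> w; rewrite addrC -lerBlDr -mulrBl (le_trans (ler_norm _))// normrM.
      by rewrite ler_wpM2r.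
    have h2 : (\int[P]_w (- 1 * (zeta w * D w))%:E <= \int[P]_w (m.+1%:R^-1 * `|D w|)%:E)%E.
      apply: mean0_le (mean0_lin (- 1) 0 mS mean0_0) _; [exact: integrableZl iz|exact: integrableZl iaD|].
      move=> w; rewrite mul0r addr0 addrC -lerBlDr -mulrBr -mulrBl (le_trans (ler_norm _))//.
      by rewrite mulN1r normrN normrM ler_wpM2r.
    have E2 : (\int[P]_w (m.+1%:R^-1 * `|D w|)%:E = (m.+1%:R^-1 * I)%:E)%E.
      under eq_integral do rewrite EFinM.
      by rewrite (integralZl measurableT iaD) EFinM fineK.
    have E3 : (\int[P]_w (- 1 * (zeta w * D w))%:E = (- e)%:E)%E.
      under eq_integral do rewrite EFinM.
      by rewrite (integralZl measurableT iz) -(mulN1r e) [RHS]EFinM (fineK fz).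
    have E1 : (\int[P]_w (zeta w * D w)%:E = e%:E)%E by rewrite fineK.
    by move: h1 h2; rewrite E1 E2 E3 !lee_fin => h1 h2; rewrite ler_norml lerNl h2 h1.
  suff e0 : e = 0 by rewrite -(fineK fz) -/e e0.
  apply/eqP/negPn/negP => ne; have ne0 : 0 < `|e| by rewrite normr_gt0.
  have := bnd (Num.truncn (I / `|e|)); rewrite ler_pdivlMl//.
  have := truncnS_gt (I / `|e|); rewrite ltr_pdivrMr//; lra.
have h : mean0 (fun w => (xi w + 1) / 2 * D w).
  apply: unit => [|w]; last by have := xi1 w; rewrite ler_norml => /andP[]; lra.
  apply: (measurable_wrt_comp (f := fun x => (x + 1) / 2)) => //.
  by apply: measurable_funM => //; exact: measurable_funD.
have hD : mean0 D by split => //; exact: D0.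
have := mean0_lin 2 (- 1) h hD; congr mean0.
by apply/funext => w; field.
Qed.

End mean_zero.

Section discrete_measurability.
Context d (T : measurableType d) (R : realType).
Variable X : nat -> T -> R.
Implicit Types (K dl : R).

Lemma measurable_natr_bool (b : T -> bool) : measurable_fun setT b ->
  measurable_fun setT (fun w => (b w)%:R : R).
Proof.
move=> mb; rewrite (_ : (fun w => _) = (fun w => if b w then 1 else 0 : R)); last first.
  by apply/funext => w; case: (b w).
by apply: measurable_fun_ifT.
Qed.

Lemma measurable_vari n : (forall i, (i <= n)%N -> measurable_fun setT (X i)) ->
  measurable_fun setT (fun w => increment_sum (X ^~ w) n).
Proof.
move=> mX; apply: (@measurable_sum _ _ _ _ _ _ (fun (j : 'I_n) w => `|X j.+1 w - X j w|)) => i.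
apply: measurableT_comp => //; apply: measurable_funB; apply: mX => //.
exact: ltnW.
Qed.

Lemma measurable_good K dl n : (forall i, (i <= n)%N -> measurable_fun setT (X i)) ->
  measurable_fun setT (fun w => good (X ^~ w) K dl n).
Proof.
elim: n => [|n ih] mX /=; first by apply: measurable_fun_eqr; [exact: mX|exact: measurable_cst].
apply: measurable_and; first by apply: ih => i ni; apply: mX; rewrite ltnW.
apply: measurable_and; apply: measurable_fun_ler => //; last exact: measurable_vari.
by apply: measurableT_comp => //; apply: measurable_funB; exact: mX.
Qed.

Lemma measurable_bad K dl n : (forall i, (i <= n.+1)%N -> measurable_fun setT (X i)) ->
  measurable_fun setT (fun w => bad (X ^~ w) K dl n).
Proof.
move=> mX; apply: measurable_and; first by apply: measurable_good => i ni; apply: mX; rewrite ltnW.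
apply: measurable_fun_ltr => //.
by apply: measurableT_comp => //; apply: measurable_funB; exact: mX.
Qed.

Lemma measurable_jump dl n : (forall i, (i <= n)%N -> measurable_fun setT (X i)) ->
  measurable_fun setT (fun w => jump (X ^~ w) dl n).
Proof.
elim: n => [|n ih] mX /=; first exact: measurable_cst.
apply: measurable_or; first by apply: ih => i ni; apply: mX; rewrite ltnW.
apply: measurable_fun_ltr => //.
by apply: measurableT_comp => //; apply: measurable_funB; exact: mX.
Qed.

End discrete_measurability.

Lemma continuous_sqrt1D (R : realType) : continuous (fun x : R => Num.sqrt (1 + x ^+ 2)).
Proof.
move=> x; apply: (@cvg_comp _ _ _ (fun x : R => 1 + x ^+ 2) Num.sqrt); last exact: sqrt_continuous.
by apply: cvgD; [exact: cvg_cst|apply: cvgM; exact: cvg_id].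
Qed.

Lemma measurable_softabs (R : realType) : measurable_fun setT (@softabs R).
Proof.
apply: measurable_funB => //; apply: continuous_measurable_fun; exact: continuous_sqrt1D.
Qed.

Lemma measurable_dsoftabs (R : realType) : measurable_fun setT (@dsoftabs R).
Proof.
apply: continuous_measurable_fun => x; apply: cvgM; first exact: cvg_id.
apply: cvgV; first by rewrite gt_eqF// (lt_le_trans ltr01 (sqrt1D_ge1 x)).
exact: continuous_sqrt1D.
Qed.

Lemma measurable_sg (R : realType) : measurable_fun setT (@Num.sg R).
Proof.
rewrite (_ : Num.sg = (fun x : R => (0 < x)%R%:R - (x < 0)%R%:R)).
  by apply: measurable_funB; apply: measurable_natr_bool; exact: measurable_fun_ltr.
by apply/funext => x; case: sgrP; rewrite ?subr0 ?sub0r.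
Qed.

(** * The mean of the pathwise bound along a discrete martingale *)

Section discrete_martingale.
Context d (T : measurableType d) (R : realType) (P : probability T R).
Variables (G : nat -> set (set T)) (X : nat -> T -> R).
Hypothesis sG : forall i, sigma_algebra setT (G i).
Hypothesis Gm : forall i, G i `<=` measurable.
Hypothesis Gle : forall i j, (i <= j)%N -> G i `<=` G j.
Hypothesis mX : forall i, measurable_wrt (G i) (X i).
Hypothesis iX : forall i, P.-integrable setT (EFin \o X i).
Hypothesis cX : forall i j A, (i <= j)%N -> G i A ->
  (\int[P]_(w in A) (X i w)%:E = \int[P]_(w in A) (X j w)%:E)%E.

Let mX' i : measurable_fun setT (X i).
Proof. exact: (measurable_wrt_fun (Gm (i := i))). Qed.

Let mXG n i : (i <= n)%N -> measurable_fun setT (X i : g_sigma_algebraType (G n) -> R).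
Proof. by move=> ni; apply/(measurable_wrtE (sG n)); apply: measurable_wrtS (mX i); exact: Gle. Qed.

Let mean0_incr (xi : T -> R) i j : (i <= j)%N -> measurable_wrt (G i) xi ->
  (forall w, `|xi w| <= 1) -> mean0 P (fun w => xi w * (X j w - X i w)).
Proof.
move=> ij mxi xi1; apply: (mean0_mul (sG i) (Gm (i := i))) => //.
  exact: (integrableB measurableT (iX j) (iX i)).
move=> A GA; have mA := Gm GA.
have iA k : P.-integrable A (EFin \o X k) by exact: integrableS (iX k).
under eq_integral do rewrite EFinB.
rewrite (integralB_EFin mA (iA j) (iA i)) (cX ij GA) subee//.
exact: (integrable_fin_num mA (iA j)).
Qed.

Lemma expectation_bound (K dl : R) (A : set T) N : 0 <= K -> 0 <= dl -> measurable A ->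
  (forall w, A w -> X 0%N w = 0 /\ increment_sum (X ^~ w) N <= K) ->
  (\int[P]_w (\1_A w * softabs (X N w))%:E <=
   \int[P]_w ((jump (X ^~ w) dl N)%:R * (2 * `|X N w| + K) + dl * (K + dl) / 2)%:E)%E.
Proof.
move=> K0 dl0 mA AP.
have iaX : P.-integrable setT (fun w => `|X N w|%:E) by exact: integrable_abse (iX N).
have icst c : P.-integrable setT (EFin \o (fun=> c : R)).
  by apply: finite_measure_integrable_cst.
(* The factor of a bad term is known only at time [i.+1], which is why its increment runs from
   [i.+1] to [N]. *)
pose z w := \sum_(i < N) (1 * ((good (X ^~ w) K dl i)%:R * dsoftabs (X i w) * (X i.+1 w - X i w)) +
  (- 1) * ((bad (X ^~ w) K dl i)%:R * Num.sg (X i.+1 w) * (X N w - X i.+1 w))).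
apply: (mean0_le (z := z)).
- apply: (le_integrable measurableT _ _ (iX N)) => [|w _].
    apply/measurable_EFinP; apply: measurable_funM; first exact: measurable_indic.
    by apply: measurableT_comp (mX' N); exact: measurable_softabs.
  rewrite /= lee_fin ger0_norm ?mulr_ge0 ?softabs_ge0// indicE.
  by case: (_ \in _); rewrite ?mul1r ?mul0r// softabs_le.
- rewrite (_ : _ \o _ = (fun w => ((jump (X ^~ w) dl N)%:R * (2 * `|X N w| + K))%:E + (dl * (K + dl) / 2)%:E)%E)//.
  apply: integrableD => //; last exact: icst.
  apply: integrable_mul_le1.
  + by apply: measurable_natr_bool; apply: measurable_jump => i _.
  + by move=> w; rewrite ger0_norm ?ler0n// lern1 leq_b1.
  + rewrite (_ : _ \o _ = (fun w => 2%:E * `|X N w|%:E + K%:E)%E)//.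
    by apply: integrableD => //; [exact: integrableZl|exact: icst].
- apply: (mean0_sum (h := fun i w => 1 * ((good (X ^~ w) K dl i)%:R * dsoftabs (X i w) * (X i.+1 w - X i w)) +
    (- 1) * ((bad (X ^~ w) K dl i)%:R * Num.sg (X i.+1 w) * (X N w - X i.+1 w)))) => i iN.
  apply: mean0_lin; apply: mean0_incr => //.
  + apply/(measurable_wrtE (sG i)); apply: measurable_funM.
      by apply: measurable_natr_bool; apply: measurable_good => j; exact: mXG.
    by apply: measurableT_comp (mXG (leqnn i)); exact: measurable_dsoftabs.
  + move=> w; rewrite normrM -[leRHS]mulr1 ler_pM ?dsoftabs_le1//.
    by rewrite ger0_norm ?ler0n// lern1 leq_b1.
  + apply/(measurable_wrtE (sG i.+1)); apply: measurable_funM.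
      by apply: measurable_natr_bool; apply: measurable_bad => j; exact: mXG.
    by apply: measurableT_comp (mXG (leqnn i.+1)); exact: measurable_sg.
  + move=> w; rewrite normrM -[leRHS]mulr1 ler_pM//.
      by rewrite ger0_norm ?ler0n// lern1 leq_b1.
    by rewrite normr_sg lern1 leq_b1.
- move=> w; rewrite indicE.
  apply: le_trans (pathwise_bound K0 dl0 (N := N) (u := X ^~ w) _) _; last first.
    rewrite addrA lerD2r lerD2r /z; apply: ler_sum => i _.
    by rewrite mul1r mulN1r.
  by rewrite in_setE; exact: AP.
Qed.

End discrete_martingale.

(** * Uniform partitions of an interval *)

Section uniform_partition.
Context {R : realType}.
Implicit Types (g : R -> R) (t : R) (n i : nat).

Definition grid t n i : R := t * i%:R / n.+1%:R.

Lemma grid0 t n : grid t n 0 = 0.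
Proof. by rewrite /grid mulr0 mul0r. Qed.

Lemma grid_last t n : grid t n n.+1 = t.
Proof. by rewrite /grid mulfK. Qed.

Lemma grid_le t n i j : 0 <= t -> (i <= j)%N -> grid t n i <= grid t n j.
Proof. by move=> t0 ij; rewrite ler_pM2r ?invr_gt0// ler_wpM2l// ler_nat. Qed.

Lemma grid_ge0 t n i : 0 <= t -> 0 <= grid t n i.
Proof. by move=> t0; rewrite -(grid0 t n) grid_le. Qed.

Lemma gridS t n i : grid t n i.+1 - grid t n i = t / n.+1%:R.
Proof. by rewrite /grid -mulrBl -mulrBr -natrB// subSnn mulr1. Qed.

Lemma vari_variations g t n M : 0 < t -> ubound (variations 0 t g) M ->
  increment_sum (fun i => g (grid t n i)) n.+1 <= M.
Proof.
(* [variation] prepends the left end point, so the list starts at the first interior grid point. *)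
move=> t0 ubM; pose l := mkseq (fun i => grid t n i.+1) n.+1.
have nthl i : (i <= n.+1)%N -> nth t (0 :: l) i = grid t n i.
  by case: i => [|i] ni; [rewrite grid0|rewrite /= nth_mkseq].
have -> : increment_sum (fun i => g (grid t n i)) n.+1 = variation 0 t g l.
  rewrite /increment_sum /variation size_mkseq big_mkord; apply: eq_bigr => i _.
  by rewrite /= -[nth t l i]/(nth t (0 :: l) i.+1) !nthl// ltnW.
apply: ubM; exists l => //; split.
  apply/(pathP t) => i; rewrite size_mkseq => ni.
  rewrite nthl ?(ltnW ni)// -[nth t l i]/(nth t (0 :: l) i.+1) nthl//.
  by rewrite -subr_gt0 gridS divr_gt0.
rewrite (last_nth t) size_mkseq -{2}(grid_last t n); apply/eqP.
by rewrite -[LHS]/(nth t (0 :: l) n.+1) nthl.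
Qed.

Lemma uniform_no_jump g t dl : 0 <= t -> 0 < dl -> {within `[0, +oo[, continuous g} ->
  \forall n \near \oo, jump (fun i => g (grid t n i)) dl n.+1 = false.
Proof.
move=> t0 dl0 /subspace_continuousP cg.
pose Q n x := `[0, t]%classic x -> forall y, `[0, t]%classic y -> `|y - x| <= t / n.+1%:R -> `|g y - g x| <= dl.
have /compact_near_coveringP/(_ nat \oo Q _) H := @segment_compact R 0 t.
have {}H : \forall n \near \oo, `[0, t] `<=` Q n.
  apply: H => x xt.
  have x0 : `[0, +oo[%classic x by move: xt; rewrite /= !in_itv/= andbT => /andP[].
  have d2 : 0 < dl / 2 by lra.
  have /cvgrPdist_lt /(_ _ d2) := cg x x0.
  move=> /nbhs_ballP[e /= e0 he].
  have e2 : 0 < e / 2 by lra.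
  have e3 : 0 < e / 2 / (t + 1) by rewrite divr_gt0// ltr_wpDl.
  exists (ball x (e / 2), [set n | n.+1%:R^-1 < e / 2 / (t + 1)]); first split => /=.
  - exact: nbhsx_ballx.
  - exact: (near_infty_natSinv_lt (PosNum e3)).
  move=> [x' n] /= [xx' ne] x't y yt yx'.
  have tn : t / n.+1%:R < e / 2.
    move: ne; rewrite ltr_pdivlMr ?ltr_wpDl// mulrC mulrDl mul1r => ne.
    have : 0 < n.+1%:R^-1 :> R by rewrite invr_gt0.
    by move: ne; set z := _^-1; lra.
  have xx2 : `|x - x'| < e / 2 by [].
  have hx' : `|g x - g x'| < dl / 2.
    apply: he; last by move: x't; rewrite /= !in_itv/= andbT => /andP[].
    by rewrite /ball/=; lra.
  have hy : `|g x - g y| < dl / 2.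
    apply: he; last by move: yt; rewrite /= !in_itv/= andbT => /andP[].
    have yx2 : `|x' - y| < e / 2 by rewrite distrC (le_lt_trans yx').
    by apply: (le_lt_trans (ler_distD x' x y)); rewrite (splitr e) ltrD.
  rewrite distrC in hy; apply: (le_trans (ler_distD (g x) (g y) (g x'))).
  by rewrite (splitr dl) lerD// ltW.
apply: filterS H => n H; apply/negP => /jumpP[i ni].
apply/negP; rewrite -leNgt; apply: H.
- by rewrite /= in_itv/= grid_ge0//= -[leRHS](grid_last t n) grid_le// ltnW.
- by rewrite /= in_itv/= grid_ge0//= -[leRHS](grid_last t n) grid_le// ltnW.
- by rewrite /= in_itv/= grid_ge0//= -[leRHS](grid_last t n) grid_le.
- by rewrite gridS ger0_norm// divr_ge0.
Qed.

End uniform_partition.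

(** * Continuous martingales on the event of bounded variation *)

Section martingale_bounded_variation.
Context d (T : measurableType d) (R : realType) (P : probability T R).
Context (F : R -> set (set T)).
Hypothesis uF : usual_filtration P F.
Variable Y : process R T.
Hypotheses (mY : martingale P F Y) (cY : continuous_paths P Y) (sY : starts_at0 P Y).

Let Fsig t : 0 <= t -> sigma_algebra setT (F t).
Proof. exact: (filtration_sigma uF). Qed.

Let mYt t : 0 <= t -> measurable_fun setT (Y t).
Proof.
move=> t0; have [aY _ _] := mY.
exact: (measurable_wrt_fun (filtration_measurable uF t0) (aY t t0)).
Qed.

(** Bounding the variation along countably many grids, instead of all partitions, gives a measurable
    event. *)
Let lowvar (t : R) (k : nat) := [set w | Y 0 w = 0 /\
  forall n, increment_sum (fun i => Y (grid t n i) w) n.+1 <= k%:R].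

Let measurable_lowvar t k : 0 <= t -> measurable (lowvar t k).
Proof.
move=> t0; rewrite (_ : lowvar t k = Y 0 @^-1` [set 0] `&`
  \bigcap_n (fun w => increment_sum (fun i => Y (grid t n i) w) n.+1) @^-1` `]-oo, k%:R]); last first.
  apply/seteqP; split => w /= [h1 h2]; split => // n; first by rewrite /= in_itv/=.
  by have := h2 n I; rewrite /= in_itv.
apply: measurableI; first by rewrite -[_ @^-1` _]setTI; exact: mYt.
apply: bigcap_measurable => // n _; rewrite -[_ @^-1` _]setTI.
apply: (measurable_vari (X := fun i => Y (grid t n i))) => // i _.
by apply: mYt; exact: grid_ge0.
Qed.

(** As the grid is refined, uniform continuity of the paths removes the jump term, with an
    integrable multiple of [|Y t|] plus a constant as dominating function; the constant term
    remains. *)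
Let lowvar_bound t k dl : 0 <= t -> 0 < dl ->
  (\int[P]_w (\1_(lowvar t k) w * softabs (Y t w))%:E <= (dl * (k%:R + dl) / 2)%:E)%E.
Proof.
move=> t0 dl0; have [aY iY eY] := mY.
have iaY : P.-integrable setT (fun w => `|Y t w|%:E) by exact: integrable_abse (iY t t0).
have icst c : P.-integrable setT (EFin \o (fun=> c : R)).
  by apply: finite_measure_integrable_cst.
set c := dl * (k%:R + dl) / 2.
have c0 : 0 <= c by rewrite /c divr_ge0// mulr_ge0 ?addr_ge0 ?ler0n// ltW.
pose f n w := ((jump (fun i => Y (grid t n i) w) dl n.+1)%:R * (2 * `|Y t w| + k%:R) + c)%:E.
have bnd n : (\int[P]_w (\1_(lowvar t k) w * softabs (Y t w))%:E <= \int[P]_w f n w)%E.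
  have p0 i := grid_ge0 n i t0.
  have := @expectation_bound _ T R P (fun i => F (grid t n i)) (fun i => Y (grid t n i))
    (fun i => Fsig (p0 i)) (fun i => filtration_measurable uF (p0 i))
    (fun i j ij => filtration_le uF (p0 i) (grid_le n t0 ij))
    (fun i => aY _ (p0 i)) (fun i => iY _ (p0 i)) _ k%:R dl (lowvar t k) n.+1.
  rewrite grid_last; apply => //.
  - move=> i j A ij FA; have [_ _] := eY _ _ (p0 i) (grid_le n t0 ij); exact.
  - exact: ltW.
  - exact: measurable_lowvar.
  - by move=> w [w0 wk]; rewrite grid0.
have fcvg : (\int[P]_w f n w)%E @[n --> \oo] --> (\int[P]_w c%:E)%E.
  have [] // := @dominated_convergence _ T R P setT measurableT f (cst c%:E)
    (fun w => (2 * `|Y t w| + k%:R + c)%:E).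
  - move=> n; apply/measurable_EFinP; apply: measurable_funD => //; apply: measurable_funM.
      apply: measurable_natr_bool; apply: (measurable_jump (X := fun i => Y (grid t n i))) => i _.
      by apply: mYt; exact: grid_ge0.
    apply: measurable_funD => //; apply: measurable_funM => //.
    by apply: measurableT_comp => //; exact: mYt.
  - apply: filterS cY => w cw _.
    apply: cvg_near_cst; have := uniform_no_jump t0 dl0 cw.
    by apply: filterS => n; rewrite /f => ->; rewrite mul0r add0r.
  - rewrite (_ : (fun w => _) = (fun w => 2%:E * `|Y t w|%:E + (k%:R + c)%:E)%E); last first.
      by apply/funext => w; rewrite -EFinM -EFinD addrA.
    by apply: integrableD => //; [exact: integrableZl|exact: icst].
  - apply: aeW => w n _; rewrite /f /= lee_fin.
    have q0 : 0 <= 2 * `|Y t w| + k%:R by rewrite addr_ge0// mulr_ge0.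
    by case: (_ || _); rewrite ?mul1r ?mul0r ?add0r ger0_norm ?addr_ge0// lerDr.
rewrite (_ : c%:E = (\int[P]_w c%:E)%E); last first.
  by rewrite (integral_cst P)// [X in (_ * X)%E](probability_setT P) mule1.
by apply: (cvge_to_ge fcvg); near=> n; exact: bnd.
Unshelve. all: by end_near.
Qed.

(** [lowvar_bound] with [dl -> 0], then a countable union over [k]. Bounded variation is a premise
    for each path, since the approximating martingales inherit it from their limit only on part of
    the space. *)
Lemma martingale_bv0 t : 0 <= t ->
  {ae P, forall w, bounded_variation 0 t (Y ^~ w) -> Y t w = 0}.
Proof.
rewrite le_eqVlt => /predU1P[<-|t0]; first by apply: filterS sY => w ->.
have t0' := ltW t0.
have H k : {ae P, forall w, lowvar t k w -> Y t w = 0}.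
  have m1 : measurable_fun setT (fun w => \1_(lowvar t k) w * softabs (Y t w)).
    apply: measurable_funM; first exact/measurable_indic/measurable_lowvar.
    by apply: measurableT_comp (mYt t0'); exact: measurable_softabs.
  have p0 w : 0 <= \1_(lowvar t k) w * softabs (Y t w) by rewrite mulr_ge0// softabs_ge0.
  have e0 : (\int[P]_w (\1_(lowvar t k) w * softabs (Y t w))%:E = 0)%E.
    have i0 : (0 <= \int[P]_w (\1_(lowvar t k) w * softabs (Y t w))%:E)%E.
      by apply: integral_ge0 => w _; rewrite lee_fin.
    have B dl := @lowvar_bound t k dl t0'.
    have fe : (\int[P]_w (\1_(lowvar t k) w * softabs (Y t w))%:E \is a fin_num)%E.
      by rewrite ge0_fin_numE// (le_lt_trans (B 1 ltr01))// ltry.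
    move: i0 B; rewrite -(fineK fe); set e := fine _; rewrite lee_fin => i0 B.
    congr EFin; apply/eqP; rewrite eq_le i0 andbT leNgt; apply/negP => ep.
    have k2 : 0 < k%:R + 2 :> R by rewrite ltr_wpDl.
    pose dl := Num.min 1 (e / (k%:R + 2)).
    have dl0 : 0 < dl by rewrite lt_min ltr01/= divr_gt0.
    have dl1 : dl <= 1 by rewrite ge_min lexx.
    have dle : dl * (k%:R + 2) <= e by rewrite -ler_pdivlMr// ge_min lexx orbT.
    have := B dl dl0; rewrite lee_fin; apply/negP; rewrite -ltNge.
    have : dl * (k%:R + dl) <= dl * (k%:R + 2) by rewrite ler_pM2l// lerD2l; lra.
    lra.
  have /ae_eq_integral_abs : measurable_fun setT (EFin \o (fun w => \1_(lowvar t k) w * softabs (Y t w))).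
    exact/measurable_EFinP.
  move=> /(_ P measurableT) [+ _].
  under eq_integral do rewrite /= ger0_norm//.
  move=> /(_ e0); apply: filterS => w /(_ I) /= [] + wk.
  by rewrite indicE mem_set// mul1r => /softabs_eq0.
have := ae_foralln H; apply: filterS2 sY => w w0 h [M ubM].
apply: (h (Num.truncn M).+1); split => // n.
by apply: le_trans (vari_variations n t0 ubM) _; exact/ltW/truncnS_gt.
Qed.

End martingale_bounded_variation.

Section bounded_variation_facts.
Context {R : realType}.
Implicit Types (g h : R -> R) (t : R).

Lemma eq_bounded_variation g h t : 0 <= t -> (forall s, 0 <= s <= t -> g s = h s) ->
  bounded_variation 0 t g -> bounded_variation 0 t h.
Proof.
move=> t0 gh [M ubM]; exists M => _ [l pl <-]; apply: ubM; exists l => //.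
rewrite /variation; apply: eq_big_nat => i /andP[_ il] /=.
have mem j : (j < (size l).+1)%N -> g (nth t (0 :: l) j) = h (nth t (0 :: l) j).
  by move=> jl; rewrite gh// (itv_partition_nth_ge jl pl) (itv_partition_nth_le jl pl).
by have := mem i (ltnW il); have := mem i.+1 il => /= -> ->.
Qed.

Lemma bounded_variationB0 g h t : 0 <= t -> bounded_variation 0 t g -> bounded_variation 0 t h ->
  bounded_variation 0 t (fun s => g s - h s).
Proof.
rewrite le_eqVlt => /predU1P[<- _ _|t0 bg bh]; first exact: bounded_variationxx.
exact: bounded_variationD t0 bg (bounded_variationN bh).
Qed.

Lemma bounded_variationD0 g h t : 0 <= t -> bounded_variation 0 t g -> bounded_variation 0 t h ->
  bounded_variation 0 t (fun s => g s + h s).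
Proof.
rewrite le_eqVlt => /predU1P[<- _ _|t0 bg bh]; first exact: bounded_variationxx.
exact: bounded_variationD t0 bg bh.
Qed.

Lemma within_stopped g (tau : \bar R) : (0 <= tau)%E -> {within `[0, +oo[, continuous g} ->
  {within `[0, +oo[, continuous (fun t => g (fine (Order.min t%:E tau)))}.
Proof.
case: tau => [r| |//] r0 cg.
  rewrite (_ : (fun t => _) = (fun t => g (Num.min t r))); first exact: within_continuous_min.
  by apply/funext => t; rewrite -EFin_min.
rewrite (_ : (fun t => _) = g)//.
by apply/funext => t; rewrite min_l ?leey.
Qed.

(** Countably many times suffice, so null sets attached to single times can be gathered into one. *)
Lemma zero_on_fractions g : {within `[0, +oo[, continuous g} ->
  (forall k m : nat, g (k%:R / m.+1%:R) = 0) -> forall t, 0 <= t -> g t = 0.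
Proof.
move=> /subspace_continuousP cg g0 t t0; apply/eqP/negPn/negP => gt.
have ng : 0 < `|g t| by rewrite normr_gt0.
have tin : `[0, +oo[%classic t by rewrite /= in_itv/= andbT.
have /cvgrPdist_lt /(_ _ ng) := cg t tin.
move=> /nbhs_ballP[e /= e0 he].
pose m := Num.truncn e^-1; pose k := Num.truncn (t * m.+1%:R).
have m0 : 0 < m.+1%:R :> R by [].
have me : m.+1%:R^-1 < e by rewrite invf_plt ?posrE// truncnS_gt.
have kt := truncn_itv (mulr_ge0 t0 (ltW m0)); have /andP[k1 k2] := kt.
have : `|g t - g (k%:R / m.+1%:R)| < `|g t|.
  apply: he; last by rewrite /= in_itv/= andbT divr_ge0.
  rewrite /ball/= ger0_norm; last by rewrite subr_ge0 ler_pdivrMr.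
  apply: le_lt_trans me.
  rewrite lerBlDr -[X in _ <= X + _]mul1r -mulrDl ler_pdivlMr// addrC natr1.
  exact: ltW.
by rewrite g0 subr0 ltxx.
Qed.

End bounded_variation_facts.

(** * Uniqueness of martingale parts and additivity of brackets *)

Section eventual_martingales.
Context d (T : measurableType d) (R : realType) (P : probability T R).
Context (F : R -> set (set T)).
Hypothesis uF : usual_filtration P F.
Implicit Types (L X Y M N K Q C : process R T) (t : R).

Lemma continuous_paths2 (op : R -> R -> R) X Y :
  (forall x y, (fun z => op z.1 z.2) @ (x, y) --> op x y) ->
  continuous_paths P X -> continuous_paths P Y ->
  continuous_paths P (fun t w => op (X t w) (Y t w)).
Proof.
by move=> cop; apply: filterS2 => w cX cY; exact: (within_continuous2 cop cX cY).
Qed.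

Lemma continuous_paths_lin (a b : R) X Y : continuous_paths P X -> continuous_paths P Y ->
  continuous_paths P (fun t w => a * X t w + b * Y t w).
Proof. by apply: filterS2 => w cX cY; exact: within_continuous_lin. Qed.

(* Unlike local martingales, this class is closed under linear combinations without any comparison of
   stopping times. *)
Definition eventual_martingale L : Prop := exists2 Y : nat -> process R T,
  forall n, [/\ martingale P F (Y n), continuous_paths P (Y n) & starts_at0 P (Y n)] &
  {ae P, forall w t, 0 <= t -> exists n0, forall n s, (n0 <= n)%N -> 0 <= s <= t ->
     Y n s w = L s w}.

(** Once [tau n] exceeds [t], stopping changes nothing on [[0, t]]. *)
Lemma local_martingale_eventual L : local_martingale P F L -> continuous_paths P L ->
  starts_at0 P L -> eventual_martingale L.
Proof.
move=> [tau [stau _ ctau mtau]] cL sL; exists (fun n => stopped (tau n) L).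
  move=> n; have [tau0 _] := stau n; split => //.
    by apply: filterS cL => w cw; exact: (within_stopped (g := L ^~ w) (tau0 w) cw).
  by apply: filterS sL => w w0; rewrite /stopped min_l.
apply: filterS ctau => w /cvgeyPge cw t t0; have [n0 _ h] := cw t.
exists n0 => n s nn /andP[s0 st]; rewrite /stopped min_l// (le_trans _ (h n nn))//.
Qed.

Lemma eventual_martingale_lin (a b : R) L L' : eventual_martingale L -> eventual_martingale L' ->
  eventual_martingale (fun t w => a * L t w + b * L' t w).
Proof.
move=> [Y hY eY] [Z hZ eZ]; exists (fun n t w => a * Y n t w + b * Z n t w).
  move=> n; have [mY cY sY] := hY n; have [mZ cZ sZ] := hZ n; split.
  - exact: (martingale_lin (filtration_sigma uF) (filtration_measurable uF)).
  - exact: continuous_paths_lin.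
  - by apply: filterS2 sY sZ => w -> ->; rewrite !mulr0 addr0.
apply: filterS2 eY eZ => w hy hz t t0.
have [n1 h1] := hy t t0; have [n2 h2] := hz t t0.
exists (maxn n1 n2) => n s; rewrite geq_max => /andP[nn1 nn2] st.
by rewrite h1// h2.
Qed.

(** On a given path and up to a given fraction, some [Y n] coincides with [L], hence has bounded
    variation there and vanishes by [martingale_bv0]. *)
Lemma eventual_martingale_bv0 L : eventual_martingale L -> continuous_paths P L ->
  {ae P, forall w, forall t, 0 <= t -> bounded_variation 0 t (L ^~ w)} ->
  {ae P, forall w, forall t, 0 <= t -> L t w = 0}.
Proof.
move=> [Y hY eY] cL bL.
have H : {ae P, forall w, forall n k m : nat,
    bounded_variation 0 (k%:R / m.+1%:R) (Y n ^~ w) -> Y n (k%:R / m.+1%:R) w = 0}.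
  apply: ae_foralln => n; apply: ae_foralln => k; apply: ae_foralln => m.
  have [mY cY sY] := hY n; by apply: (martingale_bv0 uF mY cY sY); rewrite divr_ge0.
apply: filterS2 (filterI cL bL) (filterI eY H) => w [cw bw] [ew hw].
apply: (zero_on_fractions cw) => k m; set q := _ / _.
have q0 : 0 <= q by rewrite divr_ge0.
have [n hn] := ew q q0.
have E s : 0 <= s <= q -> Y n s w = L s w by exact: hn.
rewrite -E ?q0 ?lexx//; apply: hw; apply: eq_bounded_variation (bw q q0) => // s sq.
by rewrite E.
Qed.

Lemma martingale_part_eventual X M : martingale_part P F X M -> eventual_martingale M.
Proof. by move=> [[lM cM sM] _]; exact: local_martingale_eventual. Qed.

(** [M - M'] is also the difference of the finite variation parts [X - M'] and [X - M]. *)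
Lemma martingale_part_unique X M M' : martingale_part P F X M -> martingale_part P F X M' ->
  {ae P, forall w t, 0 <= t -> M t w = M' t w}.
Proof.
move=> pM pM'; have eM := martingale_part_eventual pM; have eM' := martingale_part_eventual pM'.
have [[_ cM _] [_ _ _ bM]] := pM; have [[_ cM' _] [_ _ _ bM']] := pM'.
have := eventual_martingale_bv0 (eventual_martingale_lin 1 (-1) eM eM') (continuous_paths_lin 1 (-1) cM cM').
move=> H; apply: filterS (H _) => [w h t t0|].
  by apply/eqP; rewrite -subr_eq0 -(h t t0) mul1r mulN1r.
apply: filterS2 bM bM' => w b b' t t0.
apply: eq_bounded_variation (bounded_variationB0 t0 (b' t t0) (b t t0)) => // s _.
by ring.
Qed.

Lemma martingale_part_add X Y M N K : martingale_part P F X M -> martingale_part P F Y N ->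
  martingale_part P F (fun t w => X t w + Y t w) K ->
  {ae P, forall w t, 0 <= t -> K t w = M t w + N t w}.
Proof.
move=> pM pN pK; have eM := martingale_part_eventual pM; have eN := martingale_part_eventual pN.
have eK := martingale_part_eventual pK.
have [[_ cM _] [_ _ _ bM]] := pM; have [[_ cN _] [_ _ _ bN]] := pN.
have [[_ cK _] [_ _ _ bK]] := pK.
have H := eventual_martingale_bv0 (eventual_martingale_lin 1 (-1) eK (eventual_martingale_lin 1 1 eM eN))
  (continuous_paths_lin 1 (-1) cK (continuous_paths_lin 1 1 cM cN)).
apply: filterS (H _) => [w h t t0|].
  by apply/eqP; rewrite -subr_eq0 -(h t t0); apply/eqP; ring.
apply: filterS2 bK (filterI bM bN) => w b [b1 b2] t t0.
apply: eq_bounded_variation (bounded_variationB0 t0 (bounded_variationD0 t0 (b1 t t0) (b2 t t0)) (b t t0)) => // s _.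
by ring.
Qed.

Lemma characteristic_ge0 X Q : characteristic P F X Q -> {ae P, forall w t, 0 <= t -> 0 <= Q t w}.
Proof.
move=> [M _ [_ _ sQ iQ _]]; apply: filterS2 sQ iQ => w w0 iw t t0.
by rewrite -w0; apply: iw => //; rewrite in_itv/= ?lexx ?t0.
Qed.

Lemma characteristic_bv X Q : characteristic P F X Q ->
  {ae P, forall w t, 0 <= t -> bounded_variation 0 t (Q ^~ w)}.
Proof.
move=> [M _ [_ _ _ iQ _]]; apply: filterS iQ => w iw t t0.
apply: nondecreasing_bounded_variation => x y.
by rewrite !in_itv/= => /andP[x0 _] /andP[y0 _]; apply: iw; rewrite in_itv/= andbT.
Qed.

Let cmulB : forall x y : R, (fun z : R * R => z.1 ^+ 2 - z.2) @ (x, y) --> x ^+ 2 - y.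
Proof. by move=> x y; apply: cvgB; [apply: cvgM; exact: cvg_fst|exact: cvg_snd]. Qed.

Let cmul : forall x y : R, (fun z : R * R => z.1 * z.2) @ (x, y) --> x * y.
Proof. by move=> x y; apply: cvgM; [exact: cvg_fst|exact: cvg_snd]. Qed.

Let compensated X M Q : martingale_part P F X M -> continuous_paths P Q -> starts_at0 P Q ->
  local_martingale P F (fun t w => M t w ^+ 2 - Q t w) ->
  eventual_martingale (fun t w => M t w ^+ 2 - Q t w) /\ continuous_paths P (fun t w => M t w ^+ 2 - Q t w).
Proof.
move=> [[_ cM sM] _] cQ sQ lQ.
have c : continuous_paths P (fun t w => M t w ^+ 2 - Q t w).
  exact: (continuous_paths2 (op := fun x y => x ^+ 2 - y)).
split => //; apply: local_martingale_eventual => //.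
by apply: filterS2 sM sQ => w -> ->; rewrite expr0n/= subr0.
Qed.

Lemma characteristic_add X Y QX QY QXY C :
  characteristic P F X QX -> characteristic P F Y QY ->
  characteristic P F (fun t w => X t w + Y t w) QXY -> mutual_characteristic P F X Y C ->
  {ae P, forall w t, 0 <= t -> QXY t w = QX t w + QY t w + 2 * C t w}.
Proof.
move=> hX hY hXY hC.
have bX := characteristic_bv hX; have bY := characteristic_bv hY; have bXY := characteristic_bv hXY.
have [M1 pM1 [_ cX sX _ lX]] := hX; have [N1 pN1 [_ cY sY _ lY]] := hY.
have [K pK [_ cXY sXY _ lXY]] := hXY; have [M2 [N2 [pM2 pN2 [_ cC sC bC] lC]]] := hC.
have [eX cX'] := compensated pM1 cX sX lX; have [eY cY'] := compensated pN1 cY sY lY.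
have [eXY cXY'] := compensated pK cXY sXY lXY.
have [[_ cM2 sM2] _] := pM2; have [[_ cN2 sN2] _] := pN2.
have cC' : continuous_paths P (fun t w => M2 t w * N2 t w - C t w).
  have := continuous_paths_lin 1 (-1) (continuous_paths2 cmul cM2 cN2) cC.
  by congr continuous_paths; apply/funext => t; apply/funext => w; ring.
have eC : eventual_martingale (fun t w => M2 t w * N2 t w - C t w).
  apply: local_martingale_eventual => //.
  by apply: filterS3 sM2 sN2 sC => w -> -> ->; rewrite mul0r subr0.
have H := eventual_martingale_bv0
  (eventual_martingale_lin 1 (-1) eXY (eventual_martingale_lin 1 1 eX (eventual_martingale_lin 1 2 eY eC)))
  (continuous_paths_lin 1 (-1) cXY' (continuous_paths_lin 1 1 cX' (continuous_paths_lin 1 2 cY' cC'))).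
have U : {ae P, forall w t, 0 <= t ->
    1 * (K t w ^+ 2 - QXY t w) + -1 * (1 * (M1 t w ^+ 2 - QX t w) + 1 *
      (1 * (N1 t w ^+ 2 - QY t w) + 2 * (M2 t w * N2 t w - C t w))) =
    QX t w + QY t w + (C t w + C t w) - QXY t w}.
  apply: filterS3 (martingale_part_unique pM1 pM2) (martingale_part_unique pN1 pN2)
    (martingale_part_add pM2 pN2 pK) => w h1 h2 h3 t t0.
  by rewrite h1// h2// h3//; ring.
have := U; apply: filterS2 (H _) => [w h u t t0|].
  by have := u t t0; rewrite h// => /esym; lra.
apply: filterS3 U (filterI bX bY) (filterI bXY bC) => w u [b1 b2] [b3 b4] t t0.
have b5 := bounded_variationB0 t0 (bounded_variationD0 t0 (bounded_variationD0 t0 (b1 t t0) (b2 t t0))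
  (bounded_variationD0 t0 (b4 t t0) (b4 t t0))) (b3 t t0).
apply: eq_bounded_variation b5 => // s /andP[s0 _].
by rewrite u.
Qed.

(** The shift contributes [c * C] to the exponent and the bracket of the sum contributes
    [- c / 2 * (2 * C)]. The formula for [f] requires the brackets to be nonnegative. *)
Lemma exp_form_solves_on (V : process R T -> Prop) (f : R -> R -> R) (c : R) :
  (forall u v : R, 0 <= u -> f u v = expR (c * v - c / 2 * u)) -> solves_on P F V f.
Proof.
move=> fE X Y _ _ QX QY QXY C hX hY hXY hC t t0.
apply: filterS3 (characteristic_ge0 hX) (characteristic_ge0 hY)
  (filterI (characteristic_ge0 hXY) (characteristic_add hX hY hXY hC)) => w h1 h2 [h3 h4].
by rewrite !fE ?h1 ?h2 ?h3// h4// -expRD; congr expR; field.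
Qed.

End eventual_martingales.

Theorem theorem2 (d : measure_display) (T : measurableType d) (R : realType)
    (P : probability T R) (F : R -> set (set T)) (W : process R T)
    (f : R -> R -> R) :
  measure_is_complete P ->
  usual_filtration P F ->
  brownian_motion P F W ->
  let asrt_a := continuous_positive f /\ solves_on P F (semimartingale0 P F) f in
  let asrt_b := continuous_positive f /\ solves_on P F (indicator_integrals P F W) f in
  let asrt_c := exists c : R, forall u v : R, 0 <= u -> f u v = expR (c * v - c / 2 * u) in
  let asrt_d := [/\ continuous_positive f, f 0 0 = 1 &
    exists lambda1 lambda2 : R,
      [/\ martingale P (natural_filtration W)
            (fun t w => f t (W t w) / expR (lambda1 * t)),
          martingale P (natural_filtration W)
            (fun t w => f t (W t w) ^+ 2 / expR (lambda2 * t)) &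
          martingale P (natural_filtration W)
            (fun t w => f (4 * t) (2 * W t w + t) / expR (lambda2 * t))]] in
  [/\ asrt_a <-> asrt_d, asrt_b <-> asrt_d & asrt_c <-> asrt_d].
Proof.
move=> _ uF bW A B C D.
have CD : C <-> D.
  split=> [ef|[cf f00 [l1 [l2 [M1 M2 M3]]]]]; first exact: (exp_form_martingales uF bW).
  exact: (martingales_exp_form uF bW cf f00 M1 M2 M3).
have solves V : C -> continuous_positive f /\ solves_on P F V f.
  move=> ef; split; first exact: exp_form_continuous_positive.
  by case: ef => c fE; exact: (exp_form_solves_on uF (c := c)).
have AC : A <-> C.
  split=> [[cf sf]|]; last exact: solves.
  apply: (solves_on_exp_form uF bW _ cf sf) => a b ab.
  exact: (brownian_step_semimartingale uF bW).
have BC : B <-> C.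
  split=> [[cf sf]|]; last exact: solves.
  apply: (solves_on_exp_form uF bW _ cf sf) => a b ab.
  exact: (brownian_step_indicator_integral uF bW).
by split=> //; [rewrite AC|rewrite BC].
Qed.
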